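(* Suppose $\mathbb{E}|S_1|^{2+\delta}<\infty$ for some $\delta>0$. There exist constants $C_1,C_2>0$ such that for any $\theta>0$ and any positive sequence $\{b_n\}$ with $b_n\to\infty$ and $b_n=o(n^{1/\theta})$, $$\begin{aligned}-C_1&\le\liminf_{n\to\infty}b_n^{-\theta}\log\mathbb{P}\Big\{\mathbb{E}B_n-B_n\ge\theta(2\pi)^{-1}\det(\Gamma)^{-1/2}n\log b_n\Big\}\\&\le\limsup_{n\to\infty}b_n^{-\theta}\log\mathbb{P}\Big\{\mathbb{E}B_n-B_n\ge\theta(2\pi)^{-1}\det(\Gamma)^{-1/2}n\log b_n\Big\}\le -C_2.\end{aligned}$$
   Context: Let $S_n=X_1+\cdots+X_n$, $S_0=0$, be a random walk on $\mathbb{Z}^2$ with i.i.d. increments $X_i$ that are symmetric ($X_1\stackrel{d}{=}-X_1$) and have finite second moments, with covariance matrix $\Gamma$. Standing assumptions: the smallest group which supports $\{S_n\}$ is $\mathbb{Z}^2$ (i.e. the smallest subgroup of $\mathbb{Z}^2$ containing $\{x:\mathbb{P}(S_1=x)>0\}$ is $\mathbb{Z}^2$), and the walk is strongly aperiodic (for each $x\in\mathbb{Z}^2$, the smallest subgroup containing $\{x+z:\mathbb{P}(S_1=z)>0\}$ is $\mathbb{Z}^2$). The self-intersection local time up to time $n$ is $B_n=\sum_{1\le j<k\le n}\delta(S_j,S_k)$, where $\delta(x,y)=1$ if $x=y$ and $0$ otherwise (the function $\delta(\cdot,\cdot)$ is unrelated to the moment exponent $\delta$ in the claim). *)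

(* Defs.v *)
From HB Require Import structures.
From mathcomp Require Import all_boot all_order all_algebra.
From mathcomp Require Import finmap.
From mathcomp Require Import all_classical all_reals all_analysis.

Set Implicit Arguments.
Unset Strict Implicit.
Unset Printing Implicit Defensive.

Import Order.TTheory GRing.Theory Num.Theory.
Import numFieldNormedType.Exports.

Local Open Scope classical_set_scope.
Local Open Scope ring_scope.

(* [int] and [int * int] carry no sigma-algebra in the library: the lattice is
   an alias of [int * int] on which every subset is measurable. *)
Definition Z2 : Type := (int * int)%type.

HB.instance Definition _ := GRing.Zmodule.copy Z2 (int * int)%type.
HB.instance Definition _ := isPointed.Build Z2 0.
HB.instance Definition _ := @isMeasurable.Build default_measure_display
  Z2 (@discrete_measurable Z2) (@discrete_measurable0 Z2)
  (@discrete_measurableC Z2) (@discrete_measurableU Z2).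

Definition subgroup_gen (A : set Z2) : set Z2 :=
  smallest [set H : set Z2 | zmod_closed [in H]] A.

Section walk.
Context {R : realType}.

Definition zcoord (i : 'I_2) (z : Z2) : R :=
  if i == 0 then (z.1)%:~R else (z.2)%:~R.

Definition enorm (z : Z2) : R := Num.sqrt (\sum_(i < 2) zcoord i z ^+ 2).

Context {d : measure_display} {T : measurableType d} (P : probability T R).

(* The product rule is required for all events over all finite subfamilies. *)
Definition mutually_independent (X : nat -> {RV P >-> Z2}) : Prop :=
  forall (J : {fset nat}) (A : nat -> set Z2),
    P (\bigcap_(i in [set` J]) (X i @^-1` A i)) =
    (\prod_(i <- J) P (X i @^-1` A i))%E.

Definition identically_distributed (X : nat -> {RV P >-> Z2}) : Prop :=
  forall i, distribution P (X i) = distribution P (X 0%N) :> (set Z2 -> \bar R).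

Definition symmetric_law (Y : {RV P >-> Z2}) : Prop :=
  forall A : set Z2, P [set t | A (Y t)] = P [set t | A (- Y t)].

Definition norm_moment (p : R) (Y : {RV P >-> Z2}) : \bar R :=
  'E_P[fun t => (enorm (Y t) `^ p)%R]%E.

Definition cov_matrix (Y : {RV P >-> Z2}) : 'M[R]_2 :=
  \matrix_(i, j) fine (covariance P (zcoord i \o Y) (zcoord j \o Y)).

Definition atoms (Y : {RV P >-> Z2}) : set Z2 :=
  [set z | (0 < P (Y @^-1` [set z]))%E].

Definition strongly_aperiodic (Y : {RV P >-> Z2}) : Prop :=
  forall x : Z2, subgroup_gen [set x + z | z in atoms Y] = setT.

(* Increments are indexed from 0: the [X i] here is X_{i+1}; the law of
   S_1 is that of [X 0]. *)
Record symmetric_walk (X : nat -> {RV P >-> Z2}) : Prop := SymmetricWalk {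
  walk_indep : mutually_independent X;
  walk_ident : identically_distributed X;
  walk_sym : symmetric_law (X 0%N);
  walk_moment2 : (norm_moment 2 (X 0%N) < +oo)%E;
  walk_group : subgroup_gen (atoms (X 0%N)) = setT;
  walk_aper : strongly_aperiodic (X 0%N) }.

Definition S_ (X : nat -> {RV P >-> Z2}) (n : nat) (t : T) : Z2 :=
  \sum_(i < n) X i t.

Definition B_ (X : nat -> {RV P >-> Z2}) (n : nat) (t : T) : R :=
  \sum_(1 <= k < n.+1) \sum_(1 <= j < k) (S_ X j t == S_ X k t)%:R.

Definition deviation_event (X : nat -> {RV P >-> Z2}) (theta : R)
    (b : nat -> R) (n : nat) : set T :=
  [set t | ('E_P[B_ X n] - (B_ X n t)%:E >=
    (theta * (2 * pi)^-1 * (\det (cov_matrix (X 0%N))) `^ (- 2^-1) *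
     n%:R * ln (b n))%:E)%E].

(* [lne] takes the value -oo at 0, so the logarithm of a null event is -oo. *)
Definition scaled_log_prob (X : nat -> {RV P >-> Z2}) (theta : R)
    (b : nat -> R) (n : nat) : \bar R :=
  ((b n `^ (- theta))%:E * lne (P (deviation_event X theta b n)))%E.

End walk.

(* Main.v *)
Require Import Defs.
From HB Require Import structures.
From mathcomp Require Import all_boot all_order all_algebra.
From mathcomp Require Import finmap zify ring lra.
From mathcomp Require Import all_classical all_reals all_analysis measurable_realfun.
Import Order.TTheory GRing.Theory Num.Theory.
Import numFieldNormedType.Exports.
Local Open Scope classical_set_scope.
Local Open Scope ring_scope.
Set Implicit Arguments.
Unset Strict Implicit.
Unset Printing Implicit Defensive.

(** Put [m = b_n ^ theta].  Since [theta log b_n = log m], the claim for all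
    [theta] at once amounts to the following: with
    [kappa = 1 / (2 pi sqrt (det Gamma))], the probability that
    [E B_n - B_n >= kappa n log m] lies between [exp (- c1 m)] and
    [exp (- c2 m)], as soon as [m] is large and [m / n] is small
    ([walk_bounds]).

    The scale of the deviation comes from [E B_n = kappa n log n + O(n)]
    ([meanself_asymp]).  This follows from the local limit theorem [local_limit],
    in which the moment of order [2 + delta] makes the error summable.  Cut the
    walk into [q] blocks of length [L = n / q]: the intersections inside the
    blocks have mean [kappa n log (n / q) + O(n)], which is less than [E B_n] by
    [kappa n log q + O(n)].  For [q] of order [m] this is the deviation in
    question, and both bounds come down to an event of probability
    [exp (- c q)] for independent blocks.

    Upper bound.  The total [B_n] is at least the number of intersections inside
    the blocks.  When [q] is a small multiple of [m], the loss [kappa n log q]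
    falls short of the deviation by a large multiple of [n], and this must be
    made up by [q] independent centred terms.  These obey
    [E exp (l (E B_L - B_L)) <= exp (c l^2 L^2)] ([expself_le]): halving a block
    produces two independent halves and their mutual intersections, whose second
    moment is of the order of the product of the two lengths ([meanmut2_le]).
    Markov's inequality at [l = 1 / L] gives [upper_bound].

    Lower bound.  Take [q] a large multiple of [m].  With a probability bounded
    below, a block moves to the right by a multiple of [sqrt L], stays in a
    window of comparable width, and has at most [E B_L + O(L)]
    self-intersections ([good_prob]).  If all blocks do so, blocks at more than a
    fixed number of places from each other are disjoint, and neighbouring blocks
    have [O(L)] intersections in mean ([chain_prob]).  The total is then at most
    [kappa n log (n / q) + O(n)], which is below [E B_n - kappa n log m]
    ([lower_bound]).

    The expectation of a function of the first [n] steps is written as an [n]-fold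
    iterated integral [iterE] over the law of one step, and independence of
    stretches of the walk is the concatenation rule [iterE_cat]; [path_law]
    relates this to the given probability space. *)


(** * Expectations as positive functionals *)

Section bounded.
Context {R : realType}.

Definition bdd (V : Type) (f : V -> R) := exists M : R, forall v, `|f v| <= M.

Variable V : Type.
Implicit Types (f g : V -> R).

Lemma bdd_cst (c : R) : bdd (fun _ : V => c).
Proof. by exists `|c|. Qed.

Lemma bddD f g : bdd f -> bdd g -> bdd (fun v => f v + g v).
Proof.
move=> [M hM] [N hN]; exists (M + N) => v.
by rewrite (le_trans (ler_normD _ _))// lerD.
Qed.

Lemma bddN f : bdd f -> bdd (fun v => - f v).
Proof. by move=> [M hM]; exists M => v; rewrite normrN. Qed.

Lemma bddM f g : bdd f -> bdd g -> bdd (fun v => f v * g v).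
Proof.
move=> [M hM] [N hN]; exists (M * N) => v.
by rewrite normrM ler_pM.
Qed.

Lemma bddX f n : bdd f -> bdd (fun v => f v ^+ n).
Proof.
move=> bf; elim: n => [|n IHn]; first exact: bdd_cst.
under eq_fun do rewrite exprS.
exact: bddM.
Qed.

Lemma bdd_bool (b : V -> bool) : bdd (fun v => (b v)%:R).
Proof. by exists 1 => v; case: (b v); rewrite ?normr1 ?normr0. Qed.

Lemma bdd_expR f : bdd f -> bdd (fun v => expR (f v)).
Proof.
move=> [M hM]; exists (expR M) => v.
by rewrite ger0_norm ?expR_ge0// ler_expR (le_trans (ler_norm _)).
Qed.

Lemma bdd_max f g : bdd f -> bdd g -> bdd (fun v => Num.max (f v) (g v)).
Proof.
move=> [M hM] [N hN]; exists (M + N) => v.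
have /= := hM v; have := hN v; have := normr_ge0 (f v); have := normr_ge0 (g v).
by rewrite /Num.max; case: ifP => _ *; lra.
Qed.

Lemma bdd_cos f : bdd (fun v => cos (f v)).
Proof. by exists 1 => v; rewrite ler_norml cos_geN1 cos_le1. Qed.

Lemma bdd_sin f : bdd (fun v => sin (f v)).
Proof. by exists 1 => v; rewrite ler_norml sin_geN1 sin_le1. Qed.

Lemma bdd_sum (I : Type) (r : seq I) (P : pred I) (F : I -> V -> R) :
  (forall i, P i -> bdd (F i)) -> bdd (fun v => \sum_(i <- r | P i) F i v).
Proof.
move=> bF; elim: r => [|i r IHr].
  by under eq_fun do rewrite big_nil; exact: bdd_cst.
under eq_fun do rewrite big_cons.
by case: (boolP (P i)) => [Pi|//]; apply: bddD => //; exact: bF.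
Qed.

Lemma bdd_comp (W : Type) (h : W -> V) f : bdd f -> bdd (fun w => f (h w)).
Proof. by move=> [M hM]; exists M. Qed.

End bounded.

(** Testing on bounded functions only keeps integrability out of the way of
    linearity. *)
Record is_mean {R : realType} (V : Type) (E : (V -> R) -> R) : Prop := IsMean {
  mean_cst : forall c, E (fun=> c) = c;
  meanD : forall f g, bdd f -> bdd g ->
    E (fun v => f v + g v) = E f + E g;
  meanZ : forall c f, bdd f -> E (fun v => c * f v) = c * E f;
  mean_le : forall f g, bdd f -> bdd g -> (forall v, f v <= g v) ->
    E f <= E g }.

Section mean_theory.
Context {R : realType} (V : Type) (E : (V -> R) -> R).
Hypothesis mE : is_mean E.
Implicit Types (f g : V -> R).

Lemma meanN f : bdd f -> E (fun v => - f v) = - E f.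
Proof.
move=> bf; under eq_fun do rewrite -mulN1r.
by rewrite (meanZ mE)// mulN1r.
Qed.

Lemma meanB f g : bdd f -> bdd g -> E (fun v => f v - g v) = E f - E g.
Proof. by move=> bf bg; rewrite (meanD mE) ?meanN//; exact: bddN. Qed.

Lemma meanZr c f : bdd f -> E (fun v => f v * c) = E f * c.
Proof.
move=> bf; under eq_fun do rewrite mulrC.
by rewrite (meanZ mE)// mulrC.
Qed.

Lemma mean_sum (I : Type) (r : seq I) (P : pred I) (F : I -> V -> R) :
  (forall i, P i -> bdd (F i)) ->
  E (fun v => \sum_(i <- r | P i) F i v) = \sum_(i <- r | P i) E (F i).
Proof.
move=> bF; elim: r => [|i r IHr].
  by under eq_fun do rewrite big_nil; rewrite (mean_cst mE) big_nil.
under eq_fun do rewrite big_cons.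
rewrite big_cons; case: (boolP (P i)) => [Pi|//].
by rewrite (meanD mE) ?IHr//; [exact: bF|exact: bdd_sum].
Qed.

Lemma mean_ge0 f : bdd f -> (forall v, 0 <= f v) -> 0 <= E f.
Proof.
by move=> bf f0; rewrite -(mean_cst mE 0) (mean_le mE)//; exact: bdd_cst.
Qed.

Lemma mean_norm_le f M : (forall v, `|f v| <= M) -> `|E f| <= M.
Proof.
move=> fM; have bf : bdd f by exists M.
rewrite ler_norml -(mean_cst mE M) -meanN ?(mean_le mE)//=;
  try exact: bdd_cst; try by apply: bddN; exact: bdd_cst.
- by move=> v; have := fM v; rewrite ler_norml => /andP[].
- by move=> v; have := fM v; rewrite ler_norml => /andP[].
Qed.

End mean_theory.

Section iterated.
Context {R : realType} (V : Type) (E : (V -> R) -> R).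

(** Integrating out one list entry at a time makes the independence of disjoint
    stretches of an i.i.d. sequence a matter of list concatenation, see
    [iterE_cat]. *)
Fixpoint iterE (n : nat) (F : seq V -> R) : R :=
  if n is n'.+1 then E (fun z => iterE n' (fun s => F (z :: s))) else F [::].

Lemma iterE_cat m n F :
  iterE (m + n) F = iterE m (fun s => iterE n (fun t => F (s ++ t))).
Proof.
elim: m F => [//|m IHm] F.
by rewrite addSn /=; congr E; apply/funext => z; rewrite IHm.
Qed.

Lemma eq_iterE n F G : (forall s, size s = n -> F s = G s) ->
  iterE n F = iterE n G.
Proof.
elim: n F G => [|n IHn] F G FG /=; first exact: FG.
by congr E; apply/funext => z; apply: IHn => s sn; apply: FG; rewrite /= sn.
Qed.

Lemma iterE_map (h : V -> V) n F : (forall f, E (f \o h) = E f) ->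
  iterE n (fun s => F (map h s)) = iterE n F.
Proof.
move=> hE; elim: n F => [//|n IHn] F /=.
rewrite -[RHS]hE; congr E; apply/funext => z /=.
exact: (IHn (fun s => F (h z :: s))).
Qed.

Hypothesis mE : is_mean E.

Lemma iterE_norm_le n F M : (forall s, `|F s| <= M) -> `|iterE n F| <= M.
Proof.
elim: n F => [|n IHn] F FM /=; first exact: FM.
by apply: (mean_norm_le mE) => z; apply: IHn => s.
Qed.

Lemma bdd_iterE (W : Type) n (F : W -> seq V -> R) :
  bdd (fun p => F p.1 p.2) -> bdd (fun w => iterE n (F w)).
Proof.
move=> [M hM]; exists M => w; apply: iterE_norm_le => s.
exact: (hM (w, s)).
Qed.

Lemma iterE_mean n : is_mean (iterE n).
Proof.
have bc z (F : seq V -> R) : bdd F -> bdd (fun s => F (z :: s)).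
  by move=> bF; exact: (bdd_comp (cons z) bF).
have bi k (F : seq V -> R) : bdd F -> bdd (fun z => iterE k (fun s => F (z :: s))).
  by move=> [M hM]; apply: bdd_iterE; exists M.
elim: n => [|n IHn].
  by split => //= f g _ _; apply.
split => /=.
- move=> c; under eq_fun do rewrite (mean_cst IHn).
  exact: mean_cst.
- move=> f g bf bg; under eq_fun do rewrite (meanD IHn (bc _ _ bf) (bc _ _ bg)).
  by rewrite (meanD mE)//; exact: bi.
- move=> c f bf; under eq_fun do rewrite (meanZ IHn _ (bc _ _ bf)).
  by rewrite (meanZ mE)//; exact: bi.
- move=> f g bf bg fg; apply: (mean_le mE); [exact: bi|exact: bi|].
  by move=> z; apply: (mean_le IHn) => //; exact: bc.
Qed.

Lemma iterE_le n F G : bdd F -> bdd G ->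
  (forall s, size s = n -> F s <= G s) -> iterE n F <= iterE n G.
Proof.
move=> bF bG FG.
have bb (H : seq V -> R) : bdd H -> bdd (fun s => if size s == n then H s else 0).
  move=> [M hM]; exists M => s; case: ifP => // _.
  by rewrite normr0 (le_trans _ (hM s)).
rewrite (@eq_iterE n F (fun s => if size s == n then F s else 0)); last first.
  by move=> s ->; rewrite eqxx.
rewrite [leRHS](@eq_iterE n G (fun s => if size s == n then G s else 0)); last first.
  by move=> s ->; rewrite eqxx.
apply: (mean_le (iterE_mean n)); [exact: bb|exact: bb|].
by move=> s; case: eqP => // /FG.
Qed.

Lemma iterE_catl m n F : iterE (m + n) (fun s => F (take m s)) = iterE m F.
Proof.
rewrite iterE_cat; apply: eq_iterE => s sm.
by under eq_fun do rewrite (take_size_cat _ sm); rewrite (mean_cst (iterE_mean n)).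
Qed.

Lemma iterE_catr m n F : iterE (m + n) (fun s => F (drop m s)) = iterE n F.
Proof.
rewrite iterE_cat -[RHS](mean_cst (iterE_mean m)); apply: eq_iterE => s sm.
by under eq_fun do rewrite (drop_size_cat _ sm).
Qed.

Lemma iterE_prod n (g : V -> R) : bdd g ->
  iterE n (fun s => \prod_(z <- s) g z) = E g ^+ n.
Proof.
move=> bg; elim: n => [|n IHn]; first by rewrite /= big_nil.
have Eq z : iterE n (fun s => \prod_(w <- z :: s) g w) = g z * E g ^+ n.
  rewrite -IHn; under eq_fun do rewrite big_cons.
  case: bg => M hM.
  pose h s := if size s == n then \prod_(w <- s) g w else 0.
  have bh : bdd h.
    exists (`|M| ^+ n) => s; rewrite /h; case: eqP => [<-|_]; last first.
      by rewrite normr0 exprn_ge0.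
    elim: s => [|a s IHs]; first by rewrite big_nil normr1.
    rewrite big_cons normrM exprS ler_pM//.
    by rewrite (le_trans (hM a))// ler_norm.
  transitivity (iterE n (fun s => g z * h s)).
    by apply: eq_iterE => s sn; rewrite /h sn eqxx.
  rewrite (meanZ (iterE_mean n))//; congr (_ * _).
  by apply: eq_iterE => s sn; rewrite /h sn eqxx.
by rewrite /=; under eq_fun do rewrite Eq; rewrite (meanZr mE)// exprS.
Qed.

End iterated.

(** A block of [L] steps acts as a single step of a walk whose steps are lists. *)
Lemma iterE_flatten {R : realType} (V : Type) (E : (V -> R) -> R) L q F :
  iterE (iterE E L) q (fun ss => F (flatten ss)) = iterE E (q * L) F.
Proof.
elim: q F => [//|q IHq] F; rewrite mulSn iterE_cat /=.
by congr iterE; apply/funext => s; rewrite -IHq.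
Qed.

Ltac bd := repeat first
  [ assumption
  | exact: bdd_cst | exact: bdd_bool | exact: bdd_cos | exact: bdd_sin
  | apply: bddD | apply: bddN | apply: bdd_expR | apply: bdd_max
  | apply: bdd_sum => *
  | apply: bddM | apply: bddX ].


(** * Elementary inequalities *)

Section calculus.
Context {R : realType}.
Implicit Types (x y : R) (n : nat).

(** Each Taylor bound below is obtained from the previous one by integrating it
    from [0]. *)
Lemma ge0_of_derive (f f' : R -> R) : (forall x, is_derive x 1 f (f' x)) ->
  (forall x, 0 <= x -> 0 <= f' x) -> f 0 = 0 -> forall x, 0 <= x -> 0 <= f x.
Proof.
move=> df f'0 f0 x x0.
have cf : {within `[0, x], continuous f}.
  by apply: derivable_within_continuous => y _; apply: ex_derive; exact: df.
have [c /andP[c0 _] fx] := MVT_segment x0 (fun y _ => df y) cf.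
by rewrite -[f x]subr0 -[X in _ - X]f0 fx mulr_ge0 ?f'0 ?subr0//; move: c0; rewrite bnd_simp.
Qed.

Lemma sin_le_id x : 0 <= x -> sin x <= x.
Proof.
move=> x0; rewrite -subr_ge0.
apply: (ge0_of_derive (f := fun x => x - sin x) (f' := fun x => 1 - cos x)) => //.
  by rewrite sin0 subrr.
Qed.

Lemma cos_ge x : 1 - x ^+ 2 / 2 <= cos x.
Proof.
wlog x0 : x / 0 <= x.
  move=> H; have [/H//|/ltW x0] := leP 0 x.
  by rewrite -cosN -sqrrN H// oppr_ge0.
rewrite -subr_ge0.
apply: (ge0_of_derive (f := fun x => cos x - (1 - x ^+ 2 / 2)) (f' := fun x => x - sin x)) => //.
- move=> y; apply: is_derive_eq.
  by rewrite /GRing.scale/=; lra.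
- by move=> y y0; rewrite subr_ge0 sin_le_id.
- by rewrite cos0; ring.
Qed.

Lemma sin_ge x : 0 <= x -> x - x ^+ 3 / 6 <= sin x.
Proof.
move=> x0; rewrite -subr_ge0.
apply: (ge0_of_derive (f := fun x => sin x - (x - x ^+ 3 / 6))
  (f' := fun x => cos x - (1 - x ^+ 2 / 2))) => //.
- move=> y; apply: is_derive_eq.
  by rewrite /GRing.scale/=; lra.
- by move=> y y0; rewrite subr_ge0 cos_ge.
- by rewrite sin0; ring.
Qed.

Lemma cos_le x : cos x <= 1 - x ^+ 2 / 2 + x ^+ 4 / 24.
Proof.
wlog x0 : x / 0 <= x.
  move=> H; have [/H//|/ltW x0] := leP 0 x.
  have := H (- x); rewrite cosN oppr_ge0 => /(_ x0).
  by rewrite sqrrN exprNn -signr_odd/= expr0 mul1r.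
rewrite -subr_ge0.
apply: (ge0_of_derive (f := fun x => (1 - x ^+ 2 / 2 + x ^+ 4 / 24) - cos x)
  (f' := fun x => sin x - (x - x ^+ 3 / 6))) => //.
- move=> y; apply: is_derive_eq.
  by rewrite /GRing.scale/=; lra.
- by move=> y y0; rewrite subr_ge0 sin_ge.
- by rewrite cos0; ring.
Qed.

Lemma le_powR_interp x p : 0 <= x -> 0 <= p -> p <= 1 ->
  Num.min 1 x <= x `^ p.
Proof.
move=> x0 p0 p1; have [->|xn0] := eqVneq x 0.
  by rewrite minElt ltNge ler01/= powR_ge0.
have xp : 0 < x by rewrite lt_neqAle eq_sym xn0.
case: (leP 1 x) => x1.
  by rewrite -(powRr0 x) ler_powR.
have [->|pn0] := eqVneq p 0; first by rewrite powRr0 ltW.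
rewrite -[leLHS]powRr1// /powR (gt_eqF xp) ler_expR mul1r.
have : ln x < 0 by rewrite ln_lt0// xp.
nra.
Qed.

(** The remainder is at most [x ^+ 2] and at most [x ^+ 4], and the right-hand
    side dominates the smaller of the two. *)
Lemma cos_taylor x p : 0 <= p -> p <= 1 ->
  `|cos x - 1 + x ^+ 2 / 2| <= x ^+ 2 * (x ^+ 2) `^ p.
Proof.
move=> p0 p1; have := cos_ge x; have := cos_le x.
have := cos_le1 x => cl cu clo.
rewrite ger0_norm; last by lra.
have /= := le_powR_interp (sqr_ge0 x) p0 p1.
have := sqr_ge0 x; set y := x ^+ 2; set w := _ `^ _.
have x4 : x ^+ 4 = y * y by rewrite /y; ring.
rewrite x4 -/y in cu clo *.
by move=> y0; rewrite /Num.min; case: ifP => _ h; nra.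
Qed.

(** Second-order bound behind the lower tail of a nonnegative variable. *)
Lemma expRN_le2 x : 0 <= x -> expR (- x) <= 1 - x + x ^+ 2 / 2.
Proof.
move=> x0; rewrite -subr_ge0.
apply: (ge0_of_derive (f := fun x => 1 - x + x ^+ 2 / 2 - expR (- x))
    (f' := fun x => - 1 + x + expR (- x))) => //.
- move=> y; apply: is_derive_eq.
  by rewrite /GRing.scale/=; lra.
- by move=> y _; have := expR_ge1Dx (- y); lra.
- by rewrite oppr0 expR0; ring.
Qed.

Lemma expR_taylor x p : 0 <= x -> 0 <= p -> p <= 1 ->
  `|expR (- x) - 1 + x| <= x * x `^ p.
Proof.
move=> x0 p0 p1.
have lo : 1 - x <= expR (- x) by exact: expR_ge1Dx.
have hi1 : expR (- x) <= 1 by rewrite expR_le1 oppr_le0.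
have hi2 : expR (- x) <= 1 - x + x ^+ 2.
  by have := expRN_le2 x0; have := sqr_ge0 x; lra.
rewrite ger0_norm; last by lra.
have /= := le_powR_interp x0 p0 p1; set w := _ `^ _.
by rewrite /Num.min; case: ifP => _ h; nra.
Qed.

Lemma le_mul_powR_expR x p : 0 <= x -> 0 <= p -> p <= 1 ->
  x * x `^ p <= 2 * expR x.
Proof.
move=> x0 p0 p1; have [->|xn0] := eqVneq x 0.
  by rewrite mul0r mulr_ge0// expR_ge0.
have xp : 0 < x by rewrite lt_neqAle eq_sym xn0.
have e1 : 1 + x <= expR x by exact: expR_ge1Dx.
have e2 : 1 + x ^+ 2 / 2 <= expR x.
  by have := @expR_ge1Dxn R x 1 x0; rewrite /= factS /= muln1.
case: (leP 1 x) => x1.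
  have : x `^ p <= x by rewrite -[leRHS]powRr1// ler_powR.
  by have := powR_ge0 x p; nra.
have : x `^ p <= 1.
  rewrite /powR (gt_eqF xp) expR_le1.
  have : ln x < 0 by rewrite ln_lt0// xp.
  nra.
by have := powR_ge0 x p; nra.
Qed.

(** Comparison, in telescoping form, with the primitive [- p^-1 x ^ (- p)] of the
    summand. *)
Lemma sum_powR_le (p : R) n : 0 < p ->
  \sum_(1 <= k < n.+1) (k%:R : R) `^ (- (1 + p)) <= 1 + p^-1.
Proof.
move=> p0.
suff H : \sum_(1 <= k < n.+2) (k%:R : R) `^ (- (1 + p)) <=
    1 + p^-1 - p^-1 * n.+1%:R `^ (- p).
  case: n H => [|n] H.
    by rewrite big_nil addr_ge0// invr_ge0 ltW.
  have := H; rewrite big_nat_recr//= => H1.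
  have : 0 <= (n.+2)%:R `^ (- (1 + p)) :> R by exact: powR_ge0.
  have : 0 <= p^-1 * n.+2%:R `^ (- p).
    by rewrite mulr_ge0// ?powR_ge0// invr_ge0 ltW.
  by lra.
elim: n => [|n IHn].
  by rewrite big_nat1 !powR1 mulr1; lra.
rewrite big_nat_recr//=.
set A := \sum_(_ <= _ < _) _ in IHn *.
set a := n.+1%:R `^ (- p) in IHn *; set b := n.+2%:R `^ (- p).
have n0 : (0 : R) < n.+2%:R by rewrite ltr0n.
have -> : n.+2%:R `^ (- (1 + p)) = b / n.+2%:R :> R.
  rewrite opprD addrC powRD ?powR_inv1 ?ltW//.
  by apply/implyP => _; rewrite gt_eqF.
have b0 : 0 < b by exact: powR_gt0.
suff : b * (1 + p / n.+2%:R) <= a.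
  move=> H; have : p^-1 * (b * (1 + p / n.+2%:R)) <= p^-1 * a.
    by rewrite ler_wpM2l// invr_ge0 ltW.
  have -> : p^-1 * (b * (1 + p / n.+2%:R)) = p^-1 * b + b / n.+2%:R.
    by field; rewrite !gt_eqF// -natr1 ?ltr_wpDl.
  by move: IHn; move: (b / _) (p^-1 * a) (p^-1 * b) A p^-1 => u v w A' q ? ?; lra.
have -> : a = b * (n.+1%:R / n.+2%:R) `^ (- p).
  rewrite /a /b -powRM ?divr_ge0//; congr (_ `^ _).
  by rewrite mulrC divfK// gt_eqF.
rewrite ler_pM2l// /powR gt_eqF ?divr_gt0//.
have : ln (n.+1%:R / n.+2%:R : R) <= - n.+2%:R^-1.
  have -> : n.+1%:R / n.+2%:R = 1 + - n.+2%:R^-1 :> R.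
    have -> : n.+1%:R = n.+2%:R - 1 :> R by rewrite -[n.+2%:R]natr1 addrK.
    by rewrite mulrBl divff ?gt_eqF// mul1r.
  rewrite le_ln1Dx// ltrN2 invf_lt1// ltr1n//.
move=> h; apply: le_trans (expR_ge1Dx _) _; rewrite ler_expR.
by rewrite mulNr -mulrN ler_pM2l// lerNr.
Qed.

Lemma norm_exprB_le (a b M : R) n : `|a| <= M -> `|b| <= M ->
  `|a ^+ n.+1 - b ^+ n.+1| <= n.+1%:R * `|a - b| * M ^+ n.
Proof.
move=> aM bM; have M0 : 0 <= M by rewrite (le_trans _ aM).
rewrite subrXX normrM mulrAC mulrC.
rewrite ler_wpM2r//.
apply: le_trans (ler_norm_sum _ _ _) _.
have -> : n.+1%:R * M ^+ n = \sum_(i < n.+1) M ^+ n by rewrite sumr_const card_ord mulr_natl.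
apply: ler_sum => i _.
rewrite -[X in M ^+ X](@subnK i) -1?ltnS// exprD /=  normrM !normrX ler_pM// ?exprn_ge0// lerXn2r//.
Qed.

End calculus.


(** * The law of one step *)

Section law.
Context {R : realType} (mu : probability Z2 R).

Definition step (f : Z2 -> R) : R := \int[mu]_z f z.

Definition dot (w : R * R) (z : Z2) : R := w.1 * z.1%:~R + w.2 * z.2%:~R.

Definition sqn (w : R * R) : R := w.1 ^+ 2 + w.2 ^+ 2.

Definition sqz (z : Z2) : R := z.1%:~R ^+ 2 + z.2%:~R ^+ 2.

(** The characteristic function of the step; the cosine suffices because the law
    will be symmetric. *)
Definition phi (w : R * R) : R := step (fun z => cos (dot w z)).

Lemma dotDr w x y : dot w (x + y) = dot w x + dot w y.
Proof. by rewrite /dot /= !rmorphD/=; ring. Qed.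

Lemma dotNr w x : dot w (- x) = - dot w x.
Proof. by rewrite /dot /= !rmorphN/=; ring. Qed.

Lemma dot0r w : dot w 0 = 0.
Proof. by rewrite /dot /= !mulr0 addr0. Qed.

Lemma sqn_ge0 w : 0 <= sqn w.
Proof. by rewrite addr_ge0 ?sqr_ge0. Qed.

Lemma sqz_ge0 z : 0 <= sqz z.
Proof. by rewrite addr_ge0 ?sqr_ge0. Qed.

Lemma dot_sqr_le w z : dot w z ^+ 2 <= sqn w * sqz z.
Proof.
rewrite /dot /sqn /sqz; move: (z.1%:~R : R) (z.2%:~R : R) => a b.
rewrite -subr_ge0.
rewrite (_ : _ - _ = (w.1 * b - w.2 * a) ^+ 2) ?sqr_ge0//; ring.
Qed.

Lemma measurable_Z2 (f : Z2 -> R) : measurable_fun setT f.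
Proof. by move=> _ B mB. Qed.

Lemma integrable_bdd (f : Z2 -> R) : bdd f -> mu.-integrable setT (EFin \o f).
Proof.
move=> [M fM]; apply: (@le_integrable _ _ _ mu setT _ _ (EFin \o cst M)) => //.
- by move=> z _ /=; rewrite lee_fin (le_trans (fM z))// ler_norm.
- exact: finite_measure_integrable_cst.
Qed.

Lemma integrable_le (f g : Z2 -> R) : mu.-integrable setT (EFin \o g) ->
  (forall z, `|f z| <= g z) -> mu.-integrable setT (EFin \o f).
Proof.
move=> ig fg; apply: (@le_integrable _ _ _ mu setT _ _ (EFin \o g)) => //.
- by move=> z _ /=; rewrite lee_fin (le_trans (fg z))// ler_norm.
Qed.

Lemma stepD f g : mu.-integrable setT (EFin \o f) ->
  mu.-integrable setT (EFin \o g) ->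
  step (fun z => f z + g z) = step f + step g.
Proof. by move=> *; rewrite /step RintegralD. Qed.

Lemma stepZ c f : mu.-integrable setT (EFin \o f) ->
  step (fun z => c * f z) = c * step f.
Proof. by move=> *; rewrite /step RintegralZl. Qed.

Lemma step_cst c : step (fun=> c) = c.
Proof.
rewrite /step Rintegral_cst//.
by rewrite [X in fine X](@probability_setT _ _ _ mu) /= mulr1.
Qed.

Lemma step_le f g : mu.-integrable setT (EFin \o f) ->
  mu.-integrable setT (EFin \o g) -> (forall z, f z <= g z) ->
  step f <= step g.
Proof. by move=> *; rewrite /step le_Rintegral. Qed.

Lemma step_mean : is_mean step.
Proof.
split.
- exact: step_cst.
- by move=> f g bf bg; rewrite stepD//; exact: integrable_bdd.
- by move=> c f bf; rewrite stepZ//; exact: integrable_bdd.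
- by move=> f g bf bg; apply: step_le; exact: integrable_bdd.
Qed.

Lemma step_ge_atom f x : mu.-integrable setT (EFin \o f) ->
  (forall z, 0 <= f z) -> f x * fine (mu [set x]) <= step f.
Proof.
move=> fi f0.
have -> : f x * fine (mu [set x]) = step (fun z => f x * \1_[set x] z).
  rewrite stepZ; last by apply: integrable_bdd; exact: bdd_bool.
  by rewrite /step /Rintegral integral_indic// setIT.
apply: step_le => //.
- apply: integrable_bdd; apply: bddM; [exact: bdd_cst|exact: bdd_bool].
- move=> z; rewrite indicE; case: (boolP (z \in [set x])) => [|_].
    by rewrite inE => ->; rewrite mulr1.
  by rewrite mulr0.
Qed.

Definition is_atom (z : Z2) := (0 < mu [set z])%E.

Lemma atom_fine_gt0 z : is_atom z -> 0 < fine (mu [set z]).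
Proof.
move=> h; apply: fine_gt0; rewrite (h : (0 < _)%E)/=.
by rewrite (le_lt_trans (probability_le1 _ _))// ltry.
Qed.

Definition cell (A : set Z2) (n : nat) : set Z2 :=
  [set z : Z2 | @choice.pickle (int * int)%type z = n /\ A z].

(** Cutting along an enumeration of the lattice reduces identities between
    measures to their atoms. *)
Lemma measure_cells (m : {measure set Z2 -> \bar R}) (A : set Z2) :
  m A = (\sum_(n <oo) m (cell A n))%E.
Proof.
have {1}-> : A = \bigcup_n cell A n.
  rewrite predeqE => z; split => [Az|[n _ []//]].
  by exists (@choice.pickle (int * int)%type z).
rewrite measure_bigcup//; last by move=> i j _ _ [z [[<- _] [<- _]]].
by apply: eq_eseriesl => n; rewrite in_setT.
Qed.

Lemma eq_measure_Z2 (m1 m2 : {measure set Z2 -> \bar R}) (A : set Z2) :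
  (forall z, m1 [set z] = m2 [set z]) -> m1 A = m2 A.
Proof.
move=> m12; rewrite !measure_cells; apply: eq_eseriesr => n _.
have [[z zA]|nA] := pselect (exists z, cell A n z); last first.
  rewrite (_ : cell A n = set0) ?measure0//.
  by rewrite predeqE => z; split => // h; apply: nA; exists z.
rewrite (_ : cell A n = [set z])//; rewrite predeqE => y; split => [|->//].
by case: zA => zn _ [yn _]; apply: (pcan_inj (@choice.pickleK (int * int)%type)); rewrite yn zn.
Qed.

Lemma exists_atom : exists z, is_atom z.
Proof.
apply/not_existsP => H.
have H0 z : mu [set z] = 0%E.
  by apply/eqP; rewrite eq_le measure_ge0 andbT leNgt; apply/negP/H.
have : mu setT = 1%E by exact: probability_setT.
rewrite (@eq_measure_Z2 mu mzero)//=; first by move=> /esym/eqP; rewrite onee_eq0.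
Qed.

Lemma zmod_closedP (H : set Z2) : H 0 -> (forall x y, H x -> H y -> H (x - y)) ->
  zmod_closed [in H].
Proof.
move=> H0 HB; split; first by rewrite inE.
by move=> x y; rewrite !inE; exact: HB.
Qed.

Lemma subgroup_genP (A H : set Z2) : subgroup_gen A = setT -> H 0 ->
  (forall x y, H x -> H y -> H (x - y)) -> A `<=` H -> forall z, H z.
Proof.
move=> AT H0 HB AH z; have : subgroup_gen A z by rewrite AT.
by apply; split => //; exact: zmod_closedP.
Qed.

(** Replaces the subadditivity that [1 - cos] lacks. *)
Lemma one_sub_cosB a b :
  1 - cos (a - b) <= 2 * (1 - cos a) + 2 * (1 - cos b) :> R.
Proof.
(* with half angles this is sin^2(a-b) <= 2 sin^2 a + 2 sin^2 b *)
have h x : 1 - cos x = 2 * sin (x / 2) ^+ 2 :> R.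
  rewrite -[in LHS](divfK (_ : 2 != 0) x) ?pnatr_eq0// mulr_natr cos_mulr2n.
  by rewrite cos2sin2; ring.
rewrite !h mulrBl sinB.
have := cos2Dsin2 (a / 2); have := cos2Dsin2 (b / 2).
move: (sin (a / 2)) (sin (b / 2)) (cos (a / 2)) (cos (b / 2)) => s t c e h1 h2.
have hc : c ^+ 2 <= 1 by have := sqr_ge0 s; lra.
have he : e ^+ 2 <= 1 by have := sqr_ge0 t; lra.
have h3 : (s * e) ^+ 2 <= s ^+ 2 by rewrite exprMn ler_piMr// sqr_ge0.
have h4 : (c * t) ^+ 2 <= t ^+ 2 by rewrite exprMn ler_piMl// sqr_ge0.
have := sqr_ge0 (s * e + c * t).
nra.
Qed.

Lemma one_sub_cos_ge x : `|x| <= pi -> x ^+ 2 / 18 <= 1 - cos x :> R.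
Proof.
move=> xpi.
wlog x0 : x xpi / 0 <= x.
  move=> H; have [/H->//|/ltW x0] := leP 0 x.
  by rewrite -cosN -sqrrN H ?normrN ?oppr_ge0.
rewrite ger0_norm// in xpi.
have x4 : x <= 4.
  by rewrite (le_trans xpi)//; have := @pihalf_lt2 R; lra.
have -> : 1 - cos x = 2 * sin (x / 2) ^+ 2 :> R.
  rewrite -[in LHS](divfK (_ : 2 != 0) x) ?pnatr_eq0// mulr_natr cos_mulr2n.
  by rewrite cos2sin2; ring.
have y0 : 0 <= x / 2 by lra.
(* [sin y >= y / 3] on [0, 2], and [pi <= 4] *)
have := sin_ge y0.
have : x / 2 / 3 <= x / 2 - (x / 2) ^+ 3 / 6 by nra.
by nra.
Qed.

End law.


(** * Decay of the characteristic function *)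

Section charfun.
Context {R : realType} (mu : probability Z2 R).
Local Notation step := (step mu).
Local Notation phi := (phi mu).

Definition box : set (R * R) := [set w | `|w.1| <= pi /\ `|w.2| <= pi].

Lemma phi_real w : `|phi w| <= 1.
Proof.
by apply: (mean_norm_le (step_mean mu)) => z; rewrite ler_norml cos_geN1 cos_le1.
Qed.

(** For a fixed [h >= 0] controlling the atoms, the lattice points [z] with
    [1 - cos (w . z) <= C h w] form a subgroup because [1 - cos] is almost
    subadditive; a generating set therefore controls both unit vectors. *)
Lemma sqn_le_of_atoms (A : set Z2) (h : R * R -> R) :
  subgroup_gen A = setT -> (forall w, 0 <= h w) ->
  (forall z, A z -> exists C, forall w, 1 - cos (dot w z) <= C * h w) ->
  exists2 c, 0 < c & forall w, box w -> c * sqn w <= h w.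
Proof.
move=> AT h0 hA.
have H := subgroup_genP (H := [set z | exists C, forall w, 1 - cos (dot w z) <= C * h w]) AT.
have {}H z : exists C, forall w, 1 - cos (dot w z) <= C * h w.
  apply: H => //=.
    by exists 0 => w; rewrite dot0r cos0 subrr mul0r.
  move=> x y [C hC] [D hD]; exists (2 * C + 2 * D) => w.
  rewrite dotDr dotNr (le_trans (one_sub_cosB _ _))//.
  by have := hC w; have := hD w; lra.
have [C hC] := H ((1, 0) : Z2); have [D hD] := H ((0, 1) : Z2).
pose M := 18 * (`|C| + `|D|) + 1.
have M0 : 0 < M by rewrite /M; have := normr_ge0 C; have := normr_ge0 D; lra.
exists (M^-1); first by rewrite invr_gt0.
move=> w [w1 w2]; rewrite mulrC ler_pdivrMr//.
have := hC w; have := hD w; rewrite /dot /= mulr1 !mulr0 addr0 mulr1 add0r.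
have := one_sub_cos_ge w1; have := one_sub_cos_ge w2.
have := ler_norm C; have := ler_norm D; have := h0 w; rewrite /sqn /M.
by nra.
Qed.

Section bounds.
Hypothesis hgrp : subgroup_gen (is_atom mu) = setT.
Hypothesis haper : forall x, subgroup_gen [set (x + z : Z2) | z in is_atom mu] = setT.

Lemma one_sub_phi_ge : exists2 c, 0 < c & forall w, box w -> c * sqn w <= 1 - phi w.
Proof.
apply: (sqn_le_of_atoms hgrp) => [w|z zA].
  by rewrite subr_ge0; have := phi_real w; rewrite ler_norml => /andP[].
have m0 := atom_fine_gt0 zA.
exists ((fine (mu [set z]))^-1) => w.
rewrite mulrC ler_pdivlMr//.
have -> : 1 - phi w = step (fun z => 1 - cos (dot w z)).
  rewrite (meanB (step_mean mu)) ?(mean_cst (step_mean mu))//; bd.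
apply: (@step_ge_atom _ mu (fun z => 1 - cos (dot w z))).
  by apply: integrable_bdd; bd.
by move=> y; rewrite subr_ge0 cos_le1.
Qed.

(** [1 + cos] is [1 - cos] shifted by [pi]; two shifts cancel, which is where
    aperiodicity along a translate of the support is used. *)
Lemma one_add_phi_ge : exists2 c, 0 < c & forall w, box w -> c * sqn w <= 1 + phi w.
Proof.
have [x xA] := exists_atom mu.
apply: (sqn_le_of_atoms (haper x)) => [w|_ [z zA <-]].
  by rewrite -lerBlDl sub0r; have := phi_real w; rewrite ler_norml => /andP[].
have key y : is_atom mu y -> exists C, forall w, 1 + cos (dot w y) <= C * (1 + phi w).
  move=> yA; have m0 := atom_fine_gt0 yA.
  exists ((fine (mu [set y]))^-1) => w.
  rewrite mulrC ler_pdivlMr//.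
  have -> : 1 + phi w = step (fun z => 1 + cos (dot w z)).
    by rewrite (meanD (step_mean mu)) ?(mean_cst (step_mean mu))//; bd.
  apply: (@step_ge_atom _ mu (fun z => 1 + cos (dot w z))).
    by apply: integrable_bdd; bd.
  by move=> v; rewrite -lerBlDl sub0r cos_geN1.
have [C hC] := key _ xA; have [D hD] := key _ zA.
exists (2 * C + 2 * D) => w; rewrite dotDr.
have -> : dot w x + dot w z = (dot w x + pi) - (pi - dot w z) by ring.
rewrite (le_trans (one_sub_cosB _ _))//.
rewrite (addrC pi) !cosDpi cosN.
by have := hC w; have := hD w; lra.
Qed.

Lemma phi_decay : exists2 c, 0 < c &
  forall w, box w -> `|phi w| <= expR (- (c * sqn w)).
Proof.
have [c c0 hc] := one_sub_phi_ge; have [d d0 hd] := one_add_phi_ge.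
exists (Num.min c d); first by rewrite lt_min c0.
move=> w bw; apply: le_trans (expR_ge1Dx _).
have := hc w bw; have := hd w bw; have := sqn_ge0 w.
have : Num.min c d <= c by rewrite ge_min lexx.
have : Num.min c d <= d by rewrite ge_min lexx orbT.
move: (Num.min c d) => e ec ed s0 h1 h2.
by rewrite ler_norml; apply/andP; split; nra.
Qed.

Hypothesis hmom : mu.-integrable setT (EFin \o @sqz R).

Definition quad (w : R * R) : R := step (fun z => dot w z ^+ 2).

Lemma integrable_dot2 w : mu.-integrable setT (EFin \o (fun z => dot w z ^+ 2)).
Proof.
apply: (@integrable_le _ mu _ (fun z => sqn w * sqz z)).
  exact: (integrableZl _ _ hmom).
by move=> z; rewrite ger0_norm ?sqr_ge0// dot_sqr_le.
Qed.

Lemma quad_ub : exists2 C, 0 < C & forall w, quad w <= C * sqn w.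
Proof.
exists (step (@sqz R) + 1).
  by rewrite ltr_wpDl// Rintegral_ge0// => z _; exact: sqz_ge0.
move=> w; apply: (@le_trans _ _ (step (@sqz R) * sqn w)).
  rewrite mulrC -stepZ//; apply: step_le.
  - exact: integrable_dot2.
  - exact: (integrableZl _ _ hmom).
  - by move=> z; exact: dot_sqr_le.
by rewrite ler_wpM2r ?sqn_ge0// lerDl.
Qed.

(** Nondegeneracy: the points whose inner product with [w] is controlled by the
    quadratic form of the covariance form a subgroup containing the support. *)
Lemma quad_lb : exists2 c, 0 < c & forall w, c * sqn w <= quad w.
Proof.
have q0 w : 0 <= quad w by apply: Rintegral_ge0 => z _; exact: sqr_ge0.
have H z : exists C, forall w, dot w z ^+ 2 <= C * quad w.
  apply: (subgroup_genP (H := [set z | exists C, forall w, dot w z ^+ 2 <= C * quad w]) hgrp).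
  - by exists 0 => w; rewrite dot0r expr0n mul0r.
  - move=> x y [C hC] [D hD]; exists (2 * C + 2 * D) => w.
    rewrite dotDr dotNr; have := hC w; have := hD w.
    have := sqr_ge0 (dot w x + dot w y); nra.
  - move=> x xA; have m0 := atom_fine_gt0 xA.
    exists ((fine (mu [set x]))^-1) => w; rewrite mulrC ler_pdivlMr//.
    apply: (@step_ge_atom _ mu (fun z => dot w z ^+ 2)).
      exact: integrable_dot2.
    by move=> v; exact: sqr_ge0.
have [C hC] := H ((1, 0) : Z2); have [D hD] := H ((0, 1) : Z2).
pose M := `|C| + `|D| + 1.
have M0 : 0 < M by rewrite /M; have := normr_ge0 C; have := normr_ge0 D; lra.
exists (M^-1); first by rewrite invr_gt0.
move=> w; rewrite mulrC ler_pdivrMr//.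
have := hC w; have := hD w; rewrite /dot /= mulr1 !mulr0 addr0 mulr1 add0r.
have := ler_norm C; have := ler_norm D; have := q0 w; rewrite /sqn /M.
by nra.
Qed.

End bounds.

(** Integrating [cos_taylor] uses the moment of order [2 + 2 p]. *)
Lemma phi_taylor (p : R) : 0 <= p -> p <= 1 ->
  mu.-integrable setT (EFin \o @sqz R) ->
  mu.-integrable setT (EFin \o (fun z => sqz z * sqz z `^ p)) ->
  exists2 M, 0 < M & forall w,
    `|phi w - 1 + quad w / 2| <= M * (sqn w * sqn w `^ p).
Proof.
move=> p0 p1 hmom hp.
set m := step (fun z => sqz z * sqz z `^ p).
have m0 : 0 <= m.
  by apply: Rintegral_ge0 => z _; rewrite mulr_ge0 ?powR_ge0 ?sqz_ge0.
exists (m + 1); first by rewrite ltr_wpDl.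
move=> w; have s0 := sqn_ge0 w.
pose g z : R := cos (dot w z) - 1 + dot w z ^+ 2 / 2.
have i2 : mu.-integrable setT (EFin \o (fun z => 2^-1 * dot w z ^+ 2)).
  exact: (integrableZl _ _ (integrable_dot2 hmom w)).
have i1 : mu.-integrable setT (EFin \o (fun z => cos (dot w z) - 1)).
  by apply: integrable_bdd; bd.
have gE : phi w - 1 + quad w / 2 = step g.
  rewrite /g; under [in RHS]eq_fun do rewrite [_ / 2]mulrC.
  rewrite stepD// (meanB (step_mean mu)); [|by bd|by bd].
  rewrite (mean_cst (step_mean mu)) stepZ; last exact: integrable_dot2.
  by rewrite /quad /phi; ring.
have gle z : `|g z| <= sqn w * sqn w `^ p * (sqz z * sqz z `^ p).
  apply: le_trans (cos_taylor _ p0 p1) _.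
  rewrite mulrACA -powRM ?sqz_ge0//.
  rewrite ler_pM ?sqr_ge0 ?powR_ge0 ?dot_sqr_le//.
  by rewrite ge0_ler_powR ?nnegrE ?sqr_ge0 ?mulr_ge0 ?sqz_ge0 ?dot_sqr_le.
have ig : mu.-integrable setT (EFin \o (fun z => sqn w * sqn w `^ p * (sqz z * sqz z `^ p))).
  exact: (integrableZl _ _ hp).
have ig' : mu.-integrable setT (EFin \o g) by apply: integrable_le ig gle.
rewrite gE (le_trans (le_normr_Rintegral _ _))//.
apply: (@le_trans _ _ (sqn w * sqn w `^ p * m)).
  rewrite /m -stepZ//; apply: step_le => //.
  exact: (integrable_norm ig').
by rewrite mulrC ler_wpM2r ?lerDl// mulr_ge0// powR_ge0.
Qed.

End charfun.


(** * Fourier inversion on the plane *)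

Section plane.
Context {R : realType}.
Local Notation leb := (@lebesgue_measure R).

Definition plane := product_measure1 leb leb.

HB.instance Definition _ := Measure.on plane.

Lemma plane_sigma_finite : sigma_finite setT plane.
Proof.
have /sigma_finiteP[F [TF ndF Foo]] := sigma_finiteT leb.
exists (fun n => F n `*` F n).
 rewrite -setXTT [in LHS]TF predeqE => -[x y]; split.
    move=> [/= [n _ Fnx] [k _ Gky]]; exists (maxn n k) => //; split.
    - by move: x Fnx; exact/subsetPset/ndF/leq_maxl.
    - by move: y Gky; exact/subsetPset/ndF/leq_maxr.
  by move=> [n _ []/= ? ?]; split; exists n.
move=> k; have [? ?] := Foo k.
split; first exact: measurableX.
by rewrite /plane [ltLHS]product_measure1E// lte_mul_pinfty// ge0_fin_numE.
Qed.

HB.instance Definition _ :=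
  Measure_isSigmaFinite.Build _ _ _ plane plane_sigma_finite.

Lemma integral_gauss1 (a m : R) : 0 < a ->
  (\int[leb]_x (expR (- (a / 2 * (x - m) ^+ 2)))%:E)%E = (Num.sqrt (2 * pi / a))%:E.
Proof.
move=> a0; pose s := (Num.sqrt a)^-1.
have s2 : s ^+ 2 = a^-1 by rewrite /s exprVn sqr_sqrtr// ltW.
have s0 : s != 0 by rewrite invr_eq0 sqrtr_eq0 -ltNge.
have p0 : 0 < normal_peak s by exact: normal_peak_gt0.
have -> : Num.sqrt (2 * pi / a) = (normal_peak s)^-1.
  by rewrite /normal_peak invrK s2 -mulr_natl; congr Num.sqrt; ring.
have -> : (fun x => (expR (- (a / 2 * (x - m) ^+ 2)))%:E) =
    (fun x => (normal_peak s)^-1%:E * (normal_pdf m s x)%:E)%E.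
  apply/funext => x; rewrite normal_pdfE// -EFinM mulKf ?gt_eqF//.
  rewrite /normal_fun s2; congr (expR _)%:E.
  by rewrite mulNr; congr (- _); rewrite -mulr_natl; field; rewrite gt_eqF.
rewrite integralZl//; last exact: integrable_normal_pdf.
by rewrite integral_normal_pdf mule1.
Qed.

Lemma measurable_w1 : measurable_fun setT (fun w : R * R => w.1).
Proof. exact: measurable_fst. Qed.

Lemma measurable_w2 : measurable_fun setT (fun w : R * R => w.2).
Proof. exact: measurable_snd. Qed.

Definition qform (a b c : R) (w : R * R) : R :=
  a * w.1 ^+ 2 + 2 * b * w.1 * w.2 + c * w.2 ^+ 2.

Lemma measurable_qform a b c : measurable_fun setT (qform a b c).
Proof.
apply: measurable_funD; first apply: measurable_funD.
- apply: measurable_funM; first exact: measurable_cst.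
  by apply: measurable_funX; exact: measurable_w1.
- apply: measurable_funM; last exact: measurable_w2.
  by apply: measurable_funM; [exact: measurable_cst|exact: measurable_w1].
- apply: measurable_funM; first exact: measurable_cst.
  by apply: measurable_funX; exact: measurable_w2.
Qed.

Lemma measurable_gauss a b c :
  measurable_fun setT (fun w => expR (- (qform a b c w / 2))).
Proof.
apply: (measurableT_comp (@measurable_expR R)).
apply: (measurableT_comp (@oppr_measurable R setT)).
apply: measurable_funM; [exact: measurable_qform|exact: measurable_cst].
Qed.

(** Completing the square in the second variable. *)
Lemma integral_gauss2 (a b c : R) : 0 < c -> 0 < a * c - b ^+ 2 ->
  (\int[plane]_w (expR (- (qform a b c w / 2)))%:E)%E =
  (2 * pi / Num.sqrt (a * c - b ^+ 2))%:E.
Proof.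
move=> c0 D0; set D := a * c - b ^+ 2 in D0 *.
have mg : measurable_fun setT (fun w => (expR (- (qform a b c w / 2)))%:E).
  by apply/measurable_EFinP; exact: measurable_gauss.
rewrite [LHS]fubini_tonelli1//.
have mgx x m e : measurable_fun setT
    (fun y : R => (expR (- (e / 2 * (y - m) ^+ 2)) + x)%:E).
  apply/measurable_EFinP; apply: measurable_funD => //.
  apply: (measurableT_comp (@measurable_expR R)).
  apply: (measurableT_comp (@oppr_measurable R setT)).
  apply: measurable_funM => //; apply: measurable_funX.
  by apply: measurable_funB.
have {}mgx m e : measurable_fun setT (fun y : R => (expR (- (e / 2 * (y - m) ^+ 2)))%:E).
  by have := mgx 0 m e; under eq_fun do rewrite addr0.
have E2 x : fubini_F leb (fun w => (expR (- (qform a b c w / 2)))%:E) x =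
    ((Num.sqrt (2 * pi / c))%:E * (expR (- (D / c / 2 * (x - 0) ^+ 2)))%:E)%E.
  rewrite /fubini_F -(integral_gauss1 (- (b / c * x)) c0) muleC.
  rewrite -ge0_integralZl//; last exact: mgx.
  apply: eq_integral => y _; rewrite -EFinM -expRD; congr (expR _)%:E.
  by rewrite /qform/= /D; field; rewrite gt_eqF.
transitivity (\int[leb]_x ((Num.sqrt (2 * pi / c))%:E *
    (expR (- (D / c / 2 * (x - 0) ^+ 2)))%:E))%E.
  by apply: eq_integral => x _; exact: E2.
have Dc : 0 < D / c by rewrite divr_gt0.
rewrite ge0_integralZl//; last exact: mgx.
rewrite integral_gauss1// -EFinM; congr (_%:E).
have p0 : 0 < pi :> R by exact: pi_gt0.
have sD : 0 < Num.sqrt D by rewrite sqrtr_gt0.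
rewrite -sqrtrM; last by rewrite divr_ge0 ?ltW// mulr_gt0.
rewrite (_ : 2 * pi / c * (2 * pi / (D / c)) = (2 * pi) ^+ 2 / D); last by field; rewrite !gt_eqF.
by rewrite sqrtrM ?sqr_ge0// sqrtr_sqr sqrtrV ?ltW// ger0_norm// mulr_ge0// ltW.
Qed.

Lemma measurable_box : measurable (@box R).
Proof.
have -> : @box R = `[-pi, pi] `*` `[-pi, pi].
  by rewrite predeqE => w; rewrite /box /= !in_itv/= !ler_norml.
exact: measurableX.
Qed.

Lemma lebesgue_itv_pi : leb `[-pi, pi] = (2 * pi)%:E.
Proof.
have p0 : 0 < pi :> R by exact: pi_gt0.
rewrite lebesgue_measure_itv/= lte_fin ifT; last by lra.
by rewrite -EFinB; congr (_%:E); ring.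
Qed.

Lemma plane_box : plane (@box R) = ((2 * pi) ^+ 2)%:E.
Proof.
have -> : @box R = `[-pi, pi] `*` `[-pi, pi].
  by rewrite predeqE => w; rewrite /box /= !in_itv/= !ler_norml.
have p0 : 0 < pi :> R by exact: pi_gt0.
rewrite /plane [LHS]product_measure1E//.
transitivity ((2 * pi)%:E * (2 * pi)%:E : \bar R)%E; last by rewrite -EFinM expr2.
by congr (_ * _)%E; exact: lebesgue_itv_pi.
Qed.

Lemma integrable_box (f : R * R -> R) : measurable_fun setT f ->
  (exists M : R, forall w, box w -> `|f w| <= M) ->
  plane.-integrable box (EFin \o f).
Proof.
move=> mf [M fM].
apply: (@le_integrable _ _ _ plane box _ _ (EFin \o cst M)) => //.
- exact: measurable_box.
- by apply/measurable_EFinP; exact: measurable_funTS.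
- by move=> w bw /=; rewrite lee_fin (le_trans (fM _ bw))// ler_norm.
- apply: measurable_bounded_integrable.
  + exact: measurable_box.
  + by rewrite [ltLHS]plane_box ltry.
  + exact: measurable_cst.
  + exact: bounded_cst.
Qed.

Lemma integrable_box_restrict (f : R * R -> R) :
  plane.-integrable box (EFin \o f) ->
  plane.-integrable setT (EFin \o (f \_ box)).
Proof.
rewrite integrable_mkcond; last exact: measurable_box.
by apply: eq_integrable => // w _; rewrite /= !patchE; case: ifP.
Qed.

Lemma sin_int_pi (m : int) : sin (m%:~R * pi) = 0 :> R.
Proof.
have H (n : nat) : sin (n%:R * pi) = 0 :> R.
  elim: n => [|n IHn]; first by rewrite mul0r sin0.
  by rewrite -natr1 mulrDl mul1r sinDpi IHn oppr0.
case: m => n; first exact: H.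
by rewrite NegzE rmorphN mulNr sinN /= H oppr0.
Qed.

Lemma continuous_trig_mul (m : R) :
  continuous (fun v => cos (m * v)) /\ continuous (fun v => sin (m * v)).
Proof.
have c v : (fun v => m * v) x @[x --> v] --> m * v.
  by apply: cvgMr; exact: cvg_id.
split => v.
- apply: (cvg_comp _ _ (c v)); exact: continuous_cos.
- apply: (cvg_comp _ _ (c v)); exact: continuous_sin.
Qed.

Lemma integral_cos_int (m : int) :
  (\int[leb]_(v in `[(- pi)%R, pi%R]) (cos (m%:~R * v))%:E)%E =
  (2 * pi * (m == 0)%:R)%:E.
Proof.
have p0 : 0 < pi :> R by exact: pi_gt0.
have [->|m0] := eqVneq m 0.
  under eq_integral do rewrite mul0r cos0.
  rewrite integral_cst//= mul1e mulr1; exact: lebesgue_itv_pi.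
have r0 : (m%:~R : R) != 0 by rewrite intr_eq0.
have dF (v : R) : is_derive v 1 (fun v => sin (m%:~R * v) / m%:~R) (cos (m%:~R * v) : R).
  apply: is_derive_eq; rewrite /GRing.scale/=; field; exact: r0.
rewrite (@continuous_FTC2 _ _ (fun v => sin (m%:~R * v) / m%:~R)).
- by rewrite mulrN sinN sin_int_pi oppr0 !mul0r mulr0 subee.
- lra.
- by apply: continuous_subspaceT; exact: (continuous_trig_mul _).1.
- have cF : continuous (fun v : R => sin (m%:~R * v) / m%:~R).
    by move=> v; apply: differentiable_continuous; apply/derivable1_diffP; exact: ex_derive.
  split.
  + by move=> x _; exact: ex_derive.
  + by apply: cvg_at_right_filter; exact: cF.
  + by apply: cvg_at_left_filter; exact: cF.
- by move=> x _; rewrite derive1E; exact: derive_val.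
Qed.

Lemma integral_sin_int (m : int) :
  (\int[leb]_(v in `[(- pi)%R, pi%R]) (sin (m%:~R * v))%:E)%E = 0%E.
Proof.
have p0 : 0 < pi :> R by exact: pi_gt0.
have [->|m0] := eqVneq m 0.
  by under eq_integral do rewrite mul0r sin0; rewrite integral0.
have r0 : (m%:~R : R) != 0 by rewrite intr_eq0.
have dF (v : R) : is_derive v 1 (fun v => - cos (m%:~R * v) / m%:~R) (sin (m%:~R * v) : R).
  apply: is_derive_eq; rewrite /GRing.scale/=; field; exact: r0.
rewrite (@continuous_FTC2 _ _ (fun v => - cos (m%:~R * v) / m%:~R)).
- by rewrite mulrN cosN subee.
- lra.
- by apply: continuous_subspaceT; exact: (continuous_trig_mul _).2.
- have cF : continuous (fun v : R => - cos (m%:~R * v) / m%:~R).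
    by move=> v; apply: differentiable_continuous; apply/derivable1_diffP; exact: ex_derive.
  split.
  + by move=> x _; exact: ex_derive.
  + by apply: cvg_at_right_filter; exact: cF.
  + by apply: cvg_at_left_filter; exact: cF.
- by move=> x _; rewrite derive1E; exact: derive_val.
Qed.

Lemma measurable_cos_dot (y : Z2) : measurable_fun setT (fun w : R * R => cos (dot w y)).
Proof.
apply: (measurableT_comp (continuous_measurable_fun (@continuous_cos R))).
by apply: measurable_funD; apply: measurable_funM.
Qed.

(** Orthogonality of the characters of the torus. *)
Lemma integral_cos_dot (y : Z2) :
  \int[plane]_(w in box) cos (dot w y) = (2 * pi) ^+ 2 * (y == 0)%:R.
Proof.
have ib : plane.-integrable box (EFin \o (fun w : R * R => cos (dot w y))).
  apply: integrable_box; first exact: measurable_cos_dot.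
  by exists 1 => w _; rewrite ler_norml cos_geN1 cos_le1.
have := ib; rewrite integrable_mkcond; last exact: measurable_box.
move=> ib'.
rewrite /Rintegral integral_mkcond -[X in fine X]integral12_prod_meas1//.
set S := (`[(- pi)%R, pi%R]%classic : set R).
have mS : measurable S by exact: measurable_itv.
have ic (m : int) : leb.-integrable S (EFin \o (fun v => cos (m%:~R * v))).
  apply: continuous_compact_integrable; first exact: segment_compact.
  by apply: continuous_subspaceT; exact: (continuous_trig_mul _).1.
have si (m : int) : leb.-integrable S (EFin \o (fun v => sin (m%:~R * v))).
  apply: continuous_compact_integrable; first exact: segment_compact.
  by apply: continuous_subspaceT; exact: (continuous_trig_mul _).2.
have E1 u : fubini_F leb ((EFin \o (fun w => cos (dot w y))) \_ box) u =
    ((fun u => (2 * pi * (y.2 == 0)%:R)%:E * (cos (y.1%:~R * u))%:E)%E \_ S) u.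
  rewrite /fubini_F patchE; case: ifPn => uS; last first.
    rewrite integral0_eq// => v _; rewrite patchE ifF//.
    apply/negbTE; apply: contra uS; rewrite !inE /S/= in_itv/= /box/= ler_norml.
    by case=> ->.
  rewrite (_ : (fun v => _) = (fun v => (cos (y.1%:~R * u))%:E * (cos (y.2%:~R * v))%:E
     - (sin (y.1%:~R * u))%:E * (sin (y.2%:~R * v))%:E)%E \_ S); last first.
    apply/funext => v; rewrite !patchE.
    have -> : ((u, v) \in @box R) = (v \in S).
      move: uS; rewrite !inE /S/= !in_itv/= => u1.
      apply/idP/idP; rewrite !inE /box /S/= !in_itv/= !ler_norml; [by case|by split].
    case: ifP => // _; rewrite -!EFinM -EFinB -cosD; congr (cos _)%:E.
    by rewrite /dot/=; ring.
  rewrite -integral_mkcond integralB//; first last.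
  - by apply: integrableZl => //; exact: si.
  - by apply: integrableZl => //; exact: ic.
  rewrite integralZl//; last exact: ic.
  rewrite integralZl//; last exact: si.
  by rewrite integral_sin_int integral_cos_int mule0 sube0 muleC.
transitivity (fine (\int[leb]_u
    ((fun u => (2 * pi * (y.2 == 0)%:R)%:E * (cos (y.1%:~R * u))%:E)%E \_ S) u)%E).
  by congr fine; apply: eq_integral => u _; exact: E1.
rewrite -integral_mkcond integralZl//; last exact: ic.
rewrite integral_cos_int -EFinM/=.
rewrite (_ : (y == 0) = (y.1 == 0) && (y.2 == 0)); last by case: (y).
by case: (y.1 == 0); case: (y.2 == 0); rewrite /= ?mulr1 ?mulr0 ?mul0r ?expr2.
Qed.

End plane.


(** * Return probabilities by Fourier inversion *)

Section inversion.
Context {R : realType} (mu : probability Z2 R).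
Local Notation step := (step mu).
Local Notation phi := (phi mu).

Definition hit (k : nat) (x : Z2) : R :=
  iterE step k (fun s => (\sum_(z <- s) z == x)%:R).

Lemma hit0 x : hit 0 x = (x == 0)%:R.
Proof. by rewrite /hit /= big_nil eq_sym. Qed.

Lemma hitS k x : hit k.+1 x = step (fun z => hit k (x - z)).
Proof.
rewrite /hit /=; congr (step _); apply/funext => z.
by congr iterE; apply/funext => s; rewrite big_cons addrC -subr_eq opprK.
Qed.

Lemma Fubini_box (g : Z2 * (R * R) -> R) (M : R) :
  measurable_fun setT g -> (forall z w, box w -> `|g (z, w)| <= M) ->
  step (fun z => \int[plane]_(w in box) g (z, w)) =
  \int[plane]_(w in box) step (fun z => g (z, w)).
Proof.
move=> mg gM.
pose f : Z2 * (R * R) -> \bar R := (EFin \o g) \_ (setT `*` box).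
have mbox2 : measurable (setT `*` @box R : set (Z2 * (R * R))).
  by apply: measurableX => //; exact: measurable_box.
have fi : (mu \x @plane R)%E.-integrable setT f.
  rewrite /f -integrable_mkcond//.
  apply: (@le_integrable _ _ _ (mu \x @plane R)%E _ _ _ (EFin \o cst M)) => //.
  - by apply/measurable_EFinP; exact: measurable_funTS.
  - by move=> [z w] [_ /= bw]; rewrite lee_fin (le_trans (gM _ _ bw))// ler_norm.
  - apply: measurable_bounded_integrable => //.
    + rewrite [ltLHS]product_measure1E//; last exact: measurable_box.
      rewrite [X in (X * _)%E](@probability_setT _ _ _ mu) mul1e.
      by rewrite [ltLHS]plane_box ltry.
    + exact: bounded_cst.
have sec z w : f (z, w) = ((EFin \o (fun w => g (z, w))) \_ box) w.
  rewrite /f !patchE; have -> // : ((z, w) \in setT `*` @box R) = (w \in @box R).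
  apply/idP/idP => [/set_mem[_ /mem_set //]|bw].
  by apply: mem_set; split => //; exact: set_mem.
have ib z : plane.-integrable box (EFin \o (fun w : R * R => g (z, w))).
  apply: integrable_box; last by exists M => w; exact: gM.
  by apply: (measurableT_comp mg); exact: pair1_measurable.
have := Fubini fi => E.
transitivity (fine (\int[mu]_z \int[@plane R]_w f (z, w))%E).
  rewrite /step /Rintegral; congr fine; apply: eq_integral => z _.
  under [in RHS]eq_integral do rewrite sec.
  rewrite -integral_mkcond fineK//.
  by refine (integrable_fin_num _ (ib z)); exact: measurable_box.
rewrite E /Rintegral [in RHS]integral_mkcond; congr fine.
apply: eq_integral => w _; rewrite patchE; case: ifPn => bw; last first.
  rewrite integral0_eq// => z _; rewrite sec patchE ifF//.
  exact/negbTE.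
under eq_integral do rewrite sec patchE bw/=.
rewrite /= fineK//; apply: integrable_fin_num => //.
apply: (@integrable_bdd _ mu (fun z => g (z, w))); exists M => z; apply: gM.
by rewrite inE in bw.
Qed.

Lemma measurable_dot (x : Z2) :
  measurable_fun setT (fun p : Z2 * (R * R) => dot p.2 (x - p.1)).
Proof.
have m1 (h : Z2 -> R) : measurable_fun setT (fun p : Z2 * (R * R) => h p.1).
  by apply: (measurableT_comp (@measurable_Z2 R h)); exact: measurable_fst.
apply: measurable_funD; apply: measurable_funM.
- by apply: (measurableT_comp (@measurable_w1 R)); exact: measurable_snd.
- exact: (m1 (fun z => (x - z).1%:~R)).
- by apply: (measurableT_comp (@measurable_w2 R)); exact: measurable_snd.
- exact: (m1 (fun z => (x - z).2%:~R)).
Qed.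

Lemma measurable_phi : measurable_fun setT phi.
Proof.
pose f (p : Z2 * (R * R)) : \bar R := (1 + cos (dot p.2 (0 - p.1)))%:E.
have mf : measurable_fun setT f.
  apply/measurable_EFinP; apply: measurable_funD => //.
  apply: (measurableT_comp (continuous_measurable_fun (@continuous_cos R))).
  exact: measurable_dot.
have f0 p : (0 <= f p)%E by rewrite lee_fin -lerBlDl sub0r cos_geN1.
have := @measurable_fun_fubini_tonelli_G _ _ _ _ R mu f mf f0.
have -> : fubini_G mu f = EFin \o (fun w => 1 + phi w).
  apply/funext => w /=; rewrite /fubini_G /f /=.
  have -> : 1 + phi w = step (fun z => 1 + cos (dot w (0 - z))).
    rewrite (meanD (step_mean mu)) ?(mean_cst (step_mean mu)); [|by bd|by bd].
    by congr (_ + step _); apply/funext => z; rewrite sub0r dotNr cosN.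
  rewrite /step /Rintegral fineK//; apply: integrable_fin_num => //.
  by apply: integrable_bdd; bd.
move/measurable_EFinP => m1.
have -> : phi = (fun w => (1 + phi w) - 1).
  by apply/funext => w; rewrite addrAC subrr add0r.
exact: measurable_funB.
Qed.

Hypothesis hsym : forall f, step (fun z => f (- z)) = step f.

(** By symmetry the sine of the step has mean zero, which leaves the cosine in the
    addition formula. *)
Lemma step_cos_sub w x : step (fun z => cos (dot w (x - z))) = cos (dot w x) * phi w.
Proof.
have s0 : step (fun z => sin (dot w z)) = 0.
  have /= := hsym (fun z => sin (dot w z)).
  under eq_fun do rewrite dotNr sinN.
  rewrite (meanN (step_mean mu)); last by bd.
  by move=> h; lra.
under eq_fun do rewrite dotDr dotNr cosB.
rewrite (meanD (step_mean mu)); [|by bd|by bd].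
rewrite !(meanZ (step_mean mu)); [|by bd|by bd].
by rewrite s0 mulr0 addr0.
Qed.

Lemma hit_fourier k x :
  (2 * pi) ^+ 2 * hit k x = \int[plane]_(w in box) (phi w ^+ k * cos (dot w x)).
Proof.
elim: k x => [|k IHk] x.
  rewrite hit0 -integral_cos_dot.
  by apply: eq_Rintegral => w _; rewrite expr0 mul1r.
have bh : bdd (fun z => hit k (x - z)).
  exists 1 => z; apply: (iterE_norm_le (step_mean mu)) => s.
  by case: eqP; rewrite ?normr1 ?normr0.
rewrite hitS -(meanZ (step_mean mu))//.
under eq_fun do rewrite IHk.
pose g (p : Z2 * (R * R)) := phi p.2 ^+ k * cos (dot p.2 (x - p.1)).
rewrite (@Fubini_box g 1).
- apply: eq_Rintegral => w _; rewrite /g /=.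
  by rewrite (meanZ (step_mean mu)); [rewrite step_cos_sub exprSr -mulrA (mulrC (phi w))|bd].
- apply: measurable_funM.
    apply: measurable_funX; apply: (measurableT_comp measurable_phi).
    exact: measurable_snd.
  apply: (measurableT_comp (continuous_measurable_fun (@continuous_cos R))).
  exact: measurable_dot.
- move=> z w _; rewrite /g /= normrM normrX mulr_ile1 ?exprn_ge0//.
    by rewrite exprn_ile1// phi_real.
  by rewrite ler_norml cos_geN1 cos_le1.
Qed.

End inversion.


(** * Local limit theorem *)

Section lclt.
Context {R : realType} (mu : probability Z2 R).
Local Notation step := (step mu).
Local Notation phi := (phi mu).
Local Notation hit := (hit mu).
Local Notation quad := (quad mu).

Lemma qform_sqn (c : R) w : qform c 0 c w = c * sqn w.
Proof. by rewrite /qform /sqn; ring. Qed.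

Lemma integrable_gauss (a b c : R) : 0 < c -> 0 < a * c - b ^+ 2 ->
  (@plane R).-integrable setT (EFin \o (fun w => expR (- (qform a b c w / 2)))).
Proof.
move=> c0 D0; apply/integrableP; split.
  by apply/measurable_EFinP; exact: measurable_gauss.
rewrite [ltLHS](_ : _ = (2 * pi / Num.sqrt (a * c - b ^+ 2))%:E) ?ltry//.
rewrite -integral_gauss2//; apply: eq_integral => w _ /=.
by rewrite ger0_norm// expR_ge0.
Qed.

Lemma Rintegral_gauss (a b c : R) : 0 < c -> 0 < a * c - b ^+ 2 ->
  \int[@plane R]_w expR (- (qform a b c w / 2)) =
  2 * pi / Num.sqrt (a * c - b ^+ 2).
Proof. by move=> c0 D0; rewrite /Rintegral integral_gauss2. Qed.

Lemma integrable_gauss_sqn (c : R) : 0 < c ->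
  (@plane R).-integrable setT (EFin \o (fun w => expR (- (c * sqn w)))).
Proof.
move=> c0; have := @integrable_gauss (2 * c) 0 (2 * c).
rewrite expr0n subr0 => /(_ _ _)/=; move=> H.
have := H ltac:(lra) ltac:(nra).
by apply: eq_integrable => // w _ /=; rewrite qform_sqn; congr (expR _)%:E; field.
Qed.

Lemma Rintegral_gauss_sqn (c : R) : 0 < c ->
  \int[@plane R]_w expR (- (c * sqn w)) = pi / c.
Proof.
move=> c0; have := @Rintegral_gauss (2 * c) 0 (2 * c).
rewrite expr0n subr0 => H.
have {H} := H ltac:(lra) ltac:(nra).
rewrite -expr2 sqrtr_sqr ger0_norm; last by lra.
rewrite (_ : 2 * pi / (2 * c) = pi / c); last by field; rewrite gt_eqF.
move=> <-; apply: eq_Rintegral => w _; rewrite qform_sqn; congr expR; by field.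
Qed.

Hypothesis hgrp : subgroup_gen (is_atom mu) = setT.
Hypothesis haper : forall x, subgroup_gen [set (x + z : Z2) | z in is_atom mu] = setT.
Hypothesis hsym : forall f, step (fun z => f (- z)) = step f.
Hypothesis hmom : mu.-integrable setT (EFin \o @sqz R).

Definition cov11 := step (fun z => z.1%:~R ^+ 2).
Definition cov12 := step (fun z => z.1%:~R * z.2%:~R).
Definition cov22 := step (fun z => z.2%:~R ^+ 2).
Definition covdet := cov11 * cov22 - cov12 ^+ 2.

Lemma integrable_coord : [/\
  mu.-integrable setT (EFin \o (fun z : Z2 => z.1%:~R ^+ 2 : R)),
  mu.-integrable setT (EFin \o (fun z : Z2 => z.1%:~R * z.2%:~R : R)) &
  mu.-integrable setT (EFin \o (fun z : Z2 => z.2%:~R ^+ 2 : R))].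
Proof.
split; apply: (integrable_le hmom) => z; rewrite /sqz;
  move: (z.1%:~R : R) (z.2%:~R : R) => a b.
- by rewrite ger0_norm ?sqr_ge0// lerDl sqr_ge0.
- have := sqr_ge0 (a - b); have := sqr_ge0 (a + b) => h1 h2.
  by rewrite ler_norml; apply/andP; split; nra.
- by rewrite ger0_norm ?sqr_ge0// lerDr sqr_ge0.
Qed.

Lemma quadE w : quad w = qform cov11 cov12 cov22 w.
Proof.
have [i1 i2 i3] := integrable_coord.
have j1 : mu.-integrable setT (EFin \o (fun z : Z2 => w.1 ^+ 2 * z.1%:~R ^+ 2)).
  exact: (integrableZl _ _ i1).
have j2 : mu.-integrable setT (EFin \o (fun z : Z2 => 2 * w.1 * w.2 * (z.1%:~R * z.2%:~R))).
  exact: (integrableZl _ _ i2).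
have j3 : mu.-integrable setT (EFin \o (fun z : Z2 => w.2 ^+ 2 * z.2%:~R ^+ 2)).
  exact: (integrableZl _ _ i3).
have -> : quad w = step (fun z => (w.1 ^+ 2 * z.1%:~R ^+ 2 +
    2 * w.1 * w.2 * (z.1%:~R * z.2%:~R)) + w.2 ^+ 2 * z.2%:~R ^+ 2).
  by rewrite /quad; congr (step _); apply/funext => z; rewrite /dot; ring.
rewrite stepD//; last exact: (integrableD _ j1 j2).
by rewrite stepD// !stepZ// /qform /cov11 /cov12 /cov22; ring.
Qed.

Lemma covdet_gt0 : 0 < cov22 /\ 0 < covdet.
Proof.
have [c c0 hc] := quad_lb hgrp hmom.
have := hc (0, 1); rewrite quadE /qform /sqn /= !(expr0n, expr1n, mulr0, mul0r, add0r, mulr1) => h1.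
have c22 : 0 < cov22 by lra.
split => //.
have := hc (cov22, - cov12); rewrite quadE /qform /sqn /= => h2.
have h3 : 0 < c * (cov22 ^+ 2 + (- cov12) ^+ 2).
  by rewrite mulr_gt0// ltr_wpDr ?sqr_ge0// exprn_gt0.
have : 0 < cov22 * covdet.
  rewrite /covdet (_ : _ * _ = cov11 * cov22 ^+ 2 +
    2 * cov12 * cov22 * - cov12 + cov22 * (- cov12) ^+ 2); last by ring.
  exact: lt_le_trans h3 h2.
by rewrite pmulr_rgt0.
Qed.

Variable p : R.
Hypotheses (p0 : 0 < p) (p1 : p <= 1).
Hypothesis hp : mu.-integrable setT (EFin \o (fun z => sqz z * sqz z `^ p)).

(** Half of the Gaussian exponent pays for the polynomial factor. *)
Lemma sqn_powR_expR_le (c : R) (k : nat) (s : R) : 0 < c -> (0 < k)%N -> 0 <= s ->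
  k%:R * (s * s `^ p) * expR (- (c * k%:R * s)) <=
  4 / c * (2 / c) `^ p * k%:R `^ (- p) * expR (- (c * k%:R / 2 * s)).
Proof.
move=> c0 k0 s0; have kR : (0 : R) < k%:R by rewrite ltr0n.
set y := c * k%:R / 2 * s.
have y0 : 0 <= y by rewrite /y !mulr_ge0// ltW.
have cne : c != 0 by rewrite gt_eqF.
have kne : (k%:R : R) != 0 by rewrite gt_eqF.
have sE : s = 2 / c * k%:R^-1 * y by rewrite /y; move: (k%:R : R) kne => K Kne; field; rewrite Kne cne.
have h := le_mul_powR_expR y0 (ltW p0) p1.
have -> : c * k%:R * s = y + y by rewrite /y; field.
rewrite opprD expRD mulrA ler_pM2r ?expR_gt0// expRN ler_pdivrMr ?expR_gt0//.
have -> : s `^ p = (2 / c) `^ p * k%:R `^ (- p) * y `^ p.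
  have -> : k%:R `^ (- p) = (k%:R^-1) `^ p :> R.
    by rewrite -powR_inv1 ?ler0n// -powRrM mulN1r.
  have k1 : (0 : R) <= k%:R^-1 by rewrite invr_ge0.
  have c1 : 0 <= 2 / c by rewrite divr_ge0// ltW.
  by rewrite -(powRM p c1 k1) -(powRM p (mulr_ge0 c1 k1) y0) {1}sE.
set u := (2 / c) `^ p; set v := k%:R `^ _.
have uv0 : 0 <= 2 / c * u * v.
  by rewrite !mulr_ge0 ?powR_ge0 ?invr_ge0// ltW.
have -> : k%:R * (s * (u * v * y `^ p)) = 2 / c * u * v * (y * y `^ p).
  rewrite {1}sE; move: (y `^ p) (k%:R : R) kne u v {uv0} => w K Kne u v.
  by field; rewrite Kne cne.
apply: le_trans (ler_wpM2l uv0 h) _.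
by rewrite le_eqVlt; apply/orP; left; apply/eqP; ring.
Qed.

(** On the torus both powers decay like a Gaussian and their bases differ by
    [O(|w|^(2 + 2 p))]; off the torus the Gaussian itself is small. *)
Lemma phi_gauss_le : exists c K : R, [/\ 0 < c, 0 < K,
  forall w, box w -> `|phi w| <= expR (- (c * sqn w)) &
  forall k w, (0 < k)%N ->
    `|((fun w => phi w ^+ k) \_ box) w - expR (- (k%:R * quad w / 2))| <=
    K * k%:R `^ (- p) * expR (- (c * k%:R / 2 * sqn w))].
Proof.
have [c1 c10 hc1] := phi_decay hgrp haper.
have [c2 c20 hc2] := quad_lb hgrp hmom.
have [C C0 hC] := quad_ub hmom.
have [M M0 hM] := phi_taylor (ltW p0) p1 hmom hp.
pose c := Num.min c1 (c2 / 2).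
have c0 : 0 < c by rewrite lt_min c10 divr_gt0.
have cphi w : box w -> `|phi w| <= expR (- (c * sqn w)).
  move=> bw; rewrite (le_trans (hc1 _ bw))// ler_expR lerN2 ler_wpM2r ?sqn_ge0//.
  by rewrite ge_min lexx.
have cq w : expR (- (quad w / 2)) <= expR (- (c * sqn w)).
  rewrite ler_expR lerN2 (@le_trans _ _ (c2 / 2 * sqn w))//.
    by rewrite ler_wpM2r ?sqn_ge0// ge_min lexx orbT.
  by have := hc2 w; lra.
pose M' := M + C * C `^ p.
have M'0 : 0 < M' by rewrite /M' ltr_wpDr// mulr_ge0 ?powR_ge0// ltW.
have hM' w : `|phi w - expR (- (quad w / 2))| <= M' * (sqn w * sqn w `^ p).
  have s0 := sqn_ge0 w; have q0 : 0 <= quad w.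
    by apply: Rintegral_ge0 => z _; exact: sqr_ge0.
  have -> : phi w - expR (- (quad w / 2)) = (phi w - 1 + quad w / 2) -
    (expR (- (quad w / 2)) - 1 + quad w / 2) by ring.
  rewrite (le_trans (ler_normB _ _))// /M' mulrDl lerD//.
  have q20 : 0 <= quad w / 2 by lra.
  apply: le_trans (expR_taylor q20 (ltW p0) p1) _.
  rewrite mulrACA -powRM ?(ltW C0)//.
  have qC : quad w / 2 <= C * sqn w by have := hC w; lra.
  by rewrite ler_pM ?powR_ge0// ge0_ler_powR ?nnegrE ?mulr_ge0// ltW.
pose A := 4 / c * (2 / c) `^ p.
have A0 : 0 < A by rewrite /A !mulr_gt0 ?powR_gt0 ?divr_gt0 ?invr_gt0.
exists c, (A * (M' * expR (c * 32) + 1)); split => //.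
  by rewrite mulr_gt0// ltr_wpDl// mulr_ge0 ?expR_ge0// ltW.
move=> k w k0; rewrite patchE.
have kR : (1 : R) <= k%:R by rewrite ler1n.
have -> : expR (- (k%:R * quad w / 2)) = expR (- (quad w / 2)) ^+ k.
  by rewrite -expRM_natl; congr expR; ring.
set e := expR (- (c * k%:R / 2 * sqn w)).
have s0 := sqn_ge0 w.
have Mk : 0 <= M' * expR (c * 32) by rewrite mulr_ge0 ?expR_ge0// ltW.
have kp : 0 <= k%:R `^ (- p) :> R by rewrite powR_ge0.
case: (boolP (w \in @box R)) => bw.
- have {}bw : box w by exact: set_mem.
  apply: (@le_trans _ _ (A * (M' * expR (c * 32)) * k%:R `^ (- p) * e)); last first.
    rewrite ler_wpM2r ?expR_ge0// ler_wpM2r// ler_wpM2l ?(ltW A0)// lerDl//.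
  (* both coordinates are at most [pi <= 4] *)
  have s32 : sqn w <= 32.
    have H x : `|x| <= pi -> x ^+ 2 <= 16 :> R.
      move=> xpi; rewrite -[x ^+ 2]real_normK ?num_real// (_ : 16 = 4 ^+ 2); last by ring.
      by rewrite lerXn2r ?nnegrE// (le_trans xpi)//; have := @pihalf_lt2 R; lra.
    by case: bw => /H h1 /H h2; rewrite /sqn; lra.
  case: k k0 kR {kp} @e => // k _ kR e.
  (* one factor of the power is spent on the difference of the bases; the missing
     Gaussian factor [expR (c * sqn w)] is bounded on the torus *)
  have := norm_exprB_le k (cphi _ bw) (le_trans (ler_norm _) _ : `|expR (- (quad w / 2))| <= expR (- (c * sqn w))).
  move=> H; apply: le_trans (H _) _.
    by rewrite normr_id ger0_norm ?expR_ge0.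
  have -> : expR (- (c * sqn w)) ^+ k = expR (- (c * k.+1%:R * sqn w)) * expR (c * sqn w).
    rewrite -expRM_natl -expRD; congr expR; rewrite -natr1; ring.
  have h1 := hM' w.
  have h2 : expR (c * sqn w) <= expR (c * 32) by rewrite ler_expR ler_pM2l.
  have h3 := sqn_powR_expR_le c0 (ltn0Sn k) s0.
  rewrite -/A -/e in h3.
  set N := `|_ - _| in h1 *; have N0 : 0 <= N by exact: normr_ge0.
  set E1 := expR (- (c * k.+1%:R * sqn w)) in h3 *.
  set E2 := expR (c * sqn w) in h2 *; set E3 := expR (c * 32) in h2 *.
  apply: (@le_trans _ _ (k.+1%:R * (M' * (sqn w * sqn w `^ p)) * (E1 * E3))).
    rewrite ler_pM ?mulr_ge0 ?expR_ge0 ?ler_wpM2l ?expR_ge0//.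
  rewrite (_ : _ * _ * (E1 * E3) = (M' * E3) * (k.+1%:R * (sqn w * sqn w `^ p) * E1)); last by ring.
  apply: le_trans (ler_wpM2l _ h3) _; first by rewrite mulr_ge0 ?expR_ge0// ltW.
  by rewrite le_eqVlt; apply/orP; left; apply/eqP; ring.
- have {}bw : ~ box w by move: bw; rewrite notin_setE.
  apply: (@le_trans _ _ (A * k%:R `^ (- p) * e)); last first.
    rewrite ler_wpM2r ?expR_ge0// ler_wpM2r// ler_peMr ?(ltW A0)// lerDr//.
  rewrite [point](_ : _ = 0)// sub0r normrN ger0_norm ?exprn_ge0 ?expR_ge0//.
  have s1 : 1 <= sqn w.
    have p2 : 2 <= pi :> R by exact: pi_ge2.
    have H x : pi < `|x| -> 1 <= x ^+ 2 :> R.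
      move=> xpi; rewrite -[x ^+ 2]real_normK ?num_real//.
      by rewrite exprn_ege1//; lra.
    have [|] := leP `|w.1| pi => w1; last first.
      by rewrite /sqn (le_trans (H _ w1))// lerDl sqr_ge0.
    have [|] := leP `|w.2| pi => w2; last first.
      by rewrite /sqn (le_trans (H _ w2))// lerDr sqr_ge0.
    by case: bw.
  apply: (@le_trans _ _ (expR (- (c * sqn w)) ^+ k)).
    by rewrite lerXn2r ?nnegrE ?expR_ge0.
  have -> : expR (- (c * sqn w)) ^+ k = expR (- (c * k%:R / 2 * sqn w)) * e.
    by rewrite /e -expRM_natl -expRD; congr expR; field.
  rewrite ler_wpM2r ?expR_ge0//.
  have h3 := sqn_powR_expR_le c0 k0 ler01.
  rewrite powR1 !mulr1 -/A in h3.
  set y := c * k%:R / 2 in e h3 *.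
  have h4 : c * k%:R = y + y by rewrite /y; field.
  rewrite h4 opprD expRD mulrA ler_pM2r ?expR_gt0// in h3.
  apply: (@le_trans _ _ (expR (- y))).
    have y0 : 0 < y by rewrite /y !mulr_gt0// ltr0n.
    by rewrite ler_expR lerN2 ler_peMr// ltW.
  by apply: le_trans h3; rewrite ler_peMl// expR_ge0.
Qed.

(** The density at the origin of the Gaussian law with the covariance of the
    step. *)
Definition kappa := (2 * pi * Num.sqrt covdet)^-1.

(** Both estimates integrate [phi_gauss_le] through [hit_fourier]; the error
    exponent exceeds [1] because a moment of order more than [2] is finite. *)
Theorem local_limit : exists2 C, 0 < C & forall k, (0 < k)%N ->
  (forall x, hit k x <= C / k%:R) /\
  `|hit k 0 - kappa / k%:R| <= C * k%:R `^ (- (1 + p)).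
Proof.
have [c [K [c0 K0 hphi hdiff]]] := phi_gauss_le.
have [c22 D0] := covdet_gt0.
have pi0 : 0 < pi :> R by exact: pi_gt0.
have pi2 : 0 < (2 * pi) ^+ 2 :> R by rewrite exprn_gt0 ?mulr_gt0.
pose C := Num.max (pi / c / (2 * pi) ^+ 2) (K * (2 * pi / c) / (2 * pi) ^+ 2).
have C1 : pi / c / (2 * pi) ^+ 2 <= C by rewrite le_max lexx.
have C2 : K * (2 * pi / c) / (2 * pi) ^+ 2 <= C by rewrite le_max lexx orbT.
have C0 : 0 < C by rewrite (lt_le_trans _ C1)// !divr_gt0.
have mphi k x : measurable_fun setT (fun w : R * R => phi w ^+ k * cos (dot w x)).
  apply: measurable_funM; last exact: measurable_cos_dot.
  by apply: measurable_funX; exact: measurable_phi.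
have ibox k x : (@plane R).-integrable box (EFin \o (fun w => phi w ^+ k * cos (dot w x))).
  apply: integrable_box; first exact: mphi.
  exists 1 => w _; rewrite normrM normrX mulr_ile1 ?exprn_ge0//.
    by rewrite exprn_ile1// phi_real.
  by rewrite ler_norml cos_geN1 cos_le1.
exists C => // k k0; have kR : (0 : R) < k%:R by rewrite ltr0n.
have kne : (k%:R : R) != 0 by rewrite gt_eqF.
split.
- move=> x; rewrite -(ler_pM2l pi2) hit_fourier//.
  have ck0 : 0 < c * k%:R by rewrite mulr_gt0.
  have ig := integrable_gauss_sqn ck0.
  apply: (@le_trans _ _ (pi / (c * k%:R))); last first.
    rewrite (_ : pi / (c * k%:R) = (2 * pi) ^+ 2 * (pi / c / (2 * pi) ^+ 2 / k%:R)).
      by rewrite ler_pM2l// ler_pM2r ?invr_gt0.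
    by move: (pi : R) pi0 => q q0; field; rewrite kne !gt_eqF.
  rewrite -Rintegral_gauss_sqn// Rintegral_mkcond; apply: le_Rintegral => //.
  + exact: integrable_box_restrict (ibox k x).
  + move=> w _; rewrite patchE; case: ifPn => bw; last exact: expR_ge0.
    have {}bw : box w by exact: set_mem.
    rewrite (le_trans (ler_norm _))// normrM normrX.
    rewrite (@le_trans _ _ (`|phi w| ^+ k))//.
      by rewrite ler_piMr ?exprn_ge0// ler_norml cos_geN1 cos_le1.
    rewrite (_ : - (c * k%:R * sqn w) = k%:R * - (c * sqn w)); last by ring.
    by rewrite expRM_natl lerXn2r ?nnegrE ?expR_ge0// hphi.
- have k2 : 0 < k%:R * cov22 by rewrite mulr_gt0.
  have kD : 0 < (k%:R * cov11) * (k%:R * cov22) - (k%:R * cov12) ^+ 2.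
    rewrite (_ : _ - _ = k%:R ^+ 2 * covdet); last by rewrite /covdet; ring.
    by rewrite mulr_gt0// exprn_gt0.
  have kf w : qform (k%:R * cov11) (k%:R * cov12) (k%:R * cov22) w = k%:R * quad w.
    by rewrite quadE /qform; ring.
  have G := Rintegral_gauss k2 kD; have ig := integrable_gauss k2 kD.
  rewrite (_ : _ - _ = k%:R ^+ 2 * covdet) in G; last by rewrite /covdet; ring.
  rewrite sqrtrM ?sqr_ge0// sqrtr_sqr ger0_norm ?ltW// in G.
  have sD : 0 < Num.sqrt covdet by rewrite sqrtr_gt0.
  have kE : kappa / k%:R = (2 * pi / (k%:R * Num.sqrt covdet)) / (2 * pi) ^+ 2.
    by rewrite /kappa; move: (pi : R) pi0 => q q0; field; rewrite kne !gt_eqF.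
  have hE : hit k 0 = (\int[@plane R]_(w in box) phi w ^+ k) / (2 * pi) ^+ 2.
    rewrite -[LHS](mulKf (_ : (2 * pi) ^+ 2 != 0)) ?gt_eqF// hit_fourier// mulrC.
    by congr (_ / _); apply: eq_Rintegral => w _; rewrite dot0r cos0 mulr1.
  rewrite kE hE -mulrBl normrM [X in _ * X]ger0_norm ?invr_ge0 ?(ltW pi2)//.
  rewrite ler_pdivrMr// Rintegral_mkcond -G.
  have ib0 : (@plane R).-integrable setT (EFin \o ((fun w => phi w ^+ k) \_ box)).
    have := integrable_box_restrict (ibox k 0).
    apply: eq_integrable => // w _; rewrite /= !patchE; case: ifP => //= _.
    by rewrite dot0r cos0 mulr1.
  rewrite -RintegralB//.
  have ck0 : 0 < c * k%:R / 2 by rewrite !mulr_gt0.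
  have isub := integrableB measurableT ib0 ig.
  apply: le_trans (le_normr_Rintegral _ isub) _ => //.
  apply: (@le_trans _ _ (\int[@plane R]_w (K * k%:R `^ (- p) * expR (- (c * k%:R / 2 * sqn w))))).
    apply: le_Rintegral => //.
    + exact: (integrable_norm isub).
    + exact: (integrableZl _ _ (integrable_gauss_sqn ck0)).
    + by move=> w _; rewrite /= kf; exact: hdiff.
  rewrite RintegralZl//; last exact: integrable_gauss_sqn.
  rewrite Rintegral_gauss_sqn// opprD powRD; last by apply/implyP.
  rewrite powR_inv1 ?ler0n//; set q := _ `^ _.
  have q0 : 0 <= q by exact: powR_ge0.
  rewrite (_ : K * q * _ = (K * (2 * pi / c) / (2 * pi) ^+ 2) * (k%:R^-1 * q) * (2 * pi) ^+ 2).
    by rewrite ler_wpM2r ?(ltW pi2)// ler_wpM2r// mulr_ge0// invr_ge0 ltW.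
  by move: (pi : R) pi0 => r r0; field; rewrite kne !gt_eqF.
Qed.

End lclt.


(** * Exchanging the integrals over two lists of steps *)

Section swap.
Context {R : realType} (V : Type) (E : (V -> R) -> R).
Hypothesis mE : is_mean E.
Hypothesis swapE : forall F : V -> V -> R, bdd (fun p => F p.1 p.2) ->
  E (fun z => E (fun w => F z w)) = E (fun w => E (fun z => F z w)).

Lemma iterE_swap m n (F : seq V -> seq V -> R) : bdd (fun p => F p.1 p.2) ->
  iterE E m (fun s => iterE E n (fun t => F s t)) =
  iterE E n (fun t => iterE E m (fun s => F s t)).
Proof.
have swap1 k (G : V -> seq V -> R) : bdd (fun p => G p.1 p.2) ->
    E (fun z => iterE E k (G z)) = iterE E k (fun s => E (fun z => G z s)).
  elim: k G => [//|k IHk] G [M hM] /=.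
  rewrite swapE.
    congr E; apply/funext => w; rewrite -IHk//.
    by exists M => p; exact: (hM (p.1, w :: p.2)).
  exists M => p; apply: iterE_norm_le => // s; exact: (hM (p.1, p.2 :: s)).
elim: m F => [//|m IHm] F [M hM] /=.
transitivity (E (fun z => iterE E n (fun t => iterE E m (fun s => F (z :: s) t)))).
  congr E; apply/funext => z; rewrite IHm//.
  by exists M => p; exact: (hM (z :: p.1, p.2)).
apply: swap1; exists M => p; apply: iterE_norm_le => // s.
exact: (hM (p.1 :: s, p.2)).
Qed.

End swap.

Section step_swap.
Context {R : realType} (mu : probability Z2 R).

Lemma measurable_Z2Z2 (A : set (Z2 * Z2)) : measurable A.
Proof.
have -> : A = \bigcup_n (cell setT n `*` [set w | exists2 z, cell setT n z & A (z, w)]).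
  rewrite predeqE => -[z w]; split => [Azw|[n _ [/= [zn _] [y [yn _] Ayw]]]].
    exists (@choice.pickle (int * int)%type z) => //; split => //=.
    by exists z.
  suff -> : z = y by [].
  by apply: (pcan_inj (@choice.pickleK (int * int)%type)); rewrite zn yn.
by apply: bigcup_measurable => n _; apply: measurableX.
Qed.

Lemma step_swap (F : Z2 -> Z2 -> R) : bdd (fun p => F p.1 p.2) ->
  step mu (fun z => step mu (fun w => F z w)) =
  step mu (fun w => step mu (fun z => F z w)).
Proof.
move=> [M hM].
pose f (p : Z2 * Z2) : \bar R := (F p.1 p.2)%:E.
have fi : (mu \x mu)%E.-integrable setT f.
  apply: (@le_integrable _ _ _ (mu \x mu)%E _ _ _ (EFin \o cst M)) => //.
  - by move=> _ B mB; exact: measurable_Z2Z2.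
  - by move=> p _ /=; rewrite lee_fin (le_trans (hM p))// ler_norm.
  - apply: measurable_bounded_integrable => //; last exact: bounded_cst.
    rewrite -setXTT [ltLHS]product_measure1E// [X in (X * _)%E](@probability_setT _ _ _ mu).
    by rewrite mul1e [ltLHS](@probability_setT _ _ _ mu) ltry.
have fin (g : Z2 -> R) : (forall z, `|g z| <= M) ->
    (fine (\int[mu]_z (g z)%:E))%:E = (\int[mu]_z (g z)%:E)%E.
  move=> gM; rewrite fineK//; apply: integrable_fin_num => //.
  by apply: integrable_bdd; exists M.
have := Fubini fi => E.
rewrite /step /Rintegral; congr fine.
transitivity (\int[mu]_z \int[mu]_w f (z, w))%E.
  by apply: eq_integral => z _; rewrite fin// => w; exact: (hM (z, w)).
rewrite E; apply: eq_integral => w _; rewrite fin// => z; exact: (hM (z, w)).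
Qed.

End step_swap.

(** * Self-intersections of lattice paths *)

Section paths.
Context {R : realType}.
Implicit Types (s t : seq Z2).

Definition sumz s : Z2 := \sum_(z <- s) z.

Lemma sumz_cat s t : sumz (s ++ t) = sumz s + sumz t.
Proof. by rewrite /sumz big_cat. Qed.

Lemma sumz_take_drop j s : sumz (take j s) + sumz (drop j s) = sumz s.
Proof. by rewrite -sumz_cat cat_take_drop. Qed.

Definition selfint (n : nat) s : R :=
  \sum_(1 <= k < n.+1) \sum_(1 <= j < k) (sumz (take j s) == sumz (take k s))%:R.

(** The walk with steps [s] followed by [t] is seen from the junction:
    [sumz (drop j.+1 s)] leads from its position at time [j.+1] to the junction, so
    the sum vanishes when that position is visited again at time [k.+1] of [t]. *)
Definition mutint (m n : nat) s t : R :=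
  \sum_(0 <= j < m) \sum_(0 <= k < n)
    (sumz (drop j.+1 s) + sumz (take k.+1 t) == 0)%:R.

Lemma selfint_ge0 n s : 0 <= selfint n s.
Proof. by apply: sumr_ge0 => k _; apply: sumr_ge0 => j _; exact: ler0n. Qed.

Lemma mutint_ge0 m n s t : 0 <= mutint m n s t.
Proof. by apply: sumr_ge0 => k _; apply: sumr_ge0 => j _; exact: ler0n. Qed.

Lemma bdd_selfint n : bdd (selfint n).
Proof. by apply: bdd_sum => k _; apply: bdd_sum => j _; exact: bdd_bool. Qed.

Lemma bdd_mutint m n : bdd (fun p => mutint m n p.1 p.2).
Proof. by apply: bdd_sum => k _; apply: bdd_sum => j _; exact: bdd_bool. Qed.

Lemma selfintS n s : selfint n.+1 s =
  selfint n s + \sum_(0 <= j < n) (sumz (take j.+1 s) == sumz (take n.+1 s))%:R.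
Proof. by rewrite /selfint big_nat_recr//=; congr (_ + _); rewrite big_add1. Qed.

Lemma selfint0 s : selfint 0 s = 0.
Proof. by rewrite /selfint big_geq. Qed.

Lemma mutintS m n s t : mutint m n.+1 s t = mutint m n s t +
  \sum_(0 <= j < m) (sumz (drop j.+1 s) + sumz (take n.+1 t) == 0)%:R.
Proof.
by rewrite /mutint -big_split/=; apply: eq_bigr => j _; rewrite big_nat_recr.
Qed.

Lemma selfint_take n s : selfint n (take n s) = selfint n s.
Proof.
apply: eq_big_nat => k /andP[_ kn]; apply: eq_big_nat => j /andP[_ jk].
by rewrite !take_takel// ltnW// (leq_trans jk).
Qed.

Lemma selfint_cat m n s t : size s = m ->
  selfint (m + n) (s ++ t) = selfint m s + selfint n t + mutint m n s t.
Proof.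
move=> sm; elim: n => [|n IHn].
  rewrite addn0 selfint0 addr0 -selfint_take take_size_cat// /mutint.
  by rewrite big1_seq ?addr0// => j _; rewrite big_geq.
rewrite addnS !selfintS IHn mutintS -!addrA; congr (_ + (_ + _)).
rewrite [RHS]addrC -!addrA; congr (_ + _).
have tk k : take (m + k) (s ++ t) = s ++ take k t.
  by rewrite take_cat sm ltnNge leq_addr/= addKn.
rewrite (@big_cat_nat _ _ _ m)//= ?leq_addr// -addnS tk; congr (_ + _).
  apply: eq_big_nat => j /andP[_ jm].
  rewrite takel_cat ?sm// sumz_cat -(sumz_take_drop j.+1 s) -addrA eq_sym.
  by rewrite -subr_eq0 addrAC subrr add0r.
rewrite -{1}[m]add0n big_addn addKn; apply: eq_big_nat => j /andP[_ jn].
by rewrite addnC -addnS tk !sumz_cat (inj_eq (addrI _)).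
Qed.

Lemma selfint_le_cat m n s t : size s = m ->
  selfint m s <= selfint (m + n) (s ++ t).
Proof.
move=> sm; rewrite selfint_cat// -addrA lerDl addr_ge0//; first exact: selfint_ge0.
exact: mutint_ge0.
Qed.

End paths.


(** * Moments of the number of mutual intersections *)

Section sqrt_sums.
Context {R : realType}.

Definition rsqrt (n : nat) : R := (Num.sqrt n.+1%:R)^-1.

Lemma rsqrt_gt0 n : 0 < rsqrt n.
Proof. by rewrite invr_gt0 sqrtr_gt0 ltr0n. Qed.

Lemma sum_rsqrt_le n : \sum_(0 <= i < n) rsqrt i <= 2 * Num.sqrt n%:R.
Proof.
elim: n => [|n IHn]; first by rewrite big_geq// sqrtr0 mulr0.
rewrite big_nat_recr//= /rsqrt (le_trans (lerD IHn (lexx _)))//.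
set a := Num.sqrt n%:R; set b := Num.sqrt n.+1%:R.
have b0 : 0 < b by rewrite sqrtr_gt0 ltr0n.
have a2 : a ^+ 2 = n%:R by rewrite sqr_sqrtr.
have b2 : b ^+ 2 = n%:R + 1 by rewrite sqr_sqrtr// natr1.
have -> : 2 * a + b^-1 = (2 * a * b + 1) / b by field; rewrite gt_eqF.
rewrite ler_pdivrMr//; have := sqr_ge0 (b - a); nra.
Qed.

Definition ndist (i j : nat) : nat := ((i - j) + (j - i))%N.

Lemma ndistC i j : ndist i j = ndist j i.
Proof. by rewrite /ndist addnC. Qed.

Lemma sum_rsqrt_dist_le n i : (i < n)%N ->
  \sum_(0 <= j < n) rsqrt (ndist i j) <= 4 * Num.sqrt n%:R.
Proof.
move=> i_n; rewrite (@big_cat_nat _ _ _ i)//=; last exact: ltnW.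
have -> : \sum_(0 <= j < i) rsqrt (ndist i j) = \sum_(0 <= j < i) rsqrt j.+1.
  rewrite big_nat_rev/= add0n; apply: eq_big_nat => j /andP[_ ji].
  by congr rsqrt; rewrite /ndist; lia.
have -> : \sum_(i <= j < n) rsqrt (ndist i j) = \sum_(0 <= j < n - i) rsqrt j.
  rewrite -{1}[i]add0n big_addn; apply: eq_big_nat => j _.
  by congr rsqrt; rewrite /ndist; lia.
have h1 : \sum_(0 <= j < i) rsqrt j.+1 <= \sum_(0 <= j < n) rsqrt j.
  rewrite (@big_cat_nat _ _ _ i _ _ predT rsqrt)//=; last exact: ltnW.
  rewrite -[leLHS]addr0 lerD//; last by apply: sumr_ge0 => *; exact/ltW/rsqrt_gt0.
  apply: ler_sum => j _; rewrite lef_pV2 ?posrE ?sqrtr_gt0 ?ltr0n//.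
  by rewrite ler_sqrt// ler_nat.
have h2 : \sum_(0 <= j < n - i) rsqrt j <= \sum_(0 <= j < n) rsqrt j.
  rewrite [leRHS](@big_cat_nat _ _ _ (n - i) _ _ predT rsqrt) ?leq_subr//=.
  by rewrite -[leLHS]addr0 lerD//; apply: sumr_ge0 => *; exact/ltW/rsqrt_gt0.
have := sum_rsqrt_le n; lra.
Qed.

(** Bounding a sum of two times below by their geometric mean separates them, so
    that double sums over times factor. *)
Lemma invS_le_rsqrt i k : ((i + k).+1%:R : R)^-1 <= rsqrt i * rsqrt k.
Proof.
rewrite /rsqrt -invfM -sqrtrM//; set a := (_ * _).
have a0 : 0 < a by rewrite mulr_gt0 ?ltr0n.
rewrite lef_pV2 ?posrE ?sqrtr_gt0 ?ltr0n//.
rewrite -[leRHS]ger0_norm// -sqrtr_sqr ler_sqrt ?exprn_ge0//.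
rewrite /a -natrM -natrX ler_nat; lia.
Qed.

End sqrt_sums.

Section moments.
Local Arguments iterE : simpl never.
Context {R : realType} (mu : probability Z2 R).
Local Notation hit := (hit mu).
Local Notation Ex := (iterE (step mu)).
Let mE n := iterE_mean (step_mean mu) n.

Lemma Ex_swap m n (F : seq Z2 -> seq Z2 -> R) : bdd (fun p => F p.1 p.2) ->
  Ex m (fun s => Ex n (fun t => F s t)) = Ex n (fun t => Ex m (fun s => F s t)).
Proof. exact: iterE_swap (step_mean mu) (@step_swap _ mu) m n F. Qed.

Lemma hit_ge0 k x : 0 <= hit k x.
Proof. by apply: (mean_ge0 (mE k)) => [|s]; [bd|exact: ler0n]. Qed.

Lemma hit_le1 k x : hit k x <= 1.
Proof.
rewrite -[leRHS](mean_cst (mE k)); apply: (mean_le (mE k)); [bd|bd|].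
by move=> s; rewrite lern1 leq_b1.
Qed.

Lemma bdd_hit (W : Type) k (h : W -> Z2) : bdd (fun w => hit k (h w)).
Proof. by exists 1 => w; rewrite ger0_norm ?hit_le1// hit_ge0. Qed.

Lemma Ex_take n b y : (b <= n)%N ->
  Ex n (fun t => (sumz (take b t) == y)%:R) = hit b y.
Proof.
move=> bn; rewrite -{1}(subnKC bn).
exact: (iterE_catl (step_mean mu) b _ (fun s => (sumz s == y)%:R)).
Qed.

Lemma Ex_drop m a x : (a <= m)%N ->
  Ex m (fun t => (sumz (drop a t) == x)%:R) = hit (m - a) x.
Proof.
move=> am; rewrite -{1}(subnKC am).
exact: (iterE_catr (step_mean mu) a _ (fun s => (sumz s == x)%:R)).
Qed.

Lemma Ex_conv i b y : Ex i (fun s => hit b (y - sumz s)) = hit (i + b) y.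
Proof.
rewrite -[RHS]/(Ex (i + b) (fun s => (sumz s == y)%:R)) iterE_cat.
congr iterE; apply/funext => s.
congr iterE; apply/funext => t.
by rewrite -!/(sumz _) sumz_cat eq_sym subr_eq eq_sym addrC.
Qed.

Lemma Ex_drop_hit m a b y : (a <= m)%N ->
  Ex m (fun s => hit b (y - sumz (drop a s))) = hit (m - a + b) y.
Proof.
move=> am; rewrite -{1}(subnKC am).
rewrite (iterE_catr (step_mean mu) a _ (fun s => hit b (y - sumz s))).
exact: Ex_conv.
Qed.

Lemma Ex_take_hit n b i x : (b <= n)%N ->
  Ex n (fun t => hit i (x - sumz (take b t))) = hit (b + i) x.
Proof.
move=> bn; rewrite -{1}(subnKC bn).
rewrite (iterE_catl (step_mean mu) b _ (fun s => hit i (x - sumz s))).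
exact: Ex_conv.
Qed.

Lemma add_eq0 (x y : Z2) : (x + y == 0) = (y == 0 - x).
Proof. by rewrite sub0r addrC addr_eq0. Qed.

Lemma Ex_meet m n a b : (a <= m)%N -> (b <= n)%N ->
  Ex m (fun s => Ex n (fun t => (sumz (drop a s) + sumz (take b t) == 0)%:R)) =
  hit (m - a + b) 0.
Proof.
move=> am bn; rewrite -Ex_drop_hit//; congr iterE; apply/funext => s.
by under eq_fun do rewrite add_eq0; rewrite Ex_take.
Qed.

Definition meanself n : R := Ex n (selfint n).

(** The new endpoint coincides with the position [l] steps earlier with
    probability [hit l 0]. *)
Lemma meanselfS n :
  meanself n.+1 = meanself n + \sum_(1 <= l < n.+1) hit l 0.
Proof.
rewrite /meanself (_ : selfint n.+1 = fun s => selfint n s +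
    \sum_(0 <= j < n) (sumz (take j.+1 s) == sumz (take n.+1 s))%:R); last first.
  by apply/funext => s; rewrite selfintS.
rewrite (meanD (mE n.+1)); [|exact: bdd_selfint|by bd].
congr (_ + _).
  have <- := iterE_catl (step_mean mu) n 1 (selfint n).
  by rewrite addn1; congr iterE; apply/funext => s; rewrite selfint_take.
rewrite (mean_sum (mE n.+1)); last by move=> j _; bd.
rewrite big_add1/= big_nat_rev/= add0n; apply: eq_big_nat => j /andP[_ jn].
have -> : hit j.+1 0 = hit (n.+1 - (n - j.+1).+1) 0 by congr (hit _ _); lia.
rewrite -Ex_drop; last by lia.
apply: eq_iterE => s sn; rewrite [take n.+1 _]take_oversize ?sn//.
by rewrite -(sumz_take_drop (n - j.+1).+1 s) -subr_eq0 opprD addrA subrr sub0r oppr_eq0.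
Qed.

Lemma meanself0 : meanself 0 = 0.
Proof. exact: selfint0. Qed.

Definition meanmut m n : R := Ex m (fun s => Ex n (mutint m n s)).

Lemma bdd_mutintr m n s : bdd (@mutint R m n s).
Proof. by have [M hM] := @bdd_mutint R m n; exists M => t; exact: (hM (s, t)). Qed.

Lemma meanself_cat m n : meanself (m + n) = meanself m + meanself n + meanmut m n.
Proof.
rewrite /meanself /meanmut iterE_cat.
transitivity (Ex m (fun s => selfint m s + meanself n + Ex n (mutint m n s))).
  apply: eq_iterE => s sm.
  under eq_fun do rewrite (selfint_cat _ _ sm).
  rewrite (meanD (mE n)); [|by apply: bddD; [bd|exact: bdd_selfint]|exact: bdd_mutintr].
  by rewrite (meanD (mE n)) ?(mean_cst (mE n))//; [bd|exact: bdd_selfint].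
have bI : bdd (fun s => Ex n (mutint m n s)).
  exact: (bdd_iterE (step_mean mu) n (bdd_mutint m n)).
rewrite (meanD (mE m))//; last by apply: bddD; [exact: bdd_selfint|bd].
rewrite (meanD (mE m)) ?(mean_cst (mE m))//; [exact: bdd_selfint|by bd].
Qed.

Variables (C : R).
Hypothesis hC : forall k x, hit k x <= C / k.+1%:R.

Lemma C_ge0 : 0 <= C.
Proof. by have := hC 0 0; rewrite divr1; exact: le_trans (hit_ge0 _ _). Qed.

(** The last [r] steps decide the second event; given them, the first one asks the
    other [d] steps to end at a prescribed point. *)
Lemma Ex_join_le d r x y :
  Ex (d + r) (fun s => (sumz s == x)%:R * (sumz (drop d s) == y)%:R) <=
  C / d.+1%:R * hit r y.
Proof.
rewrite iterE_cat.
have -> : Ex d (fun s => Ex r (fun t =>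
      (sumz (s ++ t) == x)%:R * (sumz (drop d (s ++ t)) == y)%:R)) =
    Ex d (fun s => Ex r (fun t =>
      (sumz t == y)%:R * (sumz s == x - sumz t)%:R)).
  apply: eq_iterE => s sd; congr iterE; apply/funext => t.
  rewrite (drop_size_cat _ sd) mulrC sumz_cat; congr (_ * (nat_of_bool _)%:R).
  by rewrite [RHS]eq_sym subr_eq eq_sym.
rewrite Ex_swap; last by apply: bddM; exact: bdd_bool.
rewrite mulrC -(meanZr (mE r)); last by bd.
apply: (mean_le (mE r)).
- by apply: bdd_iterE; [exact: step_mean|apply: bddM; exact: bdd_bool].
- by bd.
- move=> t; rewrite (meanZ (mE d)); last by bd.
  by apply: ler_wpM2l => //; exact: hC.
Qed.

Lemma Ex_two_drops_le m a b x y : (a <= b)%N -> (b <= m)%N ->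
  Ex m (fun s => (sumz (drop a s) == x)%:R * (sumz (drop b s) == y)%:R) <=
  C / (b - a).+1%:R * hit (m - b) y.
Proof.
move=> ab bm; have am := leq_trans ab bm.
pose G s := (sumz s == x)%:R * (sumz (drop (b - a) s) == y)%:R : R.
have -> : Ex m (fun s => (sumz (drop a s) == x)%:R * (sumz (drop b s) == y)%:R) =
    Ex (a + (m - a)) (fun s => G (drop a s)).
  rewrite subnKC//; congr iterE; apply/funext => s.
  by rewrite /G drop_drop subnK.
rewrite iterE_catr; last exact: step_mean.
rewrite (_ : m - a = (b - a) + (m - b))%N; last by lia.
exact: Ex_join_le.
Qed.

Lemma sumz_cat_eqr s t (y : Z2) : (sumz (s ++ t) == y) = (sumz t == y - sumz s).
Proof. by rewrite sumz_cat [RHS]eq_sym subr_eq eq_sym addrC. Qed.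

Lemma Ex_two_takes_le n a b x y : (a <= b)%N -> (b <= n)%N ->
  Ex n (fun s => (sumz (take a s) == x)%:R * (sumz (take b s) == y)%:R) <=
  C / (b - a).+1%:R * hit a x.
Proof.
move=> ab bn.
pose G s := (sumz (take a s) == x)%:R * (sumz s == y)%:R : R.
have -> : Ex n (fun s => (sumz (take a s) == x)%:R * (sumz (take b s) == y)%:R) =
    Ex (b + (n - b)) (fun s => G (take b s)).
  rewrite subnKC//; congr iterE; apply/funext => s.
  by rewrite /G take_takel.
rewrite iterE_catl; last exact: step_mean.
rewrite -(subnKC ab) iterE_cat addKn mulrC -(meanZr (mE a)); last by bd.
have -> : Ex a (fun s => Ex (b - a) (fun t => G (s ++ t))) =
    Ex a (fun s => Ex (b - a) (fun t => (sumz s == x)%:R * (sumz t == y - sumz s)%:R)).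
  apply: eq_iterE => s sa; congr iterE; apply/funext => t.
  by rewrite /G (take_size_cat _ sa) sumz_cat_eqr.
apply: (mean_le (mE a)).
- by apply: bdd_iterE; [exact: step_mean|apply: bddM; exact: bdd_bool].
- by bd.
- move=> s; rewrite (meanZ (mE (b - a))); last by bd.
  by apply: ler_wpM2l => //; exact: hC.
Qed.

Definition meet2 m n a b a' b' := Ex m (fun s => Ex n (fun t =>
    (sumz (drop a s) + sumz (take b t) == 0)%:R *
    (sumz (drop a' s) + sumz (take b' t) == 0)%:R)).

Lemma meet2C m n a b a' b' : meet2 m n a b a' b' = meet2 m n a' b' a b.
Proof.
rewrite /meet2; congr iterE; apply/funext => s; congr iterE; apply/funext => t.
exact: mulrC.
Qed.

Lemma meet2_le_drop m n a b a' b' : (a <= a')%N -> (a' <= m)%N -> (b' <= n)%N ->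
  meet2 m n a b a' b' <= C / (a' - a).+1%:R * hit (m - a' + b') 0.
Proof.
move=> aa am bn; rewrite /meet2 Ex_swap; last by apply: bddM; exact: bdd_bool.
rewrite addnC -(@Ex_take_hit n)// -(meanZ (mE n)); last exact: bdd_hit.
apply: (mean_le (mE n)).
- by apply: bdd_iterE; [exact: step_mean|apply: bddM; exact: bdd_bool].
- by apply: bddM; [bd|exact: bdd_hit].
- move=> t; under eq_fun do rewrite ![sumz (drop _ _) + _]addrC !add_eq0.
  exact: Ex_two_drops_le.
Qed.

Lemma meet2_le_take m n a b a' b' : (b <= b')%N -> (a <= m)%N -> (b' <= n)%N ->
  meet2 m n a b a' b' <= C / (b' - b).+1%:R * hit (m - a + b) 0.
Proof.
move=> bb am bn; rewrite /meet2.
rewrite -(@Ex_drop_hit m)// -(meanZ (mE m)); last exact: bdd_hit.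
apply: (mean_le (mE m)).
- by apply: bdd_iterE; [exact: step_mean|apply: bddM; exact: bdd_bool].
- by apply: bddM; [bd|exact: bdd_hit].
- move=> s; under eq_fun do rewrite !add_eq0.
  exact: Ex_two_takes_le.
Qed.

(** Two meetings at times that are far apart: the walk has to return once more
    in between, which costs [C] over the distance. *)
Lemma meet2_le m n a b a' b' :
  (a <= m)%N -> (b <= n)%N -> (a' <= m)%N -> (b' <= n)%N ->
  meet2 m n a b a' b' <= C * (rsqrt (ndist a a') * rsqrt (ndist b b')) *
    (hit (m - a + b) 0 + hit (m - a' + b') 0).
Proof.
move=> am bn am' bn'; set X := _ + _.
have h1 := hit_ge0 (m - a + b) 0; have h2 := hit_ge0 (m - a' + b') 0.
have additive0 : 0 <= X by rewrite addr_ge0.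
have C0 := C_ge0.
have P1 : meet2 m n a b a' b' <= C / (ndist a a').+1%:R * X.
  have c0 : 0 <= C / (ndist a a').+1%:R by rewrite divr_ge0.
  have [aa|/ltnW aa] := leqP a a'.
    rewrite (le_trans (meet2_le_drop _ aa am' bn'))//.
    rewrite (_ : ndist a a' = a' - a)%N in c0 *; last by rewrite /ndist; lia.
    by rewrite ler_wpM2l// lerDr.
  rewrite meet2C (le_trans (meet2_le_drop _ aa am bn))//.
  rewrite (_ : ndist a a' = a - a')%N in c0 *; last by rewrite /ndist; lia.
  by rewrite ler_wpM2l// lerDl.
have P2 : meet2 m n a b a' b' <= C / (ndist b b').+1%:R * X.
  have c0 : 0 <= C / (ndist b b').+1%:R by rewrite divr_ge0.
  have [bb|/ltnW bb] := leqP b b'.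
    rewrite (le_trans (meet2_le_take _ bb am bn'))//.
    rewrite (_ : ndist b b' = b' - b)%N in c0 *; last by rewrite /ndist; lia.
    by rewrite ler_wpM2l// lerDl.
  rewrite meet2C (le_trans (meet2_le_take _ bb am' bn))//.
  rewrite (_ : ndist b b' = b - b')%N in c0 *; last by rewrite /ndist; lia.
  by rewrite ler_wpM2l// lerDr.
have P0 : 0 <= meet2 m n a b a' b'.
  apply: (mean_ge0 (mE m)).
    by apply: bdd_iterE; [exact: step_mean|apply: bddM; exact: bdd_bool].
  move=> s; apply: (mean_ge0 (mE n)); first by bd.
  by move=> t; rewrite mulr_ge0.
(* the geometric mean of the two bounds separates the variables *)
have sq (k : nat) : (k.+1%:R : R)^-1 = rsqrt k ^+ 2.
  by rewrite /rsqrt exprVn sqr_sqrtr.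
rewrite sq in P1; rewrite sq in P2.
rewrite -[leLHS]ger0_norm// -sqrtr_sqr -[leRHS]ger0_norm; last first.
  by rewrite !mulr_ge0// ltW// rsqrt_gt0.
rewrite -sqrtr_sqr ler_sqrt ?sqr_ge0// expr2.
apply: le_trans (ler_pM P0 P0 P1 P2) _.
by rewrite le_eqVlt; apply/orP; left; apply/eqP; ring.
Qed.

Lemma hit_le_rsqrt m a b : (a < m)%N ->
  hit (m - a.+1 + b.+1) 0 <= C * (rsqrt (m - a.+1) * rsqrt b).
Proof.
move=> am; apply: le_trans (hC _ _) _; rewrite ler_wpM2l ?C_ge0//.
apply: le_trans (invS_le_rsqrt _ _).
rewrite lef_pV2 ?posrE ?ltr0n// ler_nat; lia.
Qed.

Lemma sum_rsqrt_rev m : \sum_(0 <= a < m) rsqrt (m - a.+1) <= 2 * Num.sqrt m%:R :> R.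
Proof.
apply: le_trans (sum_rsqrt_le m).
by rewrite [leRHS]big_nat_rev/= add0n.
Qed.

(** The number of pairs of times weighted by the return probability at their
    distance. *)
Lemma meanmut_le m n :
  meanmut m n <= 4 * C * (Num.sqrt m%:R * Num.sqrt n%:R).
Proof.
have bI j k : bdd (fun s => Ex n (fun t => (sumz (drop j s) + sumz (take k t) == 0)%:R : R)).
  by apply: bdd_iterE; [exact: step_mean|exact: bdd_bool].
have -> : meanmut m n = \sum_(0 <= j < m) \sum_(0 <= k < n) hit (m - j.+1 + k.+1) 0.
  transitivity (Ex m (fun s => \sum_(0 <= j < m) \sum_(0 <= k < n)
      Ex n (fun t => (sumz (drop j.+1 s) + sumz (take k.+1 t) == 0)%:R))).
    congr iterE; apply/funext => s; rewrite (mean_sum (mE n)); last by move=> j _; bd.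
    by apply: eq_bigr => j _; rewrite (mean_sum (mE n))//; move=> k _; bd.
  rewrite (mean_sum (mE m)); last by move=> j _; apply: bdd_sum => k _.
  apply: eq_big_nat => j /andP[_ jm]; rewrite (mean_sum (mE m)); last by move=> k _.
  by apply: eq_big_nat => k /andP[_ kn]; rewrite Ex_meet.
apply: (@le_trans _ _ (C * ((\sum_(0 <= j < m) rsqrt (m - j.+1)) * \sum_(0 <= k < n) rsqrt k))).
  rewrite mulr_suml mulr_sumr; apply: ler_sum_nat => j /andP[_ jm].
  rewrite !mulr_sumr; apply: ler_sum_nat => k /andP[_ kn].
  exact: hit_le_rsqrt.
rewrite (_ : 4 * C * _ = C * ((2 * Num.sqrt m%:R) * (2 * Num.sqrt n%:R))); last by ring.
rewrite ler_wpM2l ?C_ge0// ler_pM ?sum_rsqrt_rev ?sum_rsqrt_le//;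
  by apply: sumr_ge0 => *; exact/ltW/rsqrt_gt0.
Qed.

Definition grid m n := [seq (j, k) | j <- iota 0 m, k <- iota 0 n].

Lemma grid_lt m n p : p \in grid m n -> (p.1 < m)%N /\ (p.2 < n)%N.
Proof.
by case/allpairsP => -[j k] /= []; rewrite !mem_iota !add0n => /andP[_ ?] /andP[_ ?] ->.
Qed.

Lemma big_grid m n (F : nat -> nat -> R) :
  \sum_(p <- grid m n) F p.1 p.2 = \sum_(0 <= j < m) \sum_(0 <= k < n) F j k.
Proof. by rewrite /grid big_allpairs /index_iota !subn0. Qed.

Lemma ler_sum_mem (I : eqType) (r : seq I) (F G : I -> R) :
  (forall i, i \in r -> F i <= G i) -> \sum_(i <- r) F i <= \sum_(i <- r) G i.
Proof. by move=> FG; rewrite big_seq [leRHS]big_seq; apply: ler_sum. Qed.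

(** Up to a constant, [meet_weight m p] dominates the probability of a meeting at
    the pair of times [p], and [meet_gap p q] is the price of another meeting at
    [q], see [meet2_le]. *)
Definition meet_weight m (p : nat * nat) : R := rsqrt (m - p.1.+1) * rsqrt p.2.

Definition meet_gap (p q : nat * nat) : R :=
  rsqrt (ndist p.1 q.1) * rsqrt (ndist p.2 q.2).

Lemma sum_weight_gap_le m n :
  \sum_(p <- grid m n) \sum_(q <- grid m n) meet_weight m p * meet_gap p q <=
  64 * (m%:R * n%:R).
Proof.
apply: (@le_trans _ _ (\sum_(p <- grid m n) meet_weight m p *
    (16 * (Num.sqrt m%:R * Num.sqrt n%:R)))).
  apply: ler_sum_mem => p /grid_lt[pm pn]; rewrite -mulr_sumr.
  apply: ler_wpM2l; first by rewrite mulr_ge0// ltW// rsqrt_gt0.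
  rewrite (@big_grid m n (fun j k => rsqrt (ndist p.1 j) * rsqrt (ndist p.2 k))).
  under eq_bigr do rewrite -mulr_sumr; rewrite -mulr_suml.
  rewrite (_ : 16 * _ = (4 * Num.sqrt m%:R) * (4 * Num.sqrt n%:R)); last by ring.
  by rewrite ler_pM ?sum_rsqrt_dist_le//; apply: sumr_ge0 => *; exact/ltW/rsqrt_gt0.
rewrite -mulr_suml (@big_grid m n (fun j k => rsqrt (m - j.+1) * rsqrt k)).
under eq_bigr do rewrite -mulr_sumr; rewrite -mulr_suml.
apply: (@le_trans _ _ ((2 * Num.sqrt m%:R) * (2 * Num.sqrt n%:R) *
    (16 * (Num.sqrt m%:R * Num.sqrt n%:R)))).
  rewrite ler_wpM2r ?mulr_ge0 ?sqrtr_ge0// ler_pM ?sum_rsqrt_rev ?sum_rsqrt_le//;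
    by apply: sumr_ge0 => *; exact/ltW/rsqrt_gt0.
have hm : Num.sqrt m%:R ^+ 2 = m%:R :> R by rewrite sqr_sqrtr.
have hn : Num.sqrt n%:R ^+ 2 = n%:R :> R by rewrite sqr_sqrtr.
by rewrite -[X in _ <= 64 * (X * _)]hm -[X in _ <= 64 * (_ * X)]hn
  le_eqVlt; apply/orP; left; apply/eqP; ring.
Qed.

(** The second moment has the order of the square of the bound [meanmut_le] on the
    mean. *)
Lemma meanmut2_le m n :
  Ex m (fun s => Ex n (fun t => mutint m n s t ^+ 2)) <=
  128 * C ^+ 2 * (m%:R * n%:R).
Proof.
pose e (p : nat * nat) s t : R := (sumz (drop p.1.+1 s) + sumz (take p.2.+1 t) == 0)%:R.
have be p q s : bdd (fun t => e p s t * e q s t) by bd.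
have bEe p q : bdd (fun s => Ex n (fun t => e p s t * e q s t)).
  by apply: bdd_iterE; [exact: step_mean|apply: bddM; exact: bdd_bool].
have -> : Ex m (fun s => Ex n (fun t => mutint m n s t ^+ 2)) =
    \sum_(p <- grid m n) \sum_(q <- grid m n) meet2 m n p.1.+1 p.2.+1 q.1.+1 q.2.+1.
  transitivity (Ex m (fun s => \sum_(p <- grid m n) \sum_(q <- grid m n)
      Ex n (fun t => e p s t * e q s t))).
    congr iterE; apply/funext => s.
    transitivity (Ex n (fun t => \sum_(p <- grid m n) \sum_(q <- grid m n) e p s t * e q s t)).
      congr iterE; apply/funext => t; rewrite expr2 /mutint.
      rewrite -(big_grid m n (fun j k => (sumz (drop j.+1 s) + sumz (take k.+1 t) == 0)%:R)).
      by rewrite mulr_suml; apply: eq_bigr => p _; rewrite mulr_sumr.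
    rewrite (mean_sum (mE n)); last by move=> p _; apply: bdd_sum => q _.
    by apply: eq_bigr => p _; rewrite (mean_sum (mE n)).
  rewrite (mean_sum (mE m)); last by move=> p _; apply: bdd_sum => q _.
  by apply: eq_bigr => p _; rewrite (mean_sum (mE m)).
apply: (@le_trans _ _ (\sum_(p <- grid m n) \sum_(q <- grid m n)
    C ^+ 2 * (meet_weight m p * meet_gap p q + meet_weight m q * meet_gap q p))).
  apply: ler_sum_mem => p /grid_lt[pm pn]; apply: ler_sum_mem => q /grid_lt[qm qn].
  apply: le_trans (meet2_le _ _ _ _) _ => //.
  have -> a b : ndist a.+1 b.+1 = ndist a b by rewrite /ndist; lia.
  have h1 := hit_le_rsqrt p.2 pm; have h2 := hit_le_rsqrt q.2 qm.
  have -> : meet_gap q p = meet_gap p q by rewrite /meet_gap ndistC (ndistC q.2).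
  have d0 : 0 <= meet_gap p q by rewrite mulr_ge0// ltW// rsqrt_gt0.
  rewrite -mulrDl -/(meet_gap p q).
  rewrite (_ : C ^+ 2 * _ = C * meet_gap p q * (C * meet_weight m p + C * meet_weight m q)).
    by apply: ler_wpM2l; [rewrite mulr_ge0// C_ge0|exact: lerD].
  by ring.
under eq_bigr do rewrite -mulr_sumr big_split/=.
rewrite -mulr_sumr big_split/= [X in _ + X]exchange_big/=.
rewrite (_ : 128 * _ * _ = C ^+ 2 * (64 * (m%:R * n%:R) + 64 * (m%:R * n%:R))); last by ring.
by apply: ler_wpM2l; [exact: sqr_ge0|apply: lerD; exact: sum_weight_gap_le].
Qed.

End moments.


(** * Asymptotics of the mean number of self-intersections *)

Section log_asymptotics.
Context {R : realType}.

Lemma ln_succ_bounds (n : nat) : (0 < n)%N ->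
  n.+1%:R^-1 <= ln n.+1%:R - ln n%:R :> R /\ ln n.+1%:R - ln n%:R <= n%:R^-1 :> R.
Proof.
move=> n0; have nR : (0 : R) < n%:R by rewrite ltr0n.
have n1R : (0 : R) < n.+1%:R by rewrite ltr0n.
split.
- have : ln (n%:R / n.+1%:R) <= - n.+1%:R^-1 :> R.
    have -> : n%:R / n.+1%:R = 1 + - n.+1%:R^-1 :> R.
      have -> : n%:R = n.+1%:R - 1 :> R by rewrite -natr1 addrK.
      by rewrite mulrBl divff ?gt_eqF// mul1r.
    by rewrite le_ln1Dx// ltrN2 invf_lt1// ltr1n.
  by rewrite ln_div ?posrE// lerNr opprB.
- rewrite -ln_div ?posrE//.
  have -> : n.+1%:R / n%:R = 1 + n%:R^-1 :> R.
    by rewrite -natr1 mulrDl divff ?gt_eqF// mul1r.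
  by rewrite le_ln1Dx// (lt_trans _ (_ : 0 < _)) ?invr_gt0// ltrN10.
Qed.

Lemma harmonic_bounds n :
  ln n.+1%:R <= \sum_(1 <= l < n.+1) (l%:R : R)^-1 /\
  \sum_(1 <= l < n.+1) (l%:R : R)^-1 <= 1 + ln n.+1%:R.
Proof.
suff [h1 h2] : ln n.+1%:R <= \sum_(1 <= l < n.+1) (l%:R : R)^-1 /\
    ((0 < n)%N -> \sum_(1 <= l < n.+1) (l%:R : R)^-1 <= 1 + ln n%:R).
  split => //; case: n h1 h2 => [|n] h1 h2.
    by rewrite big_nil ln1 addr0.
  apply: le_trans (h2 isT) _; rewrite lerD2l ler_ln ?posrE ?ltr0n// ler_nat//.
elim: n => [|n [IH1 IH2]].
  by rewrite big_nil ln1.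
rewrite big_nat_recr//=; have [h1 h2] := @ln_succ_bounds n.+1 isT.
split; first by rewrite -lerBlDr (le_trans _ IH1)// lerBlDr -lerBlDl.
case: n IH1 IH2 h1 h2 => [|n] IH1 IH2 h1 h2 _.
  by rewrite big_nil ln1 invr1 add0r addr0.
have [h3 h4] := @ln_succ_bounds n.+1 isT.
by rewrite (le_trans (lerD (IH2 isT) h3))// addrA lerBlDr addrAC.
Qed.

End log_asymptotics.

Section meanself_asymptotics.
Context {R : realType} (mu : probability Z2 R).
Local Notation hit := (hit mu).
Variables (kap C p : R).
Hypotheses (kap0 : 0 <= kap) (C0 : 0 <= C) (p0 : 0 < p).
Hypothesis hlim : forall k, (0 < k)%N ->
  `|hit k 0 - kap / k%:R| <= C * k%:R `^ (- (1 + p)).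

(** The errors of the local limit theorem are summable, and the main terms form a
    harmonic sum. *)
Lemma green_asymp n :
  `|\sum_(1 <= l < n.+1) hit l 0 - kap * ln n.+1%:R| <= C * (1 + p^-1) + kap.
Proof.
have [h1 h2] := @harmonic_bounds R n.
set H := \sum_(1 <= l < n.+1) _ in h1 h2.
have e1 : `|\sum_(1 <= l < n.+1) hit l 0 - kap * H| <= C * (1 + p^-1).
  rewrite /H mulr_sumr -sumrB; apply: le_trans (ler_norm_sum _ _ _) _.
  apply: (@le_trans _ _ (\sum_(1 <= l < n.+1) C * l%:R `^ (- (1 + p)))).
    by apply: ler_sum_nat => l /andP[l0 _]; exact: hlim.
  by rewrite -mulr_sumr ler_wpM2l// sum_powR_le.
have e2 : `|kap * H - kap * ln n.+1%:R| <= kap.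
  by rewrite -mulrBr normrM ger0_norm// ler_piMr// ger0_norm; lra.
have -> : \sum_(1 <= l < n.+1) hit l 0 - kap * ln n.+1%:R =
  (\sum_(1 <= l < n.+1) hit l 0 - kap * H) + (kap * H - kap * ln n.+1%:R) by ring.
by rewrite (le_trans (ler_normD _ _))// lerD.
Qed.

Lemma meanself_asymp n :
  `|meanself mu n - kap * (n%:R * ln n%:R)| <= (C * (1 + p^-1) + 2 * kap) * n%:R.
Proof.
set K := C * (1 + p^-1) + 2 * kap.
elim: n => [|n IHn]; first by rewrite meanself0 mul0r !mulr0 subr0 normr0.
rewrite meanselfS.
have g := green_asymp n.
have h : `|n%:R * (ln n.+1%:R - ln n%:R)| <= 1 :> R.
  case: n {IHn g} => [|n]; first by rewrite mul0r normr0.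
  have [h1 h2] := @ln_succ_bounds R n.+1 isT.
  have nR : (0 : R) < n.+1%:R by rewrite ltr0n.
  rewrite normrM ger0_norm// ger0_norm; last first.
    by apply: le_trans h1; rewrite invr_ge0.
  by rewrite -ler_pdivlMl// mulr1.
set G := \sum_(1 <= l < n.+1) _ in g *.
have -> : meanself mu n + G - kap * (n.+1%:R * ln n.+1%:R) =
  (meanself mu n - kap * (n%:R * ln n%:R)) + (G - kap * ln n.+1%:R) -
  kap * (n%:R * (ln n.+1%:R - ln n%:R)) by rewrite -natr1; ring.
have h3 : `|kap * (n%:R * (ln n.+1%:R - ln n%:R))| <= kap.
  by rewrite normrM ger0_norm// ler_piMr.
have -> : K * n.+1%:R = K * n%:R + K by rewrite -natr1 mulrDr mulr1.
rewrite (le_trans (ler_normB _ _))//.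
have := ler_normD (meanself mu n - kap * (n%:R * ln n%:R)) (G - kap * ln n.+1%:R).
by rewrite /K in IHn *; lra.
Qed.

End meanself_asymptotics.

(** * Exponential moments of the renormalized self-intersections *)

Section expmoment.
Context {R : realType} (mu : probability Z2 R).
Local Notation hit := (hit mu).
Local Notation Ex := (iterE (step mu)).
Let mE n := iterE_mean (step_mean mu) n.
Variable C : R.
Hypothesis hC : forall k x, hit k x <= C / k.+1%:R.

Lemma Ex_split m n (G : seq Z2 -> seq Z2 -> R) :
  Ex (m + n) (fun u => G (take m u) (drop m u)) = Ex m (fun s => Ex n (fun t => G s t)).
Proof.
rewrite iterE_cat; apply: eq_iterE => s sm; congr iterE; apply/funext => t.
by rewrite (take_size_cat _ sm) (drop_size_cat _ sm).
Qed.

(** Young's inequality with exponents [3/2] and [3]; with [r = exp (u / 3)] and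
    [q = exp (v / 3)] it reads [(r - q)^2 (2 r + q) >= 0]. *)
Lemma expR_convex (u v : R) :
  expR (2 / 3 * u + v / 3) <= 2 / 3 * expR u + expR v / 3.
Proof.
have h (x : R) : expR x = expR (x / 3) ^+ 3 by rewrite -expRM_natl; congr expR; field.
have -> : expR (2 / 3 * u + v / 3) = expR (u / 3) ^+ 2 * expR (v / 3).
  by rewrite -expRM_natl -expRD; congr expR; field.
rewrite (h u) (h v).
have := expR_gt0 (u / 3); have := expR_gt0 (v / 3).
move: (expR _) (expR _) => r q q0 r0.
have := mulr_ge0 (sqr_ge0 (r - q)) (_ : 0 <= 2 * r + q).
have -> : (r - q) ^+ 2 * (2 * r + q) = 2 * r ^+ 3 + q ^+ 3 - 3 * r ^+ 2 * q by ring.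
have h0 : 0 <= 2 * r + q by lra.
by move=> /(_ h0); lra.
Qed.

(** Only downward deviations of a nonnegative variable are weighted, so the second
    moment is enough, by [expRN_le2]. *)
Lemma expmut_le m n (l : R) : 0 <= l ->
  Ex m (fun s => Ex n (fun t => expR (l * (meanmut mu m n - mutint m n s t)))) <=
  expR (64 * C ^+ 2 * l ^+ 2 * (m%:R * n%:R)).
Proof.
move=> l0.
pose J u := mutint m n (take m u) (drop m u) : R.
have bJ : bdd J.
  have [M hM] := @bdd_mutint R m n.
  by exists M => u; exact: (hM (take m u, drop m u)).
rewrite -(Ex_split m n (fun s t => expR (l * (meanmut mu m n - mutint m n s t)))).
rewrite -/(J _); set a := meanmut mu m n.
have aE : a = Ex (m + n) J by rewrite /a /meanmut -Ex_split.
have h2 := meanmut2_le hC m n.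
rewrite -(Ex_split m n (fun s t => mutint m n s t ^+ 2)) in h2.
apply: (@le_trans _ _ (expR (l * a) * (1 - l * a + l ^+ 2 / 2 * (128 * C ^+ 2 * (m%:R * n%:R))))).
  apply: (@le_trans _ _ (Ex (m + n) (fun u => expR (l * a) * (1 - l * J u + l ^+ 2 / 2 * J u ^+ 2)))).
    apply: (mean_le (mE _)); [by bd|by bd|].
    move=> u; rewrite mulrBr expRD ler_wpM2l ?expR_ge0//.
    apply: le_trans (expRN_le2 _) _; first by rewrite mulr_ge0// mutint_ge0.
    by rewrite le_eqVlt; apply/orP; left; apply/eqP; rewrite /J; field.
  rewrite (meanZ (mE _)); last by bd.
  rewrite ler_wpM2l ?expR_ge0// (meanD (mE _)); [|by bd|by bd].
  rewrite (meanB (mE _)); [|by bd|by bd].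
  rewrite (mean_cst (mE _)) !(meanZ (mE _)); [|by bd|by bd].
  by rewrite -aE lerD2l ler_wpM2l// divr_ge0// sqr_ge0.
apply: (@le_trans _ _ (expR (l * a) * expR (- (l * a) + 64 * C ^+ 2 * l ^+ 2 * (m%:R * n%:R)))).
  rewrite ler_wpM2l ?expR_ge0//; apply: le_trans (expR_ge1Dx _).
  by rewrite le_eqVlt; apply/orP; left; apply/eqP; field.
by rewrite -expRD addrA subrr add0r.
Qed.

(** Halving: the two halves are independent and their mutual intersections are
    controlled by [expmut_le]; Young's inequality with exponents [3/2] and [3]
    decouples the two, and [3/2] is small enough for the squares of the lengths
    of the halves to absorb the loss. *)
Lemma expself_le n (l : R) : 0 <= l ->
  Ex n (fun s => expR (l * (meanself mu n - selfint n s))) <=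
  expR (384 * C ^+ 2 * l ^+ 2 * n%:R ^+ 2).
Proof.
have [N] := ubnP n; elim: N n l => // N IHN n l nN l0.
have C0 := C_ge0 hC.
have [n1|n1] := leqP n 1.
  have -> : (fun s => expR (l * (meanself mu n - selfint n s))) = fun=> 1.
    apply/funext => s; case: n n1 {nN} => [|[|//]] _.
      by rewrite meanself0 selfint0 subrr mulr0 expR0.
    rewrite meanselfS meanself0 big_geq// addr0 selfintS selfint0 big_geq//.
    by rewrite addr0 subrr mulr0 expR0.
  rewrite (mean_cst (mE _)) -[leLHS]expR0 ler_expR.
  rewrite -!mulrA; apply: mulr_ge0; first exact: ler0n.
  by rewrite ?mulr_ge0 ?sqr_ge0.
pose m := n./2; pose r := (n - n./2)%N.
have nE : n = (m + r)%N by rewrite /m /r; lia.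
have mr : (0 < m)%N /\ (m <= r <= m.+1)%N by rewrite /m /r; lia.
have mN : (m < N)%N by lia.
have rN : (r < N)%N by lia.
rewrite nE {nN n1 nE} in IHN *; clearbody m r; case: mr => m0 mr.
pose x u := l * (meanself mu m - selfint m (take m u)) +
  l * (meanself mu r - selfint r (drop m u)).
pose y u := l * (meanmut mu m r - mutint m r (take m u) (drop m u)).
have bx : bdd x.
  apply: bddD; apply: bddM; try exact: bdd_cst; apply: bddD; try exact: bdd_cst;
    apply: bddN.
  - exact: (bdd_comp (take m) (bdd_selfint m)).
  - exact: (bdd_comp (drop m) (bdd_selfint r)).
have by_ : bdd y.
  apply: bddM; [exact: bdd_cst|apply: bddD; [exact: bdd_cst|apply: bddN]].
  have [M hM] := @bdd_mutint R m r.
  by exists M => u; exact: (hM (take m u, drop m u)).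
have -> : Ex (m + r) (fun s => expR (l * (meanself mu (m + r) - selfint (m + r) s))) =
    Ex (m + r) (fun u => expR (x u + y u)).
  apply: eq_iterE => u su; congr expR.
  have sm : size (take m u) = m by rewrite size_takel// su leq_addr.
  rewrite -{1}(cat_take_drop m u) (selfint_cat _ _ sm) meanself_cat /x /y; ring.
pose A := 384 * C ^+ 2 * (3 / 2 * l) ^+ 2 * m%:R ^+ 2 +
  384 * C ^+ 2 * (3 / 2 * l) ^+ 2 * r%:R ^+ 2.
pose B := 64 * C ^+ 2 * (3 * l) ^+ 2 * (m%:R * r%:R).
have l1 : 0 <= 3 / 2 * l by lra.
have EA : Ex (m + r) (fun u => expR (3 / 2 * x u)) <= expR A.
  pose g k s := expR (3 / 2 * l * (meanself mu k - selfint k s)).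
  have bg k : bdd (g k).
    apply: bdd_expR; apply: bddM; first exact: bdd_cst.
    apply: bddD; first exact: bdd_cst.
    by apply: bddN; exact: bdd_selfint.
  have -> : Ex (m + r) (fun u => expR (3 / 2 * x u)) = Ex m (g m) * Ex r (g r).
    rewrite -(meanZr (mE _))//.
    transitivity (Ex (m + r) (fun u => g m (take m u) * g r (drop m u))).
      congr iterE; apply/funext => u; rewrite /g -expRD; congr expR.
      by rewrite /x; ring.
    rewrite (Ex_split m r (fun s t => g m s * g r t)); congr iterE.
    by apply/funext => s; rewrite (meanZ (mE _)).
  rewrite expRD ler_pM//.
  - by apply: (mean_ge0 (mE _)) => // s; exact: expR_ge0.
  - by apply: (mean_ge0 (mE _)) => // s; exact: expR_ge0.
  - exact: IHN.
  - exact: IHN.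
have EB : Ex (m + r) (fun u => expR (3 * y u)) <= expR B.
  have l3 : 0 <= 3 * l by lra.
  apply: le_trans (expmut_le m r l3).
  rewrite -(Ex_split m r (fun s t => expR (3 * l * (meanmut mu m r - mutint m r s t)))).
  by rewrite le_eqVlt; apply/orP; left; apply/eqP; congr iterE; apply/funext => u;
    congr expR; rewrite /y; ring.
apply: (@le_trans _ _ (expR (2 / 3 * A + B / 3))).
  apply: (@le_trans _ _ (Ex (m + r) (fun u => expR (2 / 3 * A + B / 3) *
    (2 / 3 * (expR (3 / 2 * x u) * expR (- A)) + (expR (3 * y u) * expR (- B)) / 3)))).
    apply: (mean_le (mE _)); [by bd|by bd|].
    move=> u; rewrite -!expRD.
    have -> : x u + y u = (2 / 3 * A + B / 3) + (2 / 3 * (3 / 2 * x u - A) + (3 * y u - B) / 3).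
      by field.
    by rewrite [leLHS]expRD; apply: ler_wpM2l; [exact: expR_ge0|exact: expR_convex].
  rewrite (meanZ (mE _)); last by bd.
  rewrite ler_piMr ?expR_ge0// (meanD (mE _)); [|by bd|by bd].
  rewrite (meanZ (mE _)); last by bd.
  rewrite !(meanZr (mE _)); [|by bd|by bd|by bd].
  have h1 : Ex (m + r) (fun u => expR (3 / 2 * x u)) * expR (- A) <= 1.
    by rewrite expRN ler_pdivrMr ?expR_gt0// mul1r.
  have h2 : Ex (m + r) (fun u => expR (3 * y u)) * expR (- B) <= 1.
    by rewrite expRN ler_pdivrMr ?expR_gt0// mul1r.
  by lra.
rewrite ler_expR.
have -> : 2 / 3 * A + B / 3 = C ^+ 2 * l ^+ 2 * (576 * (m%:R ^+ 2 + r%:R ^+ 2) + 192 * (m%:R * r%:R)).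
  by rewrite /A /B; field.
have -> : 384 * C ^+ 2 * l ^+ 2 * (m + r)%:R ^+ 2 =
    C ^+ 2 * l ^+ 2 * (384 * (m%:R + r%:R) ^+ 2) by rewrite natrD; ring.
rewrite ler_wpM2l ?mulr_ge0 ?sqr_ge0//.
(* the constant [384] is the one for which the induction closes exactly when
   [m ^ 2 + r ^ 2 <= 3 m r], which nearly equal halves satisfy *)
have : (m ^ 2 + r ^ 2 <= 3 * (m * r))%N by nia.
rewrite -(ler_nat R) natrD natrM natrM !natrX; lra.
Qed.

(** The mean of the centred variable being zero, its upper tail is controlled by
    the exponential moment of its negative part. *)
Lemma selfint_tail n (t : R) : (0 < n)%N -> 0 < t ->
  Ex n (fun s => (meanself mu n + t * n%:R < selfint n s)%R%:R) <=
  expR (384 * C ^+ 2) / t.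
Proof.
move=> n0 t0; have nR : (0 : R) < n%:R by rewrite ltr0n.
have bs : bdd (@selfint R n) by exact: bdd_selfint.
pose X s := selfint n s - meanself mu n.
have bX : bdd X by apply: bddD => //; bd.
apply: (@le_trans _ _ (Ex n (fun s =>
    (t * n%:R)^-1 * (X s + n%:R * expR (n%:R^-1 * (meanself mu n - selfint n s)))))).
  apply: (mean_le (mE _)); [by bd|by bd|].
  move=> s; rewrite [leRHS]mulrC ler_pdivlMr ?mulr_gt0//.
  set e := expR _.
  have h1 : 1 + n%:R^-1 * (meanself mu n - selfint n s) <= e by exact: expR_ge1Dx.
  have h2 : 0 < e by exact: expR_gt0.
  have h3 : 0 < n%:R * e by rewrite mulr_gt0.
  have h4 : n%:R - X s <= n%:R * e.
    apply: le_trans (ler_wpM2l (ltW nR) h1).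
    by rewrite /X mulrDr mulr1 mulrA divff ?gt_eqF// mul1r opprB.
  case: ltP => h; rewrite ?mul1r ?mul0r; last by lra.
  by rewrite /X; lra.
rewrite (meanZ (mE _)); last by bd.
rewrite (meanD (mE _)) ?(meanZ (mE _)); [|by bd|by bd|by bd].
have -> : Ex n X = 0.
  by rewrite (meanB (mE _)) ?(mean_cst (mE _)) ?subrr//; bd.
have n1 : (0 : R) <= n%:R^-1 by rewrite invr_ge0.
have := expself_le n n1.
rewrite exprVn -[X in expR X]mulrA mulVf ?expf_neq0 ?gt_eqF// mulr1 => h.
rewrite add0r invfM -mulrA mulKf ?gt_eqF// [leLHS]mulrC.
by rewrite ler_pM2r ?invr_gt0.
Qed.

End expmoment.


(** * Upper bound *)

Section blocks.
Context {R : realType}.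

Lemma size_flatten_blocks (L : nat) (ss : seq (seq Z2)) :
  all (fun s => size s == L) ss -> size (flatten ss) = (size ss * L)%N.
Proof.
elim: ss => [//|s ss IHss] /= /andP[/eqP sL ssL].
by rewrite size_cat IHss// sL mulSn.
Qed.

Lemma sum_selfint_le_flatten (L : nat) (ss : seq (seq Z2)) :
  all (fun s => size s == L) ss ->
  \sum_(s <- ss) selfint L s <= selfint (size ss * L) (flatten ss) :> R.
Proof.
elim: ss => [|s ss IHss] /=; first by rewrite big_nil selfint_ge0.
move=> /andP[/eqP sL ssL]; rewrite big_cons mulSn selfint_cat//.
by rewrite -addrA lerD2l (le_trans (IHss ssL))// lerDl mutint_ge0.
Qed.

Lemma iterE_blocks_le (E : (seq Z2 -> R) -> R) : is_mean E -> 
  forall (L q : nat) (F G : seq (seq Z2) -> R),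
  (forall f g : seq Z2 -> R, (forall s, size s = L -> f s = g s) -> E f = E g) ->
  bdd F -> bdd G ->
  (forall ss, size ss = q -> all (fun s => size s == L) ss -> F ss <= G ss) ->
  iterE E q F <= iterE E q G.
Proof.
move=> mE L q F G EL bF bG FG.
pose ok (ss : seq (seq Z2)) := all (fun s => size s == L) ss.
have EE (H H' : seq (seq Z2) -> R) k : (forall ss, ok ss -> H ss = H' ss) ->
    iterE E k H = iterE E k H'.
  elim: k H H' => [|k IHk] H H' HH /=; first exact: HH.
  by apply: EL => s sL; apply: IHk => ss okss; apply: HH; rewrite /ok/= sL eqxx.
rewrite (EE F (fun ss => if ok ss then F ss else 0) q); last by move=> ss ->.
rewrite (EE G (fun ss => if ok ss then G ss else 0) q); last by move=> ss ->.
have bb (H : seq (seq Z2) -> R) : bdd H -> bdd (fun ss => if ok ss then H ss else 0).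
  move=> [M hM]; exists M => s; case: ifP => // _.
  by rewrite normr0 (le_trans _ (hM s)).
apply: iterE_le => //; [exact: bb|exact: bb|].
by move=> ss ssq; case: ifP => // okss; exact: FG.
Qed.

Lemma bdd_prod01 (V : Type) (g : V -> R) : (forall v, 0 <= g v <= 1) ->
  bdd (fun s : seq V => \prod_(v <- s) g v).
Proof.
move=> g01; exists 1 => s.
have : 0 <= \prod_(v <- s) g v <= 1; last by move=> /andP[h1 h2]; rewrite ger0_norm.
elim: s => [|v s /andP[h1 h2]]; first by rewrite big_nil ler01 lexx.
have /andP[g0 g1] := g01 v.
by rewrite big_cons mulr_ge0//= mulr_ile1.
Qed.

End blocks.

Section upper.
Context {R : realType} (mu : probability Z2 R).
Local Notation hit := (hit mu).
Local Notation Ex := (iterE (step mu)).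
Local Notation mean := (meanself mu).
Let mE n := iterE_mean (step_mean mu) n.
Variables (C kap K : R).
Hypothesis hC : forall k x, hit k x <= C / k.+1%:R.
Hypothesis kap0 : 0 < kap.
Hypothesis hmean : forall n, `|mean n - kap * (n%:R * ln n%:R)| <= K * n%:R.

Local Notation blocks L q := (iterE (Ex L) q).

Lemma blocks_mean L q : is_mean (blocks L q).
Proof. exact: iterE_mean (mE L) q. Qed.

Lemma blocks_le L q (F G : seq (seq Z2) -> R) : bdd F -> bdd G ->
  (forall ss, size ss = q -> all (fun s => size s == L) ss -> F ss <= G ss) ->
  blocks L q F <= blocks L q G.
Proof.
move=> bF bG; apply: (iterE_blocks_le (mE L)) => // f g fg.
exact: eq_iterE.
Qed.

(** Dropping the intersections between different blocks leaves independent
    terms. *)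
Lemma laplace_blocks_le (L q : nat) (l : R) : 0 <= l ->
  Ex (q * L) (fun u => expR (- (l * selfint (q * L) u))) <=
  Ex L (fun s => expR (- (l * selfint L s))) ^+ q.
Proof.
move=> l0; pose g s : R := expR (- (l * selfint L s)).
have g01 s : 0 <= g s <= 1.
  by rewrite expR_ge0 expR_le1 oppr_le0 mulr_ge0// selfint_ge0.
have bg : bdd g by exists 1 => s; have /andP[h1 h2] := g01 s; rewrite ger0_norm.
rewrite -(iterE_prod (mE L))// -(iterE_flatten (step mu) L q).
apply: blocks_le.
- apply: bdd_expR; apply: bddN; apply: bddM; first exact: bdd_cst.
  exact: (bdd_comp flatten (bdd_selfint _)).
- exact: bdd_prod01.
- move=> ss ssq ssL; rewrite /g -expR_sum ler_expR sumrN lerN2 -mulr_sumr.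
  by rewrite ler_wpM2l// -ssq sum_selfint_le_flatten.
Qed.

(** Cutting into [q] blocks costs [kap n ln q] in the mean, up to [O(n)]. *)
Lemma mean_blocks_le (n q L : nat) : (0 < q)%N -> (0 < L)%N ->
  (q * L <= n)%N -> (n < q * L + q)%N ->
  mean n - q%:R * mean L <= (kap * ln (2 * q%:R) + (kap + 2 * K)) * n%:R.
Proof.
move=> q0 L0 qLn nqL.
have K0 : 0 <= K by have := hmean 1; rewrite mulr1; exact: le_trans.
have qR : (0 : R) < q%:R by rewrite ltr0n.
have LR : (0 : R) < L%:R by rewrite ltr0n.
have n0 : (0 < n)%N by rewrite (leq_trans _ qLn)// muln_gt0 q0.
have nR : (0 : R) < n%:R by rewrite ltr0n.
have h1 : mean n <= kap * (n%:R * ln n%:R) + K * n%:R.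
  by have := hmean n; rewrite ler_norml => /andP[_]; lra.
have h2 : kap * (L%:R * ln L%:R) - K * L%:R <= mean L.
  by have := hmean L; rewrite ler_norml => /andP[h _]; lra.
have qLn' : q%:R * L%:R <= n%:R :> R by rewrite -natrM ler_nat.
have nqL' : n%:R <= q%:R * L%:R + q%:R :> R by rewrite -natrM -natrD ler_nat ltnW.
have lnL : 0 <= ln (L%:R : R) <= L%:R.
  by rewrite ln_ge0 ?ler1n//= ltW// ln_sublinear.
have h3 : ln n%:R <= ln L%:R + ln (2 * q%:R) :> R.
  rewrite -lnM ?posrE ?mulr_gt0// ler_ln ?posrE ?mulr_gt0//.
  apply: le_trans nqL' _; have : (1 : R) <= L%:R by rewrite ler1n.
  nra.
have h4 : q%:R * (kap * (L%:R * ln L%:R) - K * L%:R) <= q%:R * mean L.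
  by rewrite ler_wpM2l// ltW.
have h5 : n%:R * ln n%:R <= n%:R * (ln L%:R + ln (2 * q%:R)) :> R by rewrite ler_pM2l.
have h6 : kap * (n%:R * ln n%:R) <= kap * (n%:R * (ln L%:R + ln (2 * q%:R))).
  by rewrite ler_pM2l.
have h7 : n%:R * ln L%:R - q%:R * L%:R * ln L%:R <= n%:R :> R.
  case/andP: lnL => l0 lL; rewrite -mulrBl.
  apply: (@le_trans _ _ (q%:R * L%:R)) => //.
  by apply: ler_pM => //; lra.
have h8 : kap * (n%:R * ln L%:R - q%:R * L%:R * ln L%:R) <= kap * n%:R.
  by rewrite ler_pM2l.
have h9 : K * (q%:R * L%:R) <= K * n%:R by rewrite ler_wpM2l.
move: h1 h4 h6 h8 h9; move: (ln L%:R) (ln n%:R) (ln (2 * q%:R)) (mean n) (mean L).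
move: (q%:R : R) (L%:R : R) (n%:R : R) => q' L' n' a b c d e.
by lra.
Qed.

(** For [q] close to [m / A] the cut costs so little of the mean that the centred
    sums over the blocks have to exceed [(M + 1) n], while their exponential moment
    at [l = 1 / L] is at most [exp (M q)]. *)
Lemma upper_bound : exists c m0 : R, [/\ 0 < c, 0 < m0 & forall n (m : R),
  m0 <= m -> m <= n%:R ->
  Ex n (fun s => (kap * (n%:R * ln m) <= mean n - selfint n s)%R%:R) <=
  expR (- (c * m))].
Proof.
have [M ME M0] : exists2 M, M = 384 * C ^+ 2 & 0 <= M.
  exists (384 * C ^+ 2); first reflexivity.
  by apply: mulr_ge0; [exact: ler0n|exact: sqr_ge0].
pose A := 2 * expR ((kap + 2 * K + M + 1) / kap).
have K0 : 0 <= K by have := hmean 1; rewrite mulr1; exact: le_trans.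
have A2 : 2 <= A.
  rewrite /A -[X in X <= _]mulr1 ler_pM2l// -[X in X <= _]expR0 ler_expR.
  by apply: divr_ge0; [rewrite !addr_ge0 ?mulr_ge0 ?(ltW kap0)|exact: ltW].
have A0 : 0 < A by lra.
(* [q] is at least [m / (2 A)] *)
exists (2 * A)^-1, (2 * A); split; [by rewrite invr_gt0; lra|lra|].
move=> n m mA mn.
pose q := Num.truncn (m / A); pose L := (n %/ q)%N.
have m0 : 0 < m by lra.
have mA0 : 0 <= m / A by rewrite divr_ge0// ltW.
have /andP[qm mq] := truncn_itv mA0; rewrite -/q in qm mq.
have mA2 : 2 <= m / A by rewrite ler_pdivlMr// mulrC; lra.
have q0 : (0 < q)%N.
  by rewrite -(ltr_nat R); move: mq; rewrite -natr1; lra.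
have qR : (0 : R) < q%:R by rewrite ltr0n.
have qn : (q <= n)%N.
  rewrite -(ler_nat R) (le_trans qm)// (le_trans _ mn)// ler_pdivrMr//.
  by rewrite ler_peMr//; lra.
have L0 : (0 < L)%N by rewrite divn_gt0.
have LR : (0 : R) < L%:R by rewrite ltr0n.
have qLn : (q * L <= n)%N by rewrite mulnC leq_divM.
have nqL : (n < q * L + q)%N by rewrite mulnC -mulSnr ltn_ceil.
have H := mean_blocks_le q0 L0 qLn nqL.
have hq : ln (2 * q%:R) <= ln m - (kap + 2 * K + M + 1) / kap.
  have -> : (kap + 2 * K + M + 1) / kap = ln (A / 2).
    by rewrite /A [2 * expR _]mulrC mulfK// expRK.
  rewrite -ln_div ?posrE ?divr_gt0 ?mulr_gt0 ?expR_gt0// ler_ln ?posrE ?divr_gt0 ?mulr_gt0 ?expR_gt0//.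
  rewrite invf_div (_ : m * (2 / A) = 2 * (m / A)); last by rewrite mulrCA.
  by rewrite ler_pM2l.
have nR : (0 : R) < n%:R by lra.
have H2 : mean n - q%:R * mean L - kap * (n%:R * ln m) <= - ((M + 1) * n%:R).
  have h1 : kap * ln (2 * q%:R) <= kap * ln m - (kap + 2 * K + M + 1).
    apply: (@le_trans _ _ (kap * (ln m - (kap + 2 * K + M + 1) / kap))).
      by rewrite ler_pM2l.
    by rewrite mulrBr mulrCA divff ?gt_eqF// mulr1.
  have h2 : (kap * ln (2 * q%:R) + (kap + 2 * K)) * n%:R <=
      (kap * ln m - (M + 1)) * n%:R by rewrite ler_pM2r//; lra.
  by lra.
have Li : 0 < L%:R^-1 :> R by rewrite invr_gt0.
have bs : bdd (@selfint R n) by exact: bdd_selfint.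
pose D := mean n - kap * (n%:R * ln m).
apply: (@le_trans _ _ (Ex n (fun s => expR (L%:R^-1 * D) * expR (- (L%:R^-1 * selfint (q * L) (take (q * L) s)))))).
  apply: iterE_le; [exact: step_mean|by bd| |].
    apply: bddM; first exact: bdd_cst.
    apply: bdd_expR; apply: bddN; apply: bddM; first exact: bdd_cst.
    exact: (bdd_comp (take _) (bdd_selfint _)).
  move=> s sn; case: (boolP (kap * (n%:R * ln m) <= mean n - selfint n s)) => h;
    last by rewrite mulr_ge0// expR_ge0.
  rewrite -expRD -[leLHS]expR0 ler_expR -mulrBr mulr_ge0 ?(ltW Li)//.
  have : selfint (q * L) (take (q * L) s) <= selfint n s :> R.
    rewrite -{2}(cat_take_drop (q * L) s) -(subnKC qLn); apply: selfint_le_cat.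
    by rewrite size_takel// sn.
  by rewrite /D; lra.
rewrite (meanZ (mE n)); last first.
  apply: bdd_expR; apply: bddN; apply: bddM; first exact: bdd_cst.
  exact: (bdd_comp (take _) (bdd_selfint _)).
rewrite -{1}(subnKC qLn).
rewrite (iterE_catl (step_mean mu) (q * L) _ (fun s => expR (- (L%:R^-1 * selfint (q * L) s)))).
have hL := expself_le hC L (ltW Li).
rewrite exprVn -[X in expR X]mulrA mulVf ?expf_neq0 ?gt_eqF// mulr1 -ME in hL.
have hL2 : Ex L (fun s => expR (- (L%:R^-1 * selfint L s))) <=
    expR (M - L%:R^-1 * mean L).
  rewrite expRB ler_pdivlMr ?expR_gt0// mulrC.
  rewrite -(meanZ (mE L)); last first.
    by apply: bdd_expR; apply: bddN; apply: bddM; [exact: bdd_cst|exact: bdd_selfint].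
  apply: le_trans hL; rewrite le_eqVlt; apply/orP; left; apply/eqP.
  by congr iterE; apply/funext => s; rewrite -expRD mulrBr.
apply: (@le_trans _ _ (expR (L%:R^-1 * D) * expR (M - L%:R^-1 * mean L) ^+ q)).
  apply: ler_wpM2l; first exact: expR_ge0.
  apply: le_trans (laplace_blocks_le _ _ (ltW Li)) _.
  rewrite lerXn2r ?nnegrE ?expR_ge0//.
  apply: (mean_ge0 (mE L)); last by move=> s; exact: expR_ge0.
  by apply: bdd_expR; apply: bddN; apply: bddM; [exact: bdd_cst|exact: bdd_selfint].
rewrite -expRM_natl -expRD ler_expR.
have H3 : L%:R^-1 * (D - q%:R * mean L) <= L%:R^-1 * - ((M + 1) * n%:R).
  by rewrite ler_pM2l//; rewrite /D; lra.
have H4 : q%:R <= L%:R^-1 * n%:R :> R.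
  by rewrite mulrC ler_pdivlMr// -natrM ler_nat.
have H5 : (M + 1) * q%:R <= (M + 1) * (L%:R^-1 * n%:R) by rewrite ler_wpM2l//; lra.
have H6 : (2 * A)^-1 * m <= q%:R.
  rewrite (_ : (2 * A)^-1 * m = m / A / 2); last by field; rewrite gt_eqF.
  by move: mq; rewrite -natr1; lra.
move: H3 H5 H6; move: (L%:R^-1 : R) (q%:R : R) ((2 * A)^-1 * m) => l q' cm.
by lra.
Qed.

End upper.


(** * Confinement of one block *)

Definition coord1 {R : realType} (z : Z2) : R := z.1%:~R.
Definition coord2 {R : realType} (z : Z2) : R := z.2%:~R.

Section confinement.
Context {R : realType} (mu : probability Z2 R).
Local Notation hit := (hit mu).
Local Notation Ex := (iterE (step mu)).
Let mE n := iterE_mean (step_mean mu) n.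
Hypothesis hsym : forall f, step mu (fun z => f (- z)) = step mu f.

Lemma step_odd0 (f : Z2 -> R) : mu.-integrable setT (EFin \o f) ->
  (forall z, f (- z) = - f z) -> step mu f = 0.
Proof.
move=> fi fN; have := hsym f.
have -> : (fun z => f (- z)) = (fun z => -1 * f z) by apply/funext => z; rewrite fN mulN1r.
by rewrite stepZ// mulN1r => h; lra.
Qed.

Section coordinate.
Variable X : Z2 -> R.
Hypothesis XD : forall x y, X (x + y) = X x + X y.
Hypothesis X2 : mu.-integrable setT (EFin \o (fun z => X z ^+ 2)).

Lemma additive0 : X 0 = 0.
Proof. by have := XD 0 0; rewrite addr0; lra. Qed.

Lemma additiveN x : X (- x) = - X x.
Proof. by have := XD x (- x); rewrite subrr additive0; lra. Qed.

Lemma integrable_X : mu.-integrable setT (EFin \o X).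
Proof.
apply: (@integrable_le _ mu _ (fun z => 1 + X z ^+ 2)).
  have i1 : mu.-integrable setT (EFin \o (fun _ : Z2 => 1 : R)).
    by apply: integrable_bdd; exact: bdd_cst.
  exact: (integrableD _ i1 X2).
move=> z; have := sqr_ge0 (X z - 1); have := sqr_ge0 (X z + 1).
by have := sqr_ge0 (X z) => *; rewrite ler_norml; apply/andP; split; nra.
Qed.

Fixpoint exits (H x : R) (s : seq Z2) : bool :=
  (H <= `|x|) || (if s is z :: s' then exits H (x + X z) s' else false).

Lemma exitsN (H x : R) s j : ~~ exits H x s -> `|x + X (sumz (take j s))| < H.
Proof.
elim: s x j => [|z s IHs] x j /=; rewrite negb_or -ltNge => /andP[h1 h2].
  by rewrite /sumz big_nil additive0 addr0.
case: j => [|j]; first by rewrite take0 /sumz big_nil additive0 addr0.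
by rewrite /= /sumz big_cons XD addrA IHs.
Qed.

(** Kolmogorov's maximal inequality, by conditioning on the first step. *)
Lemma Ex_exits_le (H : R) L x : 0 < H ->
  Ex L (fun s => (exits H x s)%:R) <=
  (x ^+ 2 + L%:R * step mu (fun z => X z ^+ 2)) / H ^+ 2.
Proof.
move=> H0; set v := step mu _.
have v0 : 0 <= v by apply: Rintegral_ge0 => z _; exact: sqr_ge0.
have H2 : 0 < H ^+ 2 by rewrite exprn_gt0.
have start y (a : R) : H <= `|y| -> 0 <= a -> 1 <= (y ^+ 2 + a) / H ^+ 2.
  move=> Hy a0; rewrite ler_pdivlMr// mul1r ler_wpDr// -[leRHS]real_normK ?num_real//.
  by rewrite lerXn2r ?nnegrE// ltW.
elim: L x => [|L IHL] x.
  rewrite /iterE /= orbF.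
  case: (boolP (H <= `|x|)) => h; first by rewrite start// mul0r.
  by rewrite divr_ge0 ?addr_ge0 ?sqr_ge0 ?mulr_ge0.
case: (boolP (H <= `|x|)) => h.
  apply: (@le_trans _ _ 1); last by rewrite start// mulr_ge0.
  rewrite -[leRHS](mean_cst (mE L.+1)); apply: (mean_le (mE _)); [bd|bd|].
  by move=> s; rewrite lern1 leq_b1.
have -> : Ex L.+1 (fun s => (exits H x s)%:R) =
    step mu (fun z => Ex L (fun s => (exits H (x + X z) s)%:R)).
  rewrite [LHS]/=; congr (step mu _); apply/funext => z.
  by congr iterE; apply/funext => s; rewrite (negbTE h).
have ix := integrable_X.
have i1 : mu.-integrable setT (EFin \o (fun z => 2 * x * X z)).
  exact: (integrableZl _ _ ix).
have i2 : mu.-integrable setT (EFin \o (fun _ : Z2 => x ^+ 2 + L%:R * v)).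
  by apply: integrable_bdd; exact: bdd_cst.
have i3 := integrableD measurableT X2 i1.
have i4 := integrableD measurableT i3 i2.
apply: (@le_trans _ _ (step mu (fun z => (H ^+ 2)^-1 * ((X z ^+ 2 + 2 * x * X z) + (x ^+ 2 + L%:R * v))))).
  apply: step_le.
  - apply: integrable_bdd; apply: bdd_iterE; [exact: step_mean|exact: bdd_bool].
  - exact: (integrableZl _ _ i4).
  - move=> z; apply: le_trans (IHL _) _; rewrite mulrC.
    by rewrite le_eqVlt; apply/orP; left; apply/eqP; congr (_ * _); ring.
rewrite stepZ// stepD// stepD// step_cst stepZ// (step_odd0 ix additiveN).
rewrite -/v mulr0 addr0 mulrC -natr1.
by rewrite le_eqVlt; apply/orP; left; apply/eqP; congr (_ * _); ring.
Qed.

Lemma Ex_opp n (F : seq Z2 -> R) : Ex n (fun s => F (map -%R s)) = Ex n F.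
Proof. by apply: (iterE_map (h := -%R)) => f; exact: hsym. Qed.

Lemma sumz_opp s : sumz (map -%R s) = - sumz s.
Proof. by rewrite /sumz big_map sumrN. Qed.

(** Half of what is not close to the origin lies to its right. *)
Lemma Ex_right L (h : R) : 0 < h ->
  Ex L (fun s => (h <= X (sumz s))%R%:R) =
  (1 - Ex L (fun s => (`|X (sumz s)| < h)%R%:R)) / 2.
Proof.
move=> h0.
have e1 : Ex L (fun s => (h <= X (sumz s))%R%:R) = Ex L (fun s => (X (sumz s) <= - h)%R%:R).
  rewrite -[LHS]Ex_opp; congr iterE; apply/funext => s.
  by rewrite sumz_opp additiveN lerNr.
have : Ex L (fun s => (h <= X (sumz s))%R%:R + (X (sumz s) <= - h)%R%:R +
     (`|X (sumz s)| < h)%R%:R) = 1.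
  rewrite -[RHS](mean_cst (mE L)); congr iterE; apply/funext => s.
  rewrite ltr_norml.
  case: (leP h (X (sumz s))) => h1; case: (leP (X (sumz s)) (- h)) => h2 /=;
    rewrite ?addr0 ?add0r//; lra.
rewrite (meanD (mE L)); [|by bd|by bd]; rewrite (meanD (mE L)); [|by bd|by bd].
by rewrite -e1 => e; lra.
Qed.

End coordinate.

Variable C : R.
Hypothesis hC : forall k x, hit k x <= C / k.+1%:R.
Local Notation x1 := (@coord1 R).
Local Notation x2 := (@coord2 R).

Lemma coord1D (x y : Z2) : x1 (x + y) = x1 x + x1 y.
Proof. by rewrite /coord1 rmorphD. Qed.

Lemma coord2D (x y : Z2) : x2 (x + y) = x2 x + x2 y.
Proof. by rewrite /coord2 rmorphD. Qed.

Lemma int_small_index (z : int) (k : nat) : (`|z%:~R| < k.+1%:R :> R) ->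
  exists2 i : nat, (i < (2 * k).+1)%N & z = i%:Z - k%:Z.
Proof.
move=> zk.
have {}zk : (`|z| < k.+1%:Z)%R by rewrite -(ltr_int R) intr_norm.
by exists (absz (z + k%:Z)); lia.
Qed.

(** A box has few points, and each is hit with probability at most
    [C / L.+1]. *)
Lemma Ex_small_box_le L (k1 k2 : nat) :
  Ex L (fun s => ((`|x1 (sumz s)| < k1.+1%:R)%R && (`|x2 (sumz s)| < k2.+1%:R)%R)%:R) <=
  (2 * k1).+1%:R * (2 * k2).+1%:R * (C / L.+1%:R).
Proof.
pose pts := [seq ((i%:Z - k1%:Z, j%:Z - k2%:Z) : Z2) | i <- iota 0 (2 * k1).+1, j <- iota 0 (2 * k2).+1].
apply: (@le_trans _ _ (Ex L (fun s => \sum_(y <- pts) (sumz s == y)%:R))).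
  apply: (mean_le (mE L)); [by bd|by bd|].
  move=> s; case: (boolP (_ && _)) => [/andP[]|_]; last by apply: sumr_ge0.
  move=> /int_small_index[i ik zi] /int_small_index[j jk zj].
  have sp : sumz s \in pts.
    apply/allpairsP; exists (i, j); rewrite !mem_iota !add0n ik jk; split => //=.
    by rewrite -zi -zj; case: (sumz s).
  rewrite (big_rem _ sp)/= eqxx lerDl; exact: sumr_ge0.
rewrite (mean_sum (mE L)); last by move=> y _; bd.
apply: (@le_trans _ _ (\sum_(y <- pts) (C / L.+1%:R))).
  by apply: ler_sum => y _; exact: hC.
rewrite big_const_seq iter_addr_0 count_predT size_allpairs !size_iota.
by rewrite -natrM mulr_natl.
Qed.

End confinement.


(** * Chains of confined blocks *)

Section chain.
Context {R : realType} (mu : probability Z2 R).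
Local Notation hit := (hit mu).
Local Notation Ex := (iterE (step mu)).
Let mE n := iterE_mean (step_mean mu) n.
Local Notation x1 := (@coord1 R).
Local Notation blocks L q := (iterE (Ex L) q).

Variables (L r : nat) (h H T : R) (G : seq Z2 -> bool).
Hypotheses (L0 : (0 < L)%N) (r0 : (0 < r)%N) (h0 : 0 <= h) (rh : 2 * H <= r.+1%:R * h).
Hypothesis Gh : forall s, size s = L -> G s -> h <= x1 (sumz s).
Hypothesis GH : forall s j, size s = L -> G s -> `|x1 (sumz (take j s))| < H.
Hypothesis GT : forall s, size s = L -> G s -> selfint L s <= T.

Let sized (ss : seq (seq Z2)) := all (fun s => size s == L) ss.

(** Complete blocks advance by at least [h] each, and the current one is confined
    to a window. *)
Lemma chain_drift ss k l : sized ss -> all G ss ->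
  (k < size ss * L)%N -> (l * L <= k)%N ->
  l%:R * h - H < x1 (sumz (take k.+1 (flatten ss))).
Proof.
elim: ss k l => [//|s ss IHss] k l /= /andP[/eqP sL ssL] /andP[Gs Gss] kL lk.
have [kL1|kL1] := ltnP k L.
  have -> : l = 0%N by case: l lk => // l lk; have := leq_trans lk (ltnW kL1); nia.
  rewrite takel_cat ?sL// mul0r sub0r.
  by have := @GH s k.+1 sL Gs; rewrite ltr_norml => /andP[].
have -> : take k.+1 (s ++ flatten ss) = s ++ take (k - L).+1 (flatten ss).
  by rewrite take_cat sL ltnNge (leqW kL1)/= subSn.
rewrite sumz_cat coord1D; have h1 := @Gh s sL Gs.
have kL2 : (k - L < size ss * L)%N by lia.
case: l lk => [|l] lk.
  have h2 := IHss (k - L)%N 0%N ssL Gss kL2 isT.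
  by apply: lt_le_trans h2 _; rewrite lerDr (le_trans h0 h1).
have lk' : (l * L <= k - L)%N by nia.
have h2 := IHss (k - L)%N l ssL Gss kL2 lk'.
rewrite -natr1 mulrDl mul1r -addrA addrCA.
exact: ler_ltD h1 h2.
Qed.

(** The drift over [r.+1] blocks outweighs the width of the windows of the two blocks
    concerned. *)
Lemma chain_far s ss j k : size s = L -> G s -> sized ss -> all G ss ->
  (k < size ss * L)%N -> (r * L <= k)%N ->
  (sumz (drop j s) + sumz (take k.+1 (flatten ss)) == 0) = false.
Proof.
move=> sL Gs ssL Gss kL rk; apply/negbTE/eqP => e.
have h1 : 2 * H <= (r%:R + 1) * h by rewrite natr1.
have h2 : x1 (sumz (take j s)) < H by have := @GH s j sL Gs; rewrite ltr_norml => /andP[].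
have h3 := @Gh s sL Gs.
have h4 : x1 (sumz (take j s)) + x1 (sumz (drop j s)) = x1 (sumz s) :> R.
  by rewrite -coord1D sumz_take_drop.
have h5 := chain_drift ssL Gss kL rk.
have h6 : x1 (sumz (drop j s)) + x1 (sumz (take k.+1 (flatten ss))) = 0 :> R.
  by rewrite -coord1D e.
move: h2 h3 h4 h5 h6; clear e sL.
move: (x1 (sumz (take j s))) (x1 (sumz s)) (x1 (sumz (drop j s))) => a1 a2 a3.
move: (x1 _) => a4 h2 h3 h4 h5 h6; lra.
Qed.

(** The intersections of each block with the [r] blocks that follow it; by
    [chain_far] there are no others when all blocks are good. *)
Fixpoint near (q : nat) (ss : seq (seq Z2)) : R :=
  if q is q'.+1 then near q' (behead ss) +
    mutint L (minn r q' * L) (head [::] ss) (flatten (take r (behead ss)))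
  else 0.

Lemma bdd_near q : bdd (near q).
Proof.
elim: q => [|q IHq] /=; first exact: bdd_cst.
apply: bddD; first exact: (bdd_comp behead IHq).
have [M hM] := @bdd_mutint R L (minn r q * L).
by exists M => ss; exact: (hM (head [::] ss, flatten (take r (behead ss)))).
Qed.

Lemma near_ge0 q ss : 0 <= near q ss.
Proof. by elim: q ss => [//|q IHq] ss /=; rewrite addr_ge0// mutint_ge0. Qed.

Lemma mutint_flatten s ss : size s = L -> G s -> sized ss -> all G ss ->
  mutint L (size ss * L) s (flatten ss) =
  mutint L (minn r (size ss) * L) s (flatten (take r ss)) :> R.
Proof.
move=> sL Gs ssL Gss; have [rs|sr] := leqP r (size ss); last first.
  by rewrite take_oversize// ltnW.
have tL : size (flatten (take r ss)) = (r * L)%N.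
  rewrite (@size_flatten_blocks L) ?size_takel//.
  by move: ssL; rewrite /sized -{1}(cat_take_drop r ss) all_cat => /andP[].
rewrite /mutint; apply: eq_bigr => j _.
rewrite (@big_cat_nat _ _ _ (r * L))//=; last by rewrite leq_mul2r rs orbT.
rewrite [X in _ + X]big1_seq ?addr0; last first.
  by move=> k /andP[_]; rewrite mem_index_iota => /andP[rk kL]; rewrite chain_far.
apply: eq_big_nat => k /andP[_ kr].
by rewrite -{1}(cat_take_drop r ss) flatten_cat takel_cat ?tL.
Qed.

Lemma selfint_flatten ss : sized ss -> all G ss ->
  selfint (size ss * L) (flatten ss) <= (size ss)%:R * T + near (size ss) ss.
Proof.
elim: ss => [|s ss IHss] /=.
  by move=> _ _; rewrite mul0n selfint0 mul0r addr0.
move=> /andP[/eqP sL ssL] /andP[Gs Gss].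
rewrite mulSn selfint_cat// mutint_flatten//.
have := IHss ssL Gss; have := @GT s sL Gs; rewrite -natr1; lra.
Qed.

Variable C : R.
Hypothesis C0 : 0 < C.
Hypothesis hC : forall k x, hit k x <= C / k.+1%:R.

Let Gr s : R := (G s)%:R.
Let g := Ex L Gr.

Let all_good (ss : seq (seq Z2)) : R := \prod_(s <- ss) Gr s.

Let Gr01 s : 0 <= Gr s <= 1.
Proof. by rewrite /Gr ler0n lern1 leq_b1. Qed.

Let bGr : bdd Gr. Proof. exact: bdd_bool. Qed.

Let ball : bdd all_good. Proof. exact: bdd_prod01. Qed.

Let all_good01 ss : 0 <= all_good ss <= 1.
Proof.
rewrite /all_good; elim: ss => [|s ss /andP[h1 h2]]; first by rewrite big_nil ler01 lexx.
have /andP[g0 g1] := Gr01 s.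
by rewrite big_cons mulr_ge0//= mulr_ile1.
Qed.

Let all_goodE ss : all_good ss = (all G ss)%:R.
Proof.
rewrite /all_good; elim: ss => [|s ss IHss]; first by rewrite big_nil.
by rewrite big_cons IHss /Gr /= -natrM mulnb.
Qed.

Lemma prob_good_le1 : g <= 1.
Proof.
rewrite -[leRHS](mean_cst (mE L)); apply: (mean_le (mE _)); [by []|exact: bdd_cst|].
by move=> s; have /andP[] := Gr01 s.
Qed.

Lemma meanmut_short_le r' : (r' <= r)%N -> meanmut mu L (r' * L) <= 4 * C * (r%:R * L%:R).
Proof.
move=> rr; apply: le_trans (meanmut_le hC _ _) _.
rewrite ler_wpM2l ?mulr_ge0 ?(ltW C0)// -sqrtrM// -natrM -natrM.
rewrite -[leRHS]ger0_norm// -sqrtr_sqr ler_sqrt ?sqr_ge0// -natrX ler_nat.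
have r2 : (r' <= r * r)%N by nia.
by rewrite expnMn -!mulnn mulnCA leq_mul2r r2 orbT.
Qed.

Hypothesis g0 : 0 < g.

Let w := 4 * C * (r%:R * L%:R) / g ^+ r.+1.

(** Mutual intersections of a block with its neighbours are estimated by dropping
    the condition that these [r.+1] blocks are good; relative to the probability
    [g ^+ q] of the chain this costs a factor of [g ^- r.+1]. *)
Lemma near_mean_le q :
  blocks L q (fun ss => all_good ss * near q ss) <= q%:R * w * g ^+ q.
Proof.
have w0 : 0 <= w.
  by rewrite /w !mulr_ge0 ?(ltW C0)// invr_ge0 exprn_ge0// ltW.
elim: q => [|q IHq]; first by rewrite /= mulr0 !mul0r.
pose r' := minn r q.
pose mut s ss : R := mutint L (r' * L) s (flatten (take r ss)).
have bmut : bdd (fun p => mut p.1 p.2).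
  have [M hM] := @bdd_mutint R L (r' * L).
  by exists M => p; exact: (hM (p.1, flatten (take r p.2))).
have bmuts s : bdd (mut s) by have [M hM] := bmut; exists M => ss; exact: (hM (s, ss)).
have mB := blocks_mean mu L q.
have bn := bdd_near q.
have b1 : bdd (fun s => blocks L q (fun ss => all_good ss * mut s ss)).
  apply: (bdd_iterE (mE L)); apply: bddM; last exact: bmut.
  exact: (bdd_comp snd ball).
have -> : blocks L q.+1 (fun ss => all_good ss * near q.+1 ss) =
    Ex L (fun s => Gr s * blocks L q (fun ss => all_good ss * near q ss) +
      Gr s * blocks L q (fun ss => all_good ss * mut s ss)).
  rewrite [LHS]/=; congr iterE; apply/funext => s.
  have ba : bdd (fun ss => all_good ss * near q ss) by apply: bddM.
  have bb : bdd (fun ss => all_good ss * mut s ss) by apply: bddM.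
  rewrite -mulrDr -(meanD mB)// -(meanZ mB); last by apply: bddD.
  congr iterE; apply/funext => ss; rewrite /mut /r' /all_good big_cons; ring.
rewrite (meanD (mE L)); [|by bd|by apply: bddM].
rewrite (meanZr (mE L))// -/g.
have gL : 0 <= g by exact: ltW.
have step2 : Ex L (fun s => Gr s * blocks L q (fun ss => all_good ss * mut s ss)) <=
    g ^+ (q - r') * meanmut mu L (r' * L).
  pose F s ss := all_good (drop r' ss) * mutint L (r' * L) s (flatten (take r' ss)) : R.
  have bF : bdd (fun p => F p.1 p.2).
    apply: bddM; first exact: (bdd_comp (fun p => drop r' p.2) ball).
    have [M hM] := @bdd_mutint R L (r' * L).
    by exists M => p; exact: (hM (p.1, flatten (take r' p.2))).
  have bFs s : bdd (F s) by have [M hM] := bF; exists M => ss; exact: (hM (s, ss)).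
  apply: (@le_trans _ _ (Ex L (fun s => blocks L q (F s)))).
    apply: (mean_le (mE L)).
    - by apply: bddM.
    - by apply: (bdd_iterE (mE L)).
    - move=> s; have bb : bdd (fun ss => all_good ss * mut s ss) by apply: bddM.
      rewrite -(meanZ mB)//; apply: (iterE_le (mE L)); [by apply: bddM; [bd|]|by []|].
      move=> ss ssq; rewrite /F.
      have -> : take r' ss = take r ss.
        rewrite /r'; have [rq|qr] := leqP r q => //.
        by rewrite !take_oversize ?ssq// ltnW.
      rewrite mulrA ler_wpM2r ?mutint_ge0//.
      have /andP[s0 s1] := Gr01 s.
      apply: (@le_trans _ _ (all_good ss)).
        by have /andP[a0 _] := all_good01 ss; rewrite ler_piMl.
      rewrite -{1}(cat_take_drop r' ss) /all_good big_cat/= -/(all_good _) -/(all_good _).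
      have /andP[a0 a1] := all_good01 (take r' ss).
      have /andP[d0 d1] := all_good01 (drop r' ss).
      by rewrite ler_piMl.
  have r'q : (r' <= q)%N by rewrite geq_minr.
  rewrite le_eqVlt; apply/orP; left; apply/eqP.
  rewrite /meanmut -(meanZ (mE L)); last first.
    by apply: (bdd_iterE (step_mean mu)); exact: bdd_mutint.
  congr iterE; apply/funext => s.
  rewrite -{1}(subnKC r'q) iterE_cat -(iterE_flatten (step mu)).
  have bmf : bdd (fun ss : seq (seq Z2) => @mutint R L (r' * L) s (flatten ss)).
    have [M hM] := @bdd_mutint R L (r' * L).
    by exists M => ss; exact: (hM (s, flatten ss)).
  rewrite -(meanZ (blocks_mean mu L r'))//; apply: eq_iterE => s1 s1r.
  rewrite -(iterE_prod (mE L))// -(meanZr (blocks_mean mu L (q - r')))//.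
  congr iterE; apply/funext => s2; rewrite /F.
  by rewrite (drop_size_cat _ s1r) (take_size_cat _ s1r).
apply: le_trans (lerD (ler_wpM2l gL IHq) step2) _.
have h2 : g ^+ (q - r') * meanmut mu L (r' * L) <= w * g ^+ q.+1.
  apply: (@le_trans _ _ (g ^+ (q - r') * (4 * C * (r%:R * L%:R)))).
    rewrite ler_wpM2l ?exprn_ge0// meanmut_short_le// geq_minl//.
  have -> : w * g ^+ q.+1 = 4 * C * (r%:R * L%:R) * g ^+ q.+1 / g ^+ r.+1.
    by rewrite /w mulrAC.
  rewrite ler_pdivlMr ?exprn_gt0// mulrAC [leLHS]mulrC.
  rewrite ler_wpM2l ?mulr_ge0 ?(ltW C0)// -exprD.
  by rewrite ler_wiXn2l ?prob_good_le1// /r'; lia.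
rewrite -natr1 mulrDl mulrDl mul1r exprS lerD//; last by rewrite -exprS.
by rewrite le_eqVlt; apply/orP; left; apply/eqP; ring.
Qed.

(** Conditioned on all blocks being good, the intersections between neighbouring
    blocks have mean [O(q L)], and Markov's inequality applies. *)
Lemma chain_prob q : (0 < q)%N ->
  g ^+ q / 2 <= Ex (q * L) (fun u => (selfint (q * L) u <= q%:R * (T + 2 * w))%R%:R).
Proof.
move=> q0; have qR : (0 : R) < q%:R by rewrite ltr0n.
have w0 : 0 < w.
  by rewrite /w divr_gt0 ?exprn_gt0// !mulr_gt0// ltr0n.
have mB := blocks_mean mu L q; have bn := bdd_near q.
have qw0 : 0 < 2 * q%:R * w by apply: mulr_gt0 => //; apply: mulr_gt0.
rewrite -(iterE_flatten (step mu)).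
apply: (@le_trans _ _ (blocks L q (fun ss => all_good ss - (2 * q%:R * w)^-1 * (all_good ss * near q ss)))).
  have ba : bdd (fun ss => all_good ss * near q ss) by apply: bddM.
  rewrite (meanB mB) ?(meanZ mB)//; last by apply: bddM; [bd|].
  rewrite (iterE_prod (mE L))// -/g.
  have : (2 * q%:R * w)^-1 * blocks L q (fun ss => all_good ss * near q ss) <= g ^+ q / 2.
    rewrite mulrC ler_pdivrMr//; apply: le_trans (near_mean_le q) _.
    by rewrite le_eqVlt; apply/orP; left; apply/eqP; field.
  lra.
apply: (@iterE_blocks_le _ (Ex L) (mE L) L).
- by move=> f f' ff; exact: eq_iterE.
- by apply: bddD => //; apply: bddN; apply: bddM; [bd|apply: bddM].
- exact: bdd_bool.
move=> ss ssq ssL; rewrite all_goodE.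
have n0 := near_ge0 q ss.
case: (boolP (all G ss)) => Gss; last by rewrite mul0r mulr0 subr0.
rewrite mul1r.
have := selfint_flatten ssL Gss; rewrite ssq => hs.
have [nq|nq] := leP (near q ss) (2 * q%:R * w).
  rewrite (_ : selfint _ _ <= _ = true).
    by rewrite lerBlDr lerDl mulr_ge0// invr_ge0 ltW.
  by apply: le_trans hs _; rewrite mulrDr lerD2l (le_trans nq)// mulrA (mulrC 2).
apply: (@le_trans _ _ 0); last exact: ler0n.
by rewrite subr_le0 mulrC ler_pdivlMr// mul1r ltW.
Qed.

End chain.


(** * The lower bound *)

Section lower.
Context {R : realType} (mu : probability Z2 R).
Local Notation hit := (hit mu).
Local Notation Ex := (iterE (step mu)).
Local Notation mean := (meanself mu).
Local Notation x1 := (@coord1 R).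
Local Notation x2 := (@coord2 R).
Let mE n := iterE_mean (step_mean mu) n.
Variables (C kap K s1 s2 t : R).
Hypothesis hsym : forall f, step mu (fun z => f (- z)) = step mu f.
Hypothesis hC : forall k x, hit k x <= C / k.+1%:R.
Hypothesis C0 : 0 < C.
Hypothesis kap0 : 0 < kap.
Hypothesis hmean : forall n, `|mean n - kap * (n%:R * ln n%:R)| <= K * n%:R.
Hypothesis X1 : mu.-integrable setT (EFin \o (fun z => x1 z ^+ 2)).
Hypothesis X2 : mu.-integrable setT (EFin \o (fun z => x2 z ^+ 2)).
Hypotheses (s11 : 1 <= s1) (s21 : 1 <= s2).
Hypotheses (s1v : step mu (fun z => x1 z ^+ 2) <= s1 ^+ 2)
           (s2v : step mu (fun z => x2 z ^+ 2) <= s2 ^+ 2).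
Hypothesis t0 : 0 < t.
Hypothesis htail : forall n, (0 < n)%N ->
  Ex n (fun s => (mean n + t * n%:R < selfint n s)%R%:R) <= 16^-1.

(* the box of [far1_prob] has probability at most [15 a s2 C <= 1/4] *)
Let a := (60 * s2 * (C + 1))^-1.

Let s10 : 0 < s1. Proof. exact: lt_le_trans s11. Qed.
Let s20 : 0 < s2. Proof. exact: lt_le_trans s21. Qed.

Let a0 : 0 < a.
Proof.
have C1 : 0 < C + 1 by rewrite addr_gt0.
by rewrite invr_gt0; apply: mulr_gt0 => //; apply: mulr_gt0.
Qed.

Let sqrtL (L : nat) : (0 < L)%N -> 0 < Num.sqrt L%:R :> R.
Proof. by move=> L0; rewrite sqrtr_gt0 ltr0n. Qed.

Lemma far2_prob L (l : R) : (0 < L)%N -> 2 * s2 * Num.sqrt L%:R <= l ->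
  Ex L (fun s => (l <= `|x2 (sumz s)|)%R%:R) <= 4^-1.
Proof.
move=> L0 hl; have L' := sqrtL L0.
have m0 : 0 < 2 * s2 * Num.sqrt L%:R by rewrite !mulr_gt0.
apply: (@le_trans _ _ (Ex L (fun s => (exits x2 (2 * s2 * Num.sqrt L%:R) 0 s)%:R))).
  apply: (mean_le (mE L)); [by bd|by bd|].
  move=> s; rewrite ler_nat; case: (boolP (exits _ _ _ _)) => [_|]; first exact: leq_b1.
  move=> /(exitsN (@coord2D R) (size s)); rewrite take_size add0r => h.
  by rewrite leNgt (lt_le_trans h hl).
apply: le_trans (Ex_exits_le hsym (@coord2D R) X2 L 0 m0) _.
rewrite expr0n/= add0r ler_pdivrMr ?exprn_gt0// !exprMn sqr_sqrtr//.
have : L%:R * step mu (fun z => x2 z ^+ 2) <= L%:R * s2 ^+ 2 by rewrite ler_wpM2l.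
move: (s2 ^+ 2) => u; lra.
Qed.

(** A block that ends close to the vertical axis ends either in a small box, which
    is unlikely by the choice of [a], or far away vertically. *)
Lemma far1_prob L : (0 < L)%N -> 1 <= a * Num.sqrt L%:R ->
  4^-1 <= Ex L (fun s => (a * Num.sqrt L%:R <= x1 (sumz s))%R%:R).
Proof.
move=> L0 aL; have L' := sqrtL L0.
set h := a * _ in aL *; have h0 : 0 < h by lra.
rewrite (Ex_right hsym (@coord1D R))//.
suff : Ex L (fun s => (`|x1 (sumz s)| < h)%R%:R) <= 2^-1 by lra.
pose l := 2 * s2 * Num.sqrt L%:R.
have l0 : 0 < l by rewrite /l !mulr_gt0.
pose k1 := Num.truncn h; pose k2 := Num.truncn l.
have /andP[k1h hk1] := truncn_itv (ltW h0); rewrite -/k1 in k1h hk1.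
have /andP[k2l lk2] := truncn_itv (ltW l0); rewrite -/k2 in k2l lk2.
apply: (@le_trans _ _ (Ex L (fun s =>
    ((`|x1 (sumz s)| < k1.+1%:R)%R && (`|x2 (sumz s)| < k2.+1%:R)%R)%:R +
    (k2.+1%:R <= `|x2 (sumz s)|)%R%:R))).
  apply: (mean_le (mE L)); [by bd|by bd|].
  move=> s; case: (ltP (`|x1 (sumz s)|) h) => h1; last by rewrite addr_ge0.
  by rewrite (lt_trans h1 hk1)/=; case: (ltP `|x2 (sumz s)| k2.+1%:R) => h2; rewrite ?addr0 ?add0r.
rewrite (meanD (mE L)); [|by bd|by bd].
have b2 := far2_prob L0 (ltW lk2).
suff : (2 * k1).+1%:R * (2 * k2).+1%:R * (C / L.+1%:R) <= 4^-1 :> R.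
  move=> b3; have b1 := le_trans (Ex_small_box_le hC L k1 k2) b3.
  by apply: le_trans (lerD b1 b2) _; lra.
have e1 : (2 * k1).+1%:R <= 3 * h by rewrite -natr1 natrM; lra.
have e2 : (2 * k2).+1%:R <= 5 * s2 * Num.sqrt L%:R.
  have : 1 <= s2 * Num.sqrt L%:R.
    have sL1 : 1 <= Num.sqrt L%:R :> R.
      by rewrite -[X in X <= _]sqrtr1; apply: ler_wsqrtr; rewrite ler1n.
    by rewrite -[X in X <= _]mulr1; apply: ler_pM.
  by rewrite -natr1 natrM; move: k2l; rewrite /l; lra.
apply: (@le_trans _ _ (3 * h * (5 * s2 * Num.sqrt L%:R) * (C / L.+1%:R))).
  rewrite ler_wpM2r//; first by rewrite divr_ge0// ltW.
  by rewrite ler_pM.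
have -> : 3 * h * (5 * s2 * Num.sqrt L%:R) * (C / L.+1%:R) =
    15 * a * s2 * C * (Num.sqrt L%:R ^+ 2 / L.+1%:R) by rewrite /h; ring.
rewrite sqr_sqrtr//.
have LL : 0 <= (L%:R / L.+1%:R : R) <= 1.
  by rewrite divr_ge0//= ler_pdivrMr// mul1r ler_nat.
have : 15 * a * s2 * C <= 4^-1.
  have -> : 15 * a * s2 * C = 4^-1 * (C / (C + 1)).
    have C1 : 0 < C + 1 by rewrite addr_gt0.
    by rewrite /a; field; rewrite !gt_eqF.
  by rewrite ler_piMr// ler_pdivrMr ?addr_gt0// mul1r lerDl.
case/andP: LL => LL0 LL1; move=> h1.
have p0 : 0 <= 15 * a * s2 * C.
  by rewrite mulr_ge0 ?(ltW C0)// mulr_ge0 ?(ltW s20)// mulr_ge0 ?(ltW a0).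
by apply: le_trans h1; rewrite ler_piMr.
Qed.

Let good L s := [&& (a * Num.sqrt L%:R <= x1 (sumz s))%R,
  ~~ exits x1 (4 * s1 * Num.sqrt L%:R) 0 s &
  (selfint L s <= mean L + t * L%:R)%R].

(** The three conditions fail with total probability at most [3/4 + 1/16 + 1/16]. *)
Lemma good_prob L : (0 < L)%N -> 1 <= a * Num.sqrt L%:R ->
  8^-1 <= Ex L (fun s => (good L s)%:R).
Proof.
move=> L0 aL; have L' := sqrtL L0.
have m0 : 0 < 4 * s1 * Num.sqrt L%:R by rewrite !mulr_gt0.
have b1 := far1_prob L0 aL.
have b2 : Ex L (fun s => (exits x1 (4 * s1 * Num.sqrt L%:R) 0 s)%:R) <= 16^-1.
  apply: le_trans (Ex_exits_le hsym (@coord1D R) X1 L 0 m0) _.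
  rewrite expr0n/= add0r ler_pdivrMr ?exprn_gt0// !exprMn sqr_sqrtr//.
  have : L%:R * step mu (fun z => x1 z ^+ 2) <= L%:R * s1 ^+ 2 by rewrite ler_wpM2l.
  move: (s1 ^+ 2) => u; lra.
have b3 := htail L0.
apply: (@le_trans _ _ (Ex L (fun s => (a * Num.sqrt L%:R <= x1 (sumz s))%R%:R -
   ((exits x1 (4 * s1 * Num.sqrt L%:R) 0 s)%:R +
    (mean L + t * L%:R < selfint L s)%R%:R)))).
  rewrite (meanB (mE L)); [|by bd|by bd]; rewrite (meanD (mE L)); [|by bd|by bd].
  by move: b1 b2 b3; move: (Ex _ _) (Ex _ _) (Ex _ _) => u v w; lra.
apply: (mean_le (mE L)); [by bd|by bd|].
move=> s; rewrite /good (leNgt (selfint L s)).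
case: (_ <= x1 _); case: (exits _ _ _ _); case: (_ < selfint _ _); rewrite /=; lra.
Qed.

(** The block length is at most [2 n / (A m)]. *)
Lemma log_scale_le (n q L : nat) (A m : R) : (0 < q)%N -> (0 < L)%N -> 0 < A -> 0 < m ->
  A * m <= q%:R -> (q * L <= 2 * n)%N -> (q * L <= n + q)%N ->
  q%:R * (L%:R * ln L%:R) <= n%:R * (ln n%:R - ln m - ln (A / 2)) + 2 * n%:R :> R.
Proof.
move=> q0 L0 A0 m0 Aq qL2 qLn.
have qR : (0 : R) < q%:R by rewrite ltr0n.
have LR : (0 : R) < L%:R by rewrite ltr0n.
have n0 : (0 < n)%N by have := leq_trans _ qL2 => /(_ 1%N); rewrite muln_gt0/= muln_gt0 q0 L0; exact.
have nR : (0 : R) < n%:R by rewrite ltr0n.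
have l0 : 0 <= ln L%:R :> R by rewrite ln_ge0// ler1n.
have lL : ln L%:R <= L%:R :> R by rewrite ltW// ln_sublinear.
have qL2R : q%:R * L%:R <= 2 * n%:R :> R by rewrite -!natrM ler_nat.
have h1 : ln L%:R <= ln n%:R - ln m - ln (A / 2) :> R.
  have A2 : 0 < A / 2 by rewrite divr_gt0.
  rewrite -ln_div ?posrE// -ln_div ?posrE ?divr_gt0// ler_ln ?posrE ?divr_gt0//.
  rewrite ler_pdivlMr// ler_pdivlMr//.
  have : A * m * L%:R <= q%:R * L%:R by rewrite ler_pM2r.
  lra.
have h2 : q%:R * (L%:R * ln L%:R) <= (n%:R + q%:R) * ln L%:R :> R.
  by rewrite mulrA ler_wpM2r// -natrM -natrD ler_nat.
have h3 : q%:R * ln L%:R <= q%:R * L%:R :> R by rewrite ler_pM2l.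
have h4 : n%:R * ln L%:R <= n%:R * (ln n%:R - ln m - ln (A / 2)) :> R by rewrite ler_pM2l.
lra.
Qed.

Lemma choose_scale (n : nat) (A m : R) : 2 <= A * m -> 2 * A * m <= n%:R ->
  exists q L : nat, [/\ (0 < q)%N, (0 < L)%N, A * m <= q%:R, q%:R <= 2 * A * m &
    [/\ (n <= q * L)%N, (q * L <= n + q)%N & (q * L <= 2 * n)%N]].
Proof.
move=> Am1 Amn; have Am0 : 0 <= A * m by lra.
have /andP[q1 q2] := truncn_itv Am0.
exists (Num.truncn (A * m)).+1, (n %/ (Num.truncn (A * m)).+1).+1.
have qA : (Num.truncn (A * m)).+1%:R <= 2 * A * m by rewrite -natr1; lra.
have qn : ((Num.truncn (A * m)).+1 <= n)%N by rewrite -(ler_nat R) (le_trans qA).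
move: (Num.truncn (A * m)).+1 (ltn0Sn (Num.truncn (A * m))) q2 qA qn => q q0 q2 qA qn.
have h1 : (n <= q * (n %/ q).+1)%N by rewrite mulnC ltnW// ltn_ceil.
have h2 : (q * (n %/ q).+1 <= n + q)%N by rewrite mulnS addnC leq_add2r mulnC leq_divM.
split=> //; first exact: ltW.
by split=> //; rewrite (leq_trans h2)// mul2n -addnn leq_add2l.
Qed.

(** Up to [O(n)] a chain of good blocks has [kap n ln (n / q)] self-intersections;
    choosing [q >= A m] with [ln A] large absorbs the [O(n)]. *)
Lemma lower_bound : exists c m0 e : R, [/\ 0 < c, 0 < m0, 0 < e & forall n (m : R),
  m0 <= m -> m <= e * n%:R ->
  expR (- (c * m)) <=
  Ex n (fun s => (kap * (n%:R * ln m) <= mean n - selfint n s)%R%:R)].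
Proof.
have [kap0' t0' s21' C0'] : [/\ 0 < kap, 0 < t, 1 <= s2 & 0 < C] by [].
have K0 : 0 <= K by have := hmean 1; rewrite mulr1; exact: le_trans.
pose r := (Num.truncn (8 * s1 / a)).+1.
have ra : 8 * s1 <= r.+1%:R * a.
  rewrite -ler_pdivrMr//; apply: ltW; apply: lt_trans (truncnS_gt _) _.
  by rewrite ltr_nat.
have [W WE W0] : exists2 W, W = 4 * C * r%:R * 8 ^+ r.+1 & 0 <= W.
  exists (4 * C * r%:R * 8 ^+ r.+1); first by [].
  have c0 : 0 <= 4 * C * r%:R by apply: mulr_ge0 => //; apply: mulr_ge0 => //; exact: ltW.
  by apply: mulr_ge0 => //; apply: exprn_ge0.
have [A AE A2] : exists2 A, ln (A / 2) = (2 * kap + 3 * K + 2 * t + 4 * W) / kap & 2 <= A.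
  exists (2 * expR ((2 * kap + 3 * K + 2 * t + 4 * W) / kap)).
    by rewrite [2 * expR _]mulrC mulfK// expRK.
  rewrite -[X in X <= _]mulr1 ler_pM2l// -[X in X <= _]expR0 ler_expR.
  by rewrite divr_ge0 ?(ltW kap0)//; lra.
have a1 : a <= 1 by rewrite /a invf_le1; nra.
have A0 : 0 < A by lra.
pose e := a ^+ 2 / (2 * A).
have e0 : 0 < e by rewrite /e divr_gt0 ?exprn_gt0// mulr_gt0.
(* there are at most [2 A m] blocks; being good costs [1/8] for each, and [16]
   also covers the factor [1/2] of [chain_prob] *)
exists (2 * A * ln 16), 1, e; split => //.
  by rewrite !mulr_gt0// ln_gt0; lra.
move=> n m m1 mn; have m0 : 0 < m by lra.
have Am1 : 2 <= A * m by rewrite -[leLHS]mulr1 ler_pM//; lra.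
have nR : (0 : R) < n%:R.
  by rewrite -(pmulr_rgt0 _ e0); exact: lt_le_trans mn.
have Aa : 2 * A * m <= a ^+ 2 * n%:R.
  have := mn; rewrite /e mulrAC ler_pdivlMr ?mulr_gt0//; lra.
have a2 : a ^+ 2 <= 1 by rewrite expr_le1// ltW.
have An : 2 * A * m <= n%:R by rewrite (le_trans Aa)// ler_piMl// ltW.
have [q [L [q0 L0 Aq qA [nN Nn N2]]]] := choose_scale Am1 An.
have aL : 1 <= a * Num.sqrt L%:R.
  have -> : a * Num.sqrt L%:R = Num.sqrt (a ^+ 2 * L%:R).
    by rewrite sqrtrM ?sqr_ge0// sqrtr_sqr gtr0_norm.
  rewrite -[X in X <= _]sqrtr1; apply: ler_wsqrtr.
  have qR : (0 : R) < q%:R by rewrite ltr0n.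
  rewrite -(ler_pM2l qR) mulr1 mulrCA -natrM.
  apply: (le_trans qA); apply: (le_trans Aa); rewrite ler_wpM2l ?sqr_ge0//.
  by rewrite ler_nat.
have hg := good_prob L0 aL; set g := Ex L _ in hg.
have g0 : 0 < g by lra.
have rh : 2 * (4 * s1 * Num.sqrt L%:R) <= r.+1%:R * (a * Num.sqrt L%:R).
  have -> : 2 * (4 * s1 * Num.sqrt L%:R) = (8 * s1) * Num.sqrt L%:R by ring.
  by rewrite mulrA ler_wpM2r// sqrtr_ge0.
have Gh s : size s = L -> good L s -> a * Num.sqrt L%:R <= x1 (sumz s).
  by move=> _ /and3P[].
have GH s j : size s = L -> good L s -> `|x1 (sumz (take j s))| < 4 * s1 * Num.sqrt L%:R.
  by move=> _ /and3P[_ /(exitsN (@coord1D R) j)]; rewrite add0r.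
have GT s : size s = L -> good L s -> selfint L s <= mean L + t * L%:R.
  by move=> _ /and3P[].
have h0 : 0 <= a * Num.sqrt L%:R by lra.
have r0 : (0 < r)%N by [].
have := chain_prob L0 r0 h0 rh Gh GH GT C0 hC g0 q0; rewrite -/g.
set w := _ / g ^+ _ => hch.
have wW : w <= W * L%:R.
  rewrite /w ler_pdivrMr ?exprn_gt0// WE.
  have : 1 <= 8 ^+ r.+1 * g ^+ r.+1.
    by rewrite -exprMn exprn_ege1//; lra.
  have p0 : 0 <= 4 * C * (r%:R * L%:R) by rewrite !mulr_ge0// ltW.
  move=> /(ler_wpM2l p0); rewrite mulr1 => h; apply: le_trans h _.
  by rewrite le_eqVlt; apply/orP; left; apply/eqP; ring.
apply: (@le_trans _ _ (g ^+ q / 2)).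
  apply: (@le_trans _ _ (16^-1 ^+ q)).
    rewrite -[16^-1]lnK ?posrE// -expRM_natl ler_expR lnV ?posrE//.
    rewrite mulrN lerN2 mulrAC ler_wpM2r// ln_ge0; lra.
  rewrite (_ : 16^-1 = 8^-1 / 2); last by field.
  rewrite exprMn ler_pM ?exprn_ge0 ?invr_ge0//.
    by rewrite lerXn2r ?nnegrE ?(ltW g0)// invr_ge0.
  by rewrite -[leRHS]expr1 ler_wiXn2l//; lra.
apply: (le_trans hch).
rewrite -{1}(subnKC nN).
pose Q (s : seq Z2) := (kap * (n%:R * ln m) <= mean n - selfint n s)%R.
rewrite -(iterE_catl (step_mean mu) n (q * L - n) (fun s => (Q s)%:R)).
rewrite subnKC//.
apply: iterE_le; [exact: step_mean|exact: bdd_bool|exact: bdd_bool|].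
move=> u uN; rewrite ler_nat /Q selfint_take.
case: leP => [hu|//]; rewrite lt0b.
suff -> : kap * (n%:R * ln m) <= mean n - selfint n u by [].
have su : selfint n u <= selfint (q * L) u :> R.
  rewrite -(selfint_take n) -{2}(cat_take_drop n u) -(subnKC nN).
  by apply: selfint_le_cat; rewrite size_takel// uN.
have m1' : mean L <= kap * (L%:R * ln L%:R) + K * L%:R.
  by have := hmean L; rewrite ler_norml => /andP[]; lra.
have m2' : kap * (n%:R * ln n%:R) - K * n%:R <= mean n.
  by have := hmean n; rewrite ler_norml => /andP[]; lra.
have hl := log_scale_le q0 L0 A0 m0 Aq N2 Nn.
have {}hl : kap * (q%:R * (L%:R * ln L%:R)) <=
   kap * (n%:R * (ln n%:R - ln m) + 2 * n%:R) - (2 * kap + 3 * K + 2 * t + 4 * W) * n%:R.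
  apply: (@le_trans _ _ (kap * (n%:R * (ln n%:R - ln m - ln (A / 2)) + 2 * n%:R))).
    by rewrite ler_pM2l.
  rewrite AE; move: (ln n%:R) (ln m) => x y.
  by rewrite le_eqVlt; apply/orP; left; apply/eqP; field; rewrite gt_eqF.
have h1 : q%:R * (mean L + t * L%:R + 2 * w) <=
   q%:R * (kap * (L%:R * ln L%:R) + K * L%:R + t * L%:R + 2 * (W * L%:R)).
  by rewrite ler_wpM2l//; lra.
have h2 : (K + t + 2 * W) * (q%:R * L%:R) <= (K + t + 2 * W) * (2 * n%:R).
  by rewrite ler_wpM2l -?natrM ?ler_nat//; lra.
move: hu su h1 h2 hl m2'.
move: (ln L%:R) (ln n%:R) (ln m) (mean n) (selfint n u) (selfint _ u) => l1 l2 l3 e1 e2 e3.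
move: (mean L + _ + _) => e4.
move: (q%:R : R) (L%:R : R) (n%:R : R) => q' L' n' *.
lra.
Qed.

End lower.


(** * From the random walk to the law of one step *)

Lemma Z2_countable : countable [set: Z2].
Proof.
by apply/countable_injP; exists (@choice.pickle (int * int)%type) => x y _ _;
  apply: (pcan_inj (@choice.pickleK _)).
Qed.

Section path_law.
Context {R : realType} {d : measure_display} {T : measurableType d}
        {P : probability T R}.
Variable X : nat -> {RV P >-> Z2}.
Hypotheses (Xind : mutually_independent X) (Xid : identically_distributed X).

Definition law : probability Z2 R := distribution P (X 0%N).
Local Notation Ex := (iterE (step law)).

Definition path_from (k m : nat) (t : T) : seq Z2 := [seq X i t | i <- iota k m].

Lemma measurable_pre k (B : set Z2) : measurable (X k @^-1` B).
Proof. by rewrite -[X in measurable X]setTI; exact: (measurable_funP (X k)). Qed.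

Lemma measurable_path k m (F : seq Z2 -> bool) :
  measurable [set t | F (path_from k m t)].
Proof.
elim: m k F => [|m IHm] k F.
  rewrite /path_from /=; case: (F [::]).
    by rewrite (_ : [set _ | _] = setT)//; apply/seteqP; split.
  by rewrite (_ : [set _ | _] = set0)//; apply/seteqP; split.
rewrite (_ : [set _ | _] = \bigcup_z (X k @^-1` [set z] `&`
    [set t | F (z :: path_from k.+1 m t)])); last first.
  apply/seteqP; split => [t Ft|t [z _ [/= <-]]//].
  by exists (X k t).
apply: countable_bigcupT_measurable; first exact: Z2_countable.
by move=> z; apply: measurableI; [exact: measurable_pre|exact: (IHm _ (fun s => F (z :: s)))].
Qed.

Definition starts (s : seq Z2) : set T := [set t | path_from 0 (size s) t = s].

Lemma measurable_starts s : measurable (starts s).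
Proof.
rewrite (_ : starts s = [set t | (path_from 0 (size s) t == s)]).
  exact: (@measurable_path 0 (size s) (fun u => u == s)).
by apply/seteqP; split => t /eqP.
Qed.

Lemma starts_rcons s z : starts (rcons s z) = starts s `&` X (size s) @^-1` [set z].
Proof.
have e t : path_from 0 (size s).+1 t = rcons (path_from 0 (size s) t) (X (size s) t).
  by rewrite /path_from -addn1 iotaD map_cat add0n cats1.
rewrite /starts size_rcons; under eq_set do rewrite e.
by apply/seteqP; split => [t /= /rcons_inj[-> ->]|t [/= -> ->]].
Qed.

Lemma indep_prefix n (A : nat -> set Z2) :
  P [set t | forall i, (i < n)%N -> A i (X i t)] = (\prod_(0 <= i < n) law (A i))%E.
Proof.
pose J := seq_fset tt (iota 0 n).
have JE i : (i \in J) = (i < n)%N by rewrite seq_fsetE mem_iota.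
have := Xind J A.
rewrite (_ : \bigcap_(i in [set` J]) _ = [set t | forall i, (i < n)%N -> A i (X i t)]); last first.
  by apply/seteqP; split => t h i /=; [rewrite -JE => /h|rewrite JE => /h].
move=> ->.
rewrite (perm_big (index_iota 0 n)); last first.
  by rewrite /index_iota subn0 (perm_trans (seq_fset_perm _ _))// undup_id ?iota_uniq.
apply: eq_bigr => i _.
by have /(congr1 (fun f => f (A i))) := Xid i.
Qed.

Lemma starts_step s (B : set Z2) :
  P (starts s `&` X (size s) @^-1` B) = (P (starts s) * law B)%E.
Proof.
pose A i := if (i < size s)%N then [set nth 0 s i] else B.
have sE : starts s = [set t | forall i, (i < size s)%N -> A i (X i t)].
  apply/seteqP; split => [t h i il|t h].
    rewrite /A il /=.
    rewrite -[in RHS]h (nth_map 0%N) ?size_iota// nth_iota//.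
  rewrite /starts/=; apply: (@eq_from_nth _ 0); first by rewrite size_map size_iota.
  move=> i; rewrite size_map size_iota => il.
  rewrite (nth_map 0%N) ?size_iota// nth_iota// add0n.
  by have := h i il; rewrite /A il.
have -> : starts s `&` X (size s) @^-1` B =
    [set t | forall i, (i < (size s).+1)%N -> A i (X i t)].
  rewrite sE; apply/seteqP; split => [t [h1 h2] i|t h].
    rewrite ltnS leq_eqVlt => /orP[/eqP ->|]; last exact: h1.
    by rewrite /A ltnn.
  split; first by move=> i il; apply: h; rewrite ltnW.
  by have := h (size s) (ltnSn _); rewrite /A ltnn.
by rewrite sE !indep_prefix big_nat_recr//= {2}/A ltnn.
Qed.

Lemma cell_set1 n z : cell setT n z -> cell setT n = [set z].
Proof.
move=> [zn _]; apply/seteqP; split => [y [yn _]|y ->//].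
by apply: (pcan_inj (@choice.pickleK (int * int)%type)); rewrite yn zn.
Qed.

Lemma cell_empty n : (forall z, ~ cell setT n z) -> cell setT n = set0.
Proof. by move=> h; apply/seteqP; split => [y /h|]. Qed.

Lemma bigcup_cell : \bigcup_n cell setT n = setT.
Proof. by apply/seteqP; split => // z _; exists (@choice.pickle (int * int)%type z). Qed.

Lemma trivIset_cell : trivIset setT (cell setT).
Proof. by move=> i j _ _ [z [[<- _] [<- _]]]. Qed.

Lemma step_cells (f : Z2 -> R) : bdd f -> (forall z, 0 <= f z) ->
  (step law f)%:E = (\sum_(n <oo) \int[law]_(z in cell setT n) (f z)%:E)%E.
Proof.
move=> bf f0.
rewrite /step /Rintegral fineK; last by apply: integrable_fin_num => //; exact: integrable_bdd.
rewrite -{1}bigcup_cell ge0_integral_bigcup//; last exact: trivIset_cell.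
by move=> z _; rewrite lee_fin.
Qed.

(** Conditioning on the steps one at a time replaces their joint law by iterated
    integrals; independence enters through [starts_step]. *)
Lemma path_law_from m s (F : seq Z2 -> bool) :
  P (starts s `&` [set t | F (path_from (size s) m t)]) =
  (P (starts s) * (Ex m (fun u => (F u)%:R))%:E)%E.
Proof.
elim: m s F => [|m IHm] s F.
  rewrite /iterE /path_from /=; case: (F [::]).
    by rewrite (_ : [set _ | _] = setT) ?setIT ?mule1//; apply/seteqP; split.
  by rewrite (_ : [set _ | _] = set0) ?setI0 ?measure0 ?mule0//; apply/seteqP; split.
pose D := starts s `&` [set t | F (path_from (size s) m.+1 t)].
have mD : measurable D.
  by apply: measurableI; [exact: measurable_starts|exact: measurable_path].
have DE : D = \bigcup_n (D `&` X (size s) @^-1` cell setT n).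
  by rewrite -setI_bigcupr -preimage_bigcup bigcup_cell preimage_setT setIT.
rewrite -/D DE measure_bigcup//; last 2 first.
- by move=> n _; apply: measurableI => //; exact: measurable_pre.
- by move=> i j _ _ [t [[_ [<- _]] [_ [<- _]]]].
rewrite [iterE _ _ _]/=.
pose f z := Ex m (fun u => (F (z :: u))%:R).
have bf : bdd f by apply: bdd_iterE; [exact: step_mean|exact: bdd_bool].
have f0 z : 0 <= f z.
  by apply: (mean_ge0 (iterE_mean (step_mean law) m)); [exact: bdd_bool|].
rewrite -/f (step_cells bf f0).
have Pf : P (starts s) \is a fin_num by exact: fin_num_measure (measurable_starts s).
rewrite -(fineK Pf) -nneseriesZl; last first.
  by move=> n _; apply: integral_ge0 => z _; rewrite lee_fin.
transitivity (\sum_(n <oo) P (D `&` X (size s) @^-1` cell setT n))%E.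
  by apply: eq_eseriesl => n; rewrite in_setT.
apply: eq_eseriesr => n _; rewrite (fineK Pf).
have [[z zn]|nz] := pselect (exists z, cell setT n z); last first.
  by rewrite cell_empty ?preimage_set0 ?setI0 ?measure0 ?integral_set0 ?mule0// => z h; apply: nz; exists z.
rewrite (cell_set1 zn).
have -> : (\int[law]_(y in [set z]) (f y)%:E = (f z)%:E * law [set z])%E.
  rewrite -integral_cst//; apply: eq_integral => y; rewrite inE => -> //.
rewrite [(_ * law _)%E]muleC muleA -starts_step -starts_rcons.
have := IHm (rcons s z) (fun u => F (z :: u)); rewrite -/(f z) => <-.
rewrite size_rcons starts_rcons; congr (P _); apply/seteqP; split => t.
  by move=> [[h1 h2] h3]; split; [split|rewrite /= -h3].
by move=> [[h1 h3] h2]; split=> //; split=> //; rewrite /= /path_from /= h3.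
Qed.

Lemma path_law n (F : seq Z2 -> bool) :
  P [set t | F (path_from 0 n t)] = (Ex n (fun u => (F u)%:R))%:E.
Proof.
have := path_law_from n [::] F.
rewrite (_ : starts [::] = setT); last by apply/seteqP; split.
by rewrite setTI probability_setT mul1e.
Qed.

Lemma S_path n j t : (j <= n)%N -> S_ X j t = sumz (take j (path_from 0 n t)).
Proof.
move=> jn; rewrite /sumz /path_from -map_take take_iota (minn_idPl jn) big_map.
by rewrite /S_ -(big_mkord xpredT (fun i => X i t)) /index_iota subn0.
Qed.

Lemma B_path n t : B_ X n t = selfint n (path_from 0 n t).
Proof.
apply: eq_big_nat => k /andP[_ kn]; apply: eq_big_nat => j /andP[_ jk].
by rewrite !(@S_path n)// ltnW// (leq_trans jk).
Qed.

Lemma expectation_B n : ('E_P[B_ X n] = (meanself law n)%:E)%E.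
Proof.
rewrite unlock.
pose F k j (s : seq Z2) := sumz (take j s) == sumz (take k s).
have mF k j : measurable_fun setT (fun t => (F k j (path_from 0 n t))%:R%:E : \bar R).
  apply/measurable_EFinP.
  rewrite (_ : (fun t => _) = \1_[set t | F k j (path_from 0 n t)]).
    by apply: measurable_indic; exact: measurable_path.
  by apply/funext => t; rewrite indicE; congr (nat_of_bool _)%:R; apply/idP/idP; rewrite inE.
have -> : (fun t => (B_ X n t)%:E) = fun t =>
    (\sum_(1 <= k < n.+1) \sum_(1 <= j < k) (F k j (path_from 0 n t))%:R%:E)%E.
  by apply/funext => t; rewrite B_path /selfint -sumEFin; apply: eq_bigr => k _; rewrite -sumEFin.
rewrite ge0_integral_sum//; last 2 first.
- by move=> k; apply: emeasurable_sum => j; exact: mF.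
- by move=> k t _; apply: sume_ge0 => j _; rewrite lee_fin.
rewrite /meanself /selfint (mean_sum (iterE_mean (step_mean law) n)); last first.
  by move=> k _; apply: bdd_sum => j _; exact: bdd_bool.
rewrite -sumEFin; apply: eq_bigr => k _.
rewrite ge0_integral_sum//.
rewrite (mean_sum (iterE_mean (step_mean law) n)); last by move=> j _; exact: bdd_bool.
rewrite -sumEFin; apply: eq_bigr => j _.
rewrite -(path_law n (F k j)) -[X in P X]setIT -integral_indic//; last exact: measurable_path.
apply: eq_integral => t _; rewrite indicE; congr (nat_of_bool _)%:R%:E.
by apply/idP/idP; rewrite inE.
Qed.

End path_law.


(** * Moments and covariance *)

Lemma integral_image d1 d2 (U : measurableType d1) (V : measurableType d2)
  (R : realType) (m : {measure set U -> \bar R}) (g : U -> V) (f : V -> \bar R) :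
  measurable_fun setT g -> measurable_fun setT f ->
  (\int[pushforward m g]_y f y = \int[m]_x f (g x))%E.
Proof.
move=> mg mf; rewrite [LHS]integralE [RHS]integralE.
congr (_ - _)%E.
- rewrite (ge0_integral_pushforward mg)//; last exact: measurable_funepos.
  by rewrite preimage_setT -(funepos_comp f g).
- rewrite (ge0_integral_pushforward mg)//; last exact: measurable_funeneg.
  by rewrite preimage_setT -(funeneg_comp f g).
Qed.

Section moments.
Context {R : realType} {d : measure_display} {T : measurableType d}
        {P : probability T R}.
Variable X : nat -> {RV P >-> Z2}.
Hypothesis hX : symmetric_walk X.
Local Notation mu := (law X).

Lemma integral_law (f : Z2 -> R) :
  (\int[P]_t (f (X 0%N t))%:E = \int[mu]_z (f z)%:E)%E.
Proof.
rewrite /law /= /distribution (@integral_image _ _ T Z2 R P (X 0%N) (EFin \o f))//.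
Qed.

Lemma step_lawN (f : Z2 -> R) : step mu (fun z => f (- z)) = step mu f.
Proof.
rewrite /step /Rintegral; congr fine.
have mN : measurable_fun setT (fun z : Z2 => - z) by move=> _ B mB.
rewrite -(@integral_image _ _ Z2 Z2 R mu (fun z => - z) (EFin \o f))//.
have -> : pushforward mu (fun z : Z2 => - z) = mu :> (set Z2 -> \bar R); last by [].
by apply/funext => A; exact: esym (walk_sym hX A).
Qed.

Lemma enorm_powR (r : R) (z : Z2) : enorm z `^ (2 * r) = sqz z `^ r :> R.
Proof.
rewrite /enorm /sqz.
have -> : \sum_(i < 2) zcoord i z ^+ 2 = z.1%:~R ^+ 2 + z.2%:~R ^+ 2 :> R.
  by rewrite big_ord_recl big_ord1.
by rewrite -powR12_sqrt ?addr_ge0 ?sqr_ge0// -powRrM mulKf.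
Qed.

Lemma integrable_moment (r : R) : (norm_moment (2 * r) (X 0%N) < +oo)%E ->
  mu.-integrable setT (EFin \o (fun z => sqz z `^ r)).
Proof.
rewrite /norm_moment unlock => h; apply/integrableP; split => //.
apply: le_lt_trans h.
have -> : (\int[P]_w (enorm (X 0%N w) `^ (2 * r))%:E = \int[mu]_z (sqz z `^ r)%:E)%E.
  by rewrite -integral_law; apply: eq_integral => t _; rewrite enorm_powR.
rewrite le_eqVlt; apply/orP; left; apply/eqP; apply: eq_integral => z _.
by rewrite /= ger0_norm ?powR_ge0.
Qed.

Lemma integrable_sqz : mu.-integrable setT (EFin \o @sqz R).
Proof.
have := @integrable_moment 1; rewrite mulr1 => /(_ (walk_moment2 hX)).
by under [X in _.-integrable _ X]eq_fun do rewrite /= powRr1 ?sqz_ge0//.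
Qed.

Lemma integrable_sqz_powR (delta p : R) : 0 < p -> p <= delta / 2 ->
  (norm_moment (2 + delta) (X 0%N) < +oo)%E ->
  mu.-integrable setT (EFin \o (fun z => sqz z * sqz z `^ p)).
Proof.
move=> p0 pd hm.
have e : 2 + delta = 2 * (1 + delta / 2) by field.
rewrite e in hm; have i1 := integrable_moment hm.
have i2 : mu.-integrable setT (EFin \o (fun _ : Z2 => 1 : R)).
  by apply: integrable_bdd; exact: bdd_cst.
apply: (@integrable_le _ mu _ (fun z => 1 + sqz z `^ (1 + delta / 2))).
  exact: (integrableD _ i2 i1).
move=> z; have : 0 <= sqz z :> R by exact: sqz_ge0.
move: (sqz z) => u u0.
rewrite ger0_norm ?mulr_ge0 ?powR_ge0//.
have [u1|u1] := leP u 1.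
  rewrite ler_wpDr ?powR_ge0// mulr_ile1 ?powR_ge0//.
  have : u `^ p <= 1 `^ p by apply: ge0_ler_powR; rewrite ?nnegrE//; exact: ltW.
  by rewrite powR1.
have up : 0 < u by exact: lt_trans u1.
rewrite ler_wpDl// powRD; last by rewrite (gt_eqF up) implybT.
by rewrite powRr1// ler_pM2l// ler_powR// ltW.
Qed.

(** The means vanish by symmetry, so that covariances are second moments. *)
Lemma cov_matrix_det : \det (cov_matrix (X 0%N)) = covdet mu.
Proof.
have [i1 i12 i2] := integrable_coord integrable_sqz.
have [j1 j2] : mu.-integrable setT (EFin \o (fun z : Z2 => z.1%:~R : R)) /\
    mu.-integrable setT (EFin \o (fun z : Z2 => z.2%:~R : R)).
  by split; [exact: (@integrable_X _ mu (@coord1 R))|exact: (@integrable_X _ mu (@coord2 R))].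
have z0 i : fine ('E_P[zcoord i \o X 0%N])%E = 0 :> R.
  rewrite unlock (integral_law (zcoord i)).
  have iE : zcoord i = if i == 0 then @coord1 R else @coord2 R.
    by apply/funext => z; rewrite /zcoord; case: ifP.
  apply: (step_odd0 step_lawN); rewrite iE; case: ifP => _ // z;
    by rewrite /coord1 /coord2 rmorphN.
have cE i j : cov_matrix (X 0%N) i j = step mu (fun z => zcoord i z * zcoord j z).
  rewrite mxE unlock !z0 unlock.
  rewrite -[step _ _]/(fine _) -(integral_law (fun z => zcoord i z * zcoord j z)).
  by congr fine; apply: eq_integral => t _; rewrite -[X in X%:E]/((zcoord i (X 0%N t) - 0) * (zcoord j (X 0%N t) - 0)) !subr0.
have cE' i j : fine (covariance P (zcoord i \o X 0%N) (zcoord j \o X 0%N)) = step mu (fun z => zcoord i z * zcoord j z).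
  by rewrite -cE mxE.
rewrite (expand_det_row _ ord0) big_ord_recl big_ord1 /cofactor !det_mx11 !mxE !cE' /covdet /cov11 /cov12 /cov22 /zcoord /=.
have -> : step mu (fun z => z.2%:~R * z.1%:~R) = step mu (fun z => z.1%:~R * z.2%:~R).
  by congr (step mu _); apply/funext => z; rewrite mulrC.
by rewrite /bump/= addn0 expr0 expr1 mul1r mulN1r mulrN.
Qed.

Lemma kappaE : (2 * pi)^-1 * \det (cov_matrix (X 0%N)) `^ (- 2^-1) = kappa mu.
Proof.
have [_ d0] := @covdet_gt0 R mu (walk_group hX) integrable_sqz.
by rewrite cov_matrix_det powRN powR12_sqrt ?(ltW d0)// /kappa [RHS]invfM.
Qed.


Variables (delta : R).
Hypotheses (delta0 : 0 < delta) (hmoment : (norm_moment (2 + delta) (X 0%N) < +oo)%E).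

(** The moment of order [2 + delta] is used only up to the order [4], beyond which
    Taylor's bound [cos_taylor] does not improve. *)
Lemma walk_bounds : exists c1 c2 m0 e : R, [/\ 0 < c1, 0 < c2, 0 < m0, 0 < e &
  forall n m, m0 <= m -> m <= e * n%:R ->
  expR (- (c1 * m)) <=
    iterE (step mu) n (fun s => (kappa mu * (n%:R * ln m) <= meanself mu n - selfint n s)%R%:R) <=
  expR (- (c2 * m))].
Proof.
pose p := Num.min (delta / 2) 1.
have p0 : 0 < p by rewrite lt_min ltr01 divr_gt0.
have p1 : p <= 1 by rewrite ge_min lexx orbT.
have pd : p <= delta / 2 by rewrite ge_min lexx.
have hp := integrable_sqz_powR p0 pd hmoment.
have [C C0 hC] := @local_limit R mu (walk_group hX) (walk_aper hX) step_lawN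
  integrable_sqz p p0 p1 hp.
have [_ D0] := @covdet_gt0 R mu (walk_group hX) integrable_sqz.
have k0 : 0 < kappa mu by rewrite invr_gt0 !mulr_gt0 ?pi_gt0 ?sqrtr_gt0.
pose C' := 2 * C + 1.
have C'0 : 0 < C' by rewrite /C'; lra.
have hC' k x : hit mu k x <= C' / k.+1%:R.
  case: k => [|k].
    by rewrite divr1 (le_trans (hit_le1 mu 0 x))// /C'; lra.
  have [h1 _] := hC k.+1 isT; apply: le_trans (h1 x) _.
  rewrite ler_pdivlMr// mulrAC ler_pdivrMr// /C'.
  have k1 : 1 <= k.+1%:R :> R by rewrite ler1n.
  have Ck : C <= C * k.+1%:R by rewrite ler_peMr// ltW.
  by rewrite -[k.+2%:R]natr1; lra.
have hlim k (k1 : (0 < k)%N) := (hC k k1).2.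
have hmean := meanself_asymp (ltW k0) (ltW C0) p0 hlim.
set K := C * _ + _ in hmean.
have [c2 [m2 [c20 m20 hup]]] := upper_bound hC' k0 hmean.
have [i1 _ i2] := integrable_coord integrable_sqz.
pose v1 := step mu (fun z => coord1 z ^+ 2); pose v2 := step mu (fun z => coord2 z ^+ 2).
have v10 : 0 <= v1 by apply: Rintegral_ge0 => z _; exact: sqr_ge0.
have v20 : 0 <= v2 by apply: Rintegral_ge0 => z _; exact: sqr_ge0.
have [M M0 hM] : exists2 M, 0 < M & forall n t, (0 < n)%N -> 0 < t ->
    iterE (step mu) n (fun s => (meanself mu n + t * n%:R < selfint n s)%R%:R) <= M / t.
  exists (expR (384 * C' ^+ 2)); first exact: expR_gt0.
  move=> n t; exact: selfint_tail.
have t0 : 0 < 16 * M by rewrite mulr_gt0.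
have htail n : (0 < n)%N ->
    iterE (step mu) n (fun s => (meanself mu n + 16 * M * n%:R < selfint n s)%R%:R) <= 16^-1.
  move=> n0; apply: le_trans (hM n _ n0 t0) _.
  by rewrite invfM mulrCA divff ?gt_eqF// mulr1.
have s1 : 1 <= v1 + 1 by rewrite lerDr.
have s2 : 1 <= v2 + 1 by rewrite lerDr.
have sv v : 0 <= v -> v <= (v + 1) ^+ 2 :> R by move=> ?; nra.
have [c1 [m1 [e [c10 m10 e0 hlow]]]] :=
  lower_bound step_lawN hC' C'0 k0 hmean i1 i2 s1 s2 (sv _ v10) (sv _ v20) t0 htail.
exists c1, c2, (Num.max m1 m2), (Num.min e 1); split => //.
- by rewrite lt_max m10.
- by rewrite lt_min e0 ltr01.
move=> n m; rewrite ge_max => /andP[mm1 mm2] mn.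
have n0 : 0 <= n%:R :> R by [].
have me : m <= e * n%:R by rewrite (le_trans mn)// ler_wpM2r// ge_min lexx.
have mn1 : m <= n%:R by rewrite (le_trans mn)// ler_piMl// ge_min lexx orbT.
by rewrite hlow// hup.
Qed.

End moments.

(** * The deviation probabilities *)

Section deviation.
Context {R : realType} {d : measure_display} {T : measurableType d}
        {P : probability T R}.
Variable X : nat -> {RV P >-> Z2}.
Hypothesis hX : symmetric_walk X.
Local Notation mu := (law X).

(** The event depends on [theta] through [b n `^ theta] alone. *)
Lemma P_deviation (theta : R) (b : nat -> R) n :
  P (deviation_event X theta b n) =
  (iterE (step mu) n (fun s => (kappa mu * (n%:R * ln (b n `^ theta)) <=
     meanself mu n - selfint n s)%R%:R))%:E.
Proof.
rewrite -(path_law (walk_indep hX) (walk_ident hX)); congr (P _).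
have kE : theta * (2 * pi)^-1 * \det (cov_matrix (X 0%N)) `^ (- 2^-1) * n%:R * ln (b n) =
    kappa mu * (n%:R * ln (b n `^ theta)).
  by rewrite ln_powR -(kappaE hX); move: (_ `^ _) (ln _) ((2 * pi)^-1) => u v w; ring.
apply/seteqP; split => t; rewrite /deviation_event /= kE (expectation_B (walk_indep hX) (walk_ident hX));
  by rewrite -EFinB lee_fin B_path.
Qed.

Lemma scaled_log_prob_bounds (theta : R) (b : nat -> R) n (c1 c2 : R) :
  0 < b n ->
  expR (- (c1 * b n `^ theta)) <=
    iterE (step mu) n (fun s => (kappa mu * (n%:R * ln (b n `^ theta)) <=
      meanself mu n - selfint n s)%R%:R) <=
  expR (- (c2 * b n `^ theta)) ->
  ((- c1)%:E <= scaled_log_prob X theta b n <= (- c2)%:E)%E.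
Proof.
rewrite /scaled_log_prob P_deviation => bn0.
move: (iterE _ _ _) => q /andP[q1 q2].
have q0 : 0 < q by apply: lt_le_trans q1; exact: expR_gt0.
have m0 : 0 < b n `^ theta by exact: powR_gt0.
rewrite lne_EFin// -EFinM !lee_fin powRN.
have l1 : - (c1 * b n `^ theta) <= ln q.
  by rewrite -(expRK (- (c1 * _))) ler_ln ?posrE// expR_gt0.
have l2 : ln q <= - (c2 * b n `^ theta).
  by rewrite -(expRK (- (c2 * _))) ler_ln ?posrE// expR_gt0.
rewrite [_^-1 * _]mulrC ler_pdivlMr// ler_pdivrMr//.
by rewrite !mulNr l1 l2.
Qed.

End deviation.

Lemma limn_einf_ge (R : realType) (u : (\bar R)^nat) (c : \bar R) :
  (\forall n \near \oo, (c <= u n)%E) -> (c <= limn_einf u)%E.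
Proof.
move=> [N _ hN]; rewrite limn_einf_lim; apply: lime_ge; first exact: is_cvg_einfs.
exists N => // n /= Nn; apply: le_ereal_inf_tmp => _ [k /= nk <-].
by apply: hN; exact: leq_trans nk.
Qed.

Lemma limn_esup_le (R : realType) (u : (\bar R)^nat) (c : \bar R) :
  (\forall n \near \oo, (u n <= c)%E) -> (limn_esup u <= c)%E.
Proof.
move=> [N _ hN]; rewrite limn_esup_lim; apply: lime_le; first exact: is_cvg_esups.
exists N => // n /= Nn; apply: ge_ereal_sup => _ [k /= nk <-].
by apply: hN; exact: leq_trans nk.
Qed.

Theorem theorem1p2 (R : realType) (d : measure_display) (T : measurableType d)
    (P : probability T R) (X : nat -> {RV P >-> Z2})
    (hX : symmetric_walk X)
    (delta : R) (hdelta : 0 < delta)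
    (hmoment : (norm_moment (2 + delta) (X 0%N) < +oo)%E) :
  exists C1 C2 : R, [/\ 0 < C1, 0 < C2 &
    forall (theta : R) (b : nat -> R),
      0 < theta ->
      (forall n, 0 < b n) ->
      b n @[n --> \oo] --> +oo ->
      (b : nat -> R^o) =o_\oo ((fun n => n%:R `^ theta^-1) : nat -> R^o) ->
      [/\ ((- C1)%:E <= limn_einf (scaled_log_prob X theta b))%E,
          (limn_einf (scaled_log_prob X theta b) <=
           limn_esup (scaled_log_prob X theta b))%E &
          (limn_esup (scaled_log_prob X theta b) <= (- C2)%:E)%E]].
Proof.
have [c1 [c2 [m0 [e [c10 c20 m00 e0 hb]]]]] := walk_bounds hX hdelta hmoment.
exists c1, c2; split => // theta b theta0 b0 binf bo.
have powK x : 0 <= x -> x = (x `^ theta^-1) `^ theta :> R.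
  by move=> x0; rewrite -powRrM mulVf ?gt_eqF// powRr1.
have mlow : \forall n \near \oo, m0 <= b n `^ theta.
  have : \forall n \near \oo, m0 `^ theta^-1 <= b n by move/cvgryPge : binf; apply.
  apply: filterS => n h.
  rewrite [m0](powK _ (ltW m00)).
  by apply: ge0_ler_powR; rewrite ?nnegrE ?powR_ge0// ltW.
have mup : \forall n \near \oo, b n `^ theta <= e * n%:R.
  move/eqoP : bo => /(_ (e `^ theta^-1)); rewrite powR_gt0// => /(_ isT).
  apply: filterS => n; rewrite /= !ger0_norm ?powR_ge0 ?(ltW (b0 n))// -powRM ?(ltW e0)// => h.
  have n0 : 0 <= e * n%:R by rewrite mulr_ge0// ltW.
  rewrite [leRHS](powK _ n0).
  by apply: ge0_ler_powR; rewrite ?nnegrE ?powR_ge0// ltW.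
have hall : \forall n \near \oo,
    ((- c1)%:E <= scaled_log_prob X theta b n <= (- c2)%:E)%E.
  apply: filterS2 mlow mup => n h1 h2.
  by apply: scaled_log_prob_bounds => //; exact: hb.
split; last 2 first.
- exact: limn_einf_sup.
- by apply: limn_esup_le; apply: filterS hall => n /andP[].
- by apply: limn_einf_ge; apply: filterS hall => n /andP[].
Qed.
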